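(* Let $E \subset \mathbb{T}$ be a closed set of logarithmic capacity $0$. Let $g \in \mathcal{D}$ be non-vanishing on $\mathbb{D}$, and let $f \in C(E)$ be non-vanishing on $E$. Then there exists a sequence of polynomials $P_n$ which do not vanish on the closed unit disc $\overline{\mathbb{D}}$ such that $P_n \to g$ in $\mathcal{D}$ and $P_n \to f$ uniformly on $E$.
   Context: The Dirichlet space $\mathcal D$ consists of holomorphic $f(z)=\sum_k a_kz^k$ on the unit disc $\mathbb{D}$ with $\|f\|_{\mathcal D}^2=\sum_{k\ge0}(k+1)|a_k|^2<\infty$. $C(E)$ is the space of continuous functions on $E$ with the sup norm. *)

(* Defs.v *)
From HB Require Import structures.
From mathcomp Require Import all_boot all_order all_algebra.
From mathcomp Require Import all_classical all_reals all_analysis.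
From mathcomp Require Import complex.
Import Order.TTheory GRing.Theory Num.Theory.
Import numFieldNormedType.Exports.

Set Implicit Arguments.
Unset Strict Implicit.
Unset Printing Implicit Defensive.

Local Open Scope classical_set_scope.
Local Open Scope ring_scope.

Section Defs.
Variable R : realType.
Local Notation C := R[i].

Definition cabs (z : C) : R := ComplexField.Normc.normc z.

Definition cpt (p : R * R) : C := (p.1 +i* p.2)%C.

Definition cclosed (E : set C) : Prop :=
  forall z, (forall e : R, 0 < e -> exists2 w, E w & cabs (z - w) < e) -> E z.

Definition on_circle (E : set C) : Prop := forall z, E z -> cabs z = 1.

Definition ccontinuous_on (E : set C) (f : C -> C) : Prop :=
  forall z, E z -> forall e : R, 0 < e ->
    exists2 d : R, 0 < d & forall w, E w -> cabs (z - w) < d -> cabs (f z - f w) < e.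

Definition log_kernel (p q : R * R) : \bar R :=
  if cpt p == cpt q then +oo%E else (- ln (cabs (cpt p - cpt q)))%:E.

Definition log_energy (mu : {measure set (R * R)%type -> \bar R}) : \bar R :=
  (\int[mu]_p (\int[mu]_q log_kernel p q))%E.

Definition prob_measure_on (E : set C) (mu : {measure set (R * R)%type -> \bar R}) : Prop :=
  mu setT = 1%E /\ mu [set p | ~ E (cpt p)] = 0%E.

Definition robin_constant (E : set C) : \bar R :=
  ereal_inf [set log_energy mu | mu in prob_measure_on E].

(* logarithmic capacity cap(E) = exp(-V(E)), with exp(-oo) = 0.
   (V(E) = -oo cannot occur for E contained in the unit circle.) *)
Definition log_capacity (E : set C) : R :=
  match robin_constant E with
  | EFin v => expR (- v)
  | +oo%E => 0
  | -oo%E => 0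
  end.

(* Dirichlet space: power series  sum_k a_k z^k  with sum (k+1)|a_k|^2 < oo *)
Definition dirichlet_weighted (a : nat -> C) (k : nat) : R :=
  k.+1%:R * cabs (a k) ^+ 2.

Definition in_dirichlet (a : nat -> C) : Prop :=
  cvgn (series (dirichlet_weighted a)).

Definition dirichlet_norm (a : nat -> C) : R :=
  Num.sqrt (limn (series (dirichlet_weighted a))).

Definition psum (a : nat -> C) (z : C) (n : nat) : C :=
  \sum_(k < n) a k * z ^+ k.

Definition pseries_to (a : nat -> C) (z w : C) : Prop :=
  (fun n => cabs (psum a z n - w)) @ \oo --> (0 : R).

Definition pcoef (P : {poly C}) (k : nat) : C := P`_k.

End Defs.

(* Main.v *)
(* Everything is done with polynomials.  Capacity zero forces the discrete
   logarithmic energies of point configurations in [E] to be unbounded;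
   near-minimizing configurations yield polynomials [F] with nonnegative real
   part on the circle, large real part on [E], and small Dirichlet norm after
   normalization, so [h = 1 - (1 - F/m)^m] is bounded by [3] on the disc, close
   to [1] on [E] and, being a Lipschitz function of [F] in Douglas' double
   integral, small in the Dirichlet space.  If [|p| <= 1/4] on the disc,
   then [1 + p h] has no zero there, is close to [1] in the Dirichlet space, and
   is close to [1 + p] on [E].  Products [(1 + v/m)^m] give [exp v] for every
   continuous [v] on [E]; logarithms of the factors [z - a] then give every
   nonvanishing continuous function.  This is applied to [f / G], where [G] is a
   zero-free partial sum of a dilation [g(r z)]: the product of [G] with the
   resulting polynomial approximates [g] and [f] simultaneously. *)
Require Import Defs.
From HB Require Import structures.
From mathcomp Require Import all_boot all_order all_algebra.
From mathcomp Require Import all_classical all_reals all_analysis.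
From mathcomp Require Import measurable_realfun complex cyclic separable cyclotomic.
From mathcomp Require Import ring lra zify.
Import Order.TTheory GRing.Theory Num.Theory.
Import numFieldNormedType.Exports.
Set Implicit Arguments.
Unset Strict Implicit.
Unset Printing Implicit Defensive.
Local Open Scope classical_set_scope.
Local Open Scope ring_scope.

(** * Complex modulus and the Dirichlet norm of polynomials *)

(** Zero-freeness on the closed disc forces a cut-off whose sup bound does not deteriorate as its
    Dirichlet norm tends to [0]; hence powers [(1 - F/m)^m], whose modulus and Lipschitz constant in
    [F] are bounded uniformly in large [m]. The small norm rests on one comparison. The dyadic
    kernel has coefficients [c k >= 0] with [(k + 1) c k <= 4]. A potential with coefficients
    [c k * sig k] therefore has squared Dirichlet norm at most four times its energy
    [sum c k |sig k|^2], while for a near-minimal configuration its real part on [E] is at least the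
    energy [V'] minus [1]. Scaling by [2 N / V'] leaves a squared norm of order [N^2 / V']. Capacity
    is defined by measures, so large discrete energies are obtained by contraposition:
    configurations of bounded energy have limiting dyadic quantiles, and the image of Lebesgue
    measure under the limiting quantile function is a probability measure on [E] of finite energy.
    For [|a| < 1] the winding of [z - a] prevents a logarithm on the whole circle; a point of the
    circle outside [E] removes this obstruction. *)

Section Modulus.
Variable R : realType.
Local Notation C := R[i].
Implicit Types (x y z w : C) (r : R).

Lemma cabs_ge0 z : 0 <= cabs z.
Proof. by case: z => a b; rewrite /cabs /= sqrtr_ge0. Qed.

Lemma cabs0 : cabs (0 : C) = 0.
Proof. exact: ComplexField.Normc.normc0. Qed.

Lemma cabs1 : cabs (1 : C) = 1.
Proof. exact: ComplexField.Normc.normc1. Qed.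

Lemma cabs_eq0 z : (cabs z == 0) = (z == 0).
Proof.
apply/eqP/eqP => [/ComplexField.Normc.eq0_normc //|->]; exact: cabs0.
Qed.

Lemma cabs_gt0 z : (0 < cabs z) = (z != 0).
Proof. by rewrite lt_def cabs_ge0 cabs_eq0 andbT. Qed.

Lemma cabsM z w : cabs (z * w) = cabs z * cabs w.
Proof. exact: ComplexField.Normc.normcM. Qed.

Lemma cabsV z : cabs z^-1 = (cabs z)^-1.
Proof. exact: ComplexField.Normc.normcV. Qed.

Lemma cabsX z n : cabs (z ^+ n) = cabs z ^+ n.
Proof. by elim: n => [|n ih]; rewrite ?expr0 ?cabs1 // !exprS cabsM ih. Qed.

Lemma cabsN z : cabs (- z) = cabs z.
Proof. by case: z => a b; rewrite /cabs /= !sqrrN. Qed.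

Lemma cabsBC z w : cabs (z - w) = cabs (w - z).
Proof. by rewrite -cabsN opprB. Qed.

Lemma cabsD z w : cabs (z + w) <= cabs z + cabs w.
Proof. by have := ler_normD z w; rewrite !normc_def -rmorphD lecR; case: z w => a b [c d]. Qed.

Lemma cabsB z w : cabs (z - w) <= cabs z + cabs w.
Proof. by rewrite -(cabsN w) cabsD. Qed.

Lemma cabsDD x y z : cabs (x - z) <= cabs (x - y) + cabs (y - z).
Proof. by have -> : x - z = (x - y) + (y - z) by [ring]; exact: cabsD. Qed.

Lemma cabsJ z : cabs z^*%C = cabs z.
Proof. by case: z => a b; rewrite /cabs /= sqrrN. Qed.

Lemma cabs_sqr z : cabs z ^+ 2 = complex.Re z ^+ 2 + complex.Im z ^+ 2.
Proof. by case: z => a b; rewrite /cabs /= sqr_sqrtr // addr_ge0 ?sqr_ge0. Qed.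

Lemma mulJ_cabs z : z * z^*%C = ((cabs z ^+ 2)%:C)%C.
Proof.
rewrite cabs_sqr; case: z => a b /=; apply/eqP; rewrite eq_complex /=.
by apply/andP; split; apply/eqP; ring.
Qed.

Lemma cabs_real r : cabs (r%:C)%C = `|r|.
Proof. by rewrite /cabs /= expr0n /= addr0 sqrtr_sqr. Qed.

Lemma natCE n : (n%:R : C) = ((n%:R : R)%:C)%C.
Proof. by rewrite rmorph_nat. Qed.

Lemma cabs_nat n : cabs (n%:R : C) = n%:R.
Proof. by rewrite natCE cabs_real normr_nat. Qed.

Lemma cabs_sum (I : Type) (s : seq I) (P : pred I) (F : I -> C) :
  cabs (\sum_(i <- s | P i) F i) <= \sum_(i <- s | P i) cabs (F i).
Proof.
elim/big_rec2: _ => [|i y1 y2 _ h]; first by rewrite cabs0.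
by apply: (le_trans (cabsD _ _)); rewrite lerD2l.
Qed.

Lemma ler_Re_cabs z : `|complex.Re z| <= cabs z.
Proof.
case: z => a b; rewrite /cabs /= -sqrtr_sqr ler_wsqrtr //.
by rewrite lerDl sqr_ge0.
Qed.

Lemma ler_Im_cabs z : `|complex.Im z| <= cabs z.
Proof.
case: z => a b; rewrite /cabs /= -sqrtr_sqr ler_wsqrtr //.
by rewrite lerDr sqr_ge0.
Qed.

Lemma cabs_le_ReIm z : cabs z <= `|complex.Re z| + `|complex.Im z|.
Proof.
rewrite -(ler_pXn2r (n := 2)) ?nnegrE ?cabs_ge0 ?addr_ge0 //.
rewrite cabs_sqr sqrrD !real_normK ?num_real //.
have := mulr_ge0 (normr_ge0 (complex.Re z)) (normr_ge0 (complex.Im z)); lra.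
Qed.

Lemma cabsB_sqr z w :
  cabs (z - w) ^+ 2 = cabs z ^+ 2 + cabs w ^+ 2 - 2 * complex.Re (z * w^*%C).
Proof. rewrite !cabs_sqr; case: z w => a b [c d] /=; ring. Qed.

Lemma cabsD_sqr z w :
  cabs (z + w) ^+ 2 = cabs z ^+ 2 + cabs w ^+ 2 + 2 * complex.Re (z * w^*%C).
Proof. rewrite !cabs_sqr; case: z w => a b [c d] /=; ring. Qed.

Lemma cabsD_sqr_le z w :
  cabs (z + w) ^+ 2 <= 2 * cabs z ^+ 2 + 2 * cabs w ^+ 2.
Proof.
rewrite !cabs_sqr; case: z w => a b [c d] /=.
have := sqr_ge0 (a - c); have := sqr_ge0 (b - d); nra.
Qed.

(** The powers are bounded rather than the bases, because the bases used later, such as [1 - u/m],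
    may have modulus slightly above [1]. The factor [n] is cancelled there by a difference of bases
    of order [1/n]. *)
Lemma cabs_expB_le z w (A B : R) n :
  (forall k, (k <= n)%N -> cabs z ^+ k <= A) ->
  (forall k, (k <= n)%N -> cabs w ^+ k <= B) ->
  cabs (z ^+ n - w ^+ n) <= n%:R * (A * B) * cabs (z - w).
Proof.
move=> hA hB; rewrite subrXX cabsM mulrC ler_wpM2r ?cabs_ge0 //.
apply: (le_trans (cabs_sum _ _ _)).
apply: (@le_trans _ _ (\sum_(i < n) (A * B))); last first.
  by rewrite sumr_const card_ord mulr_natl.
apply: ler_sum => i _; rewrite cabsM !cabsX.
apply: ler_pM; rewrite ?exprn_ge0 ?cabs_ge0 //.
  by apply/hA/(leq_trans (leq_subr _ _))/leq_pred.
by apply/hB/ltnW.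
Qed.

End Modulus.

Section PolynomialsOnTheDisc.
Variable R : realType.
Local Notation C := R[i].
Implicit Types (p q G : {poly C}) (b c : nat -> C) (e : R).

Lemma poly_bounded p :
  exists2 B : R, 0 < B & forall z, cabs z <= 1 -> cabs p.[z] <= B.
Proof.
elim/poly_ind: p => [|p c [B B0 hB]].
  by exists 1 => // z _; rewrite horner0 cabs0 ler01.
exists (B + cabs c); first by rewrite ltr_wpDr ?cabs_ge0.
move=> z hz; rewrite hornerD hornerM hornerX hornerC.
apply: (le_trans (cabsD _ _)); rewrite lerD2r cabsM.
by rewrite -[leRHS]mulr1 ler_pM ?cabs_ge0 ?hB.
Qed.

Lemma poly_lipschitz p :
  exists2 L : R, 0 <= L & forall z w, cabs z <= 1 -> cabs w <= 1 ->
    cabs (p.[z] - p.[w]) <= L * cabs (z - w).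
Proof.
elim/poly_ind: p => [|p c [L L0 hL]].
  by exists 0 => // z w _ _; rewrite !horner0 subrr cabs0 mul0r.
have [B B0 hB] := poly_bounded p.
exists (L + B); first by rewrite addr_ge0 // ltW.
move=> z w hz hw; rewrite !hornerD !hornerM !hornerX !hornerC.
have -> : p.[z] * z + c - (p.[w] * w + c) = (p.[z] - p.[w]) * z + p.[w] * (z - w).
  by ring.
apply: (le_trans (cabsD _ _)); rewrite [leRHS]mulrDl !cabsM; apply: lerD.
  by rewrite -[leRHS]mulr1 ler_pM ?cabs_ge0 ?hL.
by rewrite ler_wpM2r ?cabs_ge0 ?hB.
Qed.

(* [dle b e] says that the Dirichlet norm of [sum_k b_k z^k] is at most
   [sqrt e]; squared norms are used throughout, so the triangle inequality is
   replaced by the cruder [dle_add]. *)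
Definition dle b e := forall n, \sum_(k < n) dirichlet_weighted b k <= e.

Lemma dirichlet_weighted_ge0 b k : 0 <= dirichlet_weighted b k.
Proof. by rewrite mulr_ge0 ?exprn_ge0 ?cabs_ge0. Qed.

Lemma dle_le b e1 e2 : e1 <= e2 -> dle b e1 -> dle b e2.
Proof. by move=> he hb n; exact: le_trans (hb n) he. Qed.

Lemma dle_ge0 b e : dle b e -> 0 <= e.
Proof. by move=> /(_ 0%N); rewrite big_ord0. Qed.

Lemma dle_eq b c e : b =1 c -> dle b e -> dle c e.
Proof.
move=> h hb n; rewrite (eq_bigr (fun k : 'I_n => dirichlet_weighted b k)).
  exact: hb.
by move=> k _; rewrite /dirichlet_weighted h.
Qed.

Lemma dle_add b c e1 e2 :
  dle b e1 -> dle c e2 -> dle (fun k => b k + c k) (2 * e1 + 2 * e2).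
Proof.
move=> hb hc n; apply: (@le_trans _ _ (\sum_(k < n)
    (2 * dirichlet_weighted b k + 2 * dirichlet_weighted c k))).
  apply: ler_sum => k _; rewrite /dirichlet_weighted.
  have -> (u v m : R) : 2 * (m * u) + 2 * (m * v) = m * (2 * u + 2 * v) by ring.
  by rewrite ler_wpM2l ?cabsD_sqr_le.
rewrite big_split /= -!mulr_sumr.
by apply: lerD; apply: ler_wpM2l => //; [exact: hb | exact: hc].
Qed.

Lemma dle_scale b e (a : C) : dle b e -> dle (fun k => a * b k) (cabs a ^+ 2 * e).
Proof.
move=> hb n; apply: (@le_trans _ _ (\sum_(k < n)
    (cabs a ^+ 2 * dirichlet_weighted b k))).
  by apply: ler_sum => k _; rewrite /dirichlet_weighted cabsM exprMn mulrCA.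
by rewrite -mulr_sumr ler_wpM2l ?exprn_ge0 ?cabs_ge0 //; exact: hb.
Qed.

Lemma dle_mulX p e : dle (pcoef p) e -> dle (pcoef (p * 'X)) (2 * e).
Proof.
move=> hp [|n]; first by rewrite big_ord0 mulr_ge0 // (dle_ge0 hp).
rewrite big_ord_recl /dirichlet_weighted /pcoef coefMX eqxx cabs0 expr0n mulr0 add0r.
apply: (@le_trans _ _ (2 * \sum_(k < n) dirichlet_weighted (pcoef p) k));
  last by rewrite ler_wpM2l //; exact: hp.
rewrite mulr_sumr; apply: ler_sum => k _.
rewrite coefMX /= /dirichlet_weighted /pcoef mulrA.
rewrite ler_wpM2r ?exprn_ge0 ?cabs_ge0 //.
by rewrite -natrM ler_nat /bump leq0n add1n mul2n -addnn addSn ltnS leq_addl.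
Qed.

(** A fixed polynomial is a bounded multiplier. The constant depends on [G] alone, so the other
    factor may be chosen after [G]. Horner's scheme reduces the claim to the shift, which at most
    doubles the weights. *)
Lemma dle_mull G : exists2 B : R, 0 < B & forall p e,
  dle (pcoef p) e -> dle (pcoef (G * p)) (B * e).
Proof.
elim/poly_ind: G => [|G c [B B0 hB]].
  exists 1 => // p e hp n; rewrite mul0r mul1r.
  rewrite big1 ?(dle_ge0 hp) // => k _.
  by rewrite /dirichlet_weighted /pcoef coef0 cabs0 expr0n mulr0.
exists (4 * B + 2 * cabs c ^+ 2).
  by rewrite ltr_wpDr ?mulr_gt0 // mulr_ge0 ?exprn_ge0 ?cabs_ge0.
move=> p e hp.
have h1 := dle_mulX (hB _ _ hp); have h2 := dle_scale c hp.
have := dle_add h1 h2.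
have -> : 2 * (2 * (B * e)) + 2 * (cabs c ^+ 2 * e) =
  (4 * B + 2 * cabs c ^+ 2) * e by ring.
apply: dle_eq => k; rewrite /pcoef mulrDl coefD coefCM; congr (_`_k + _).
by rewrite mulrAC.
Qed.

End PolynomialsOnTheDisc.

(** * Roots of unity and Douglas' formula *)

Section RootsOfUnity.
Variable R : realType.
Local Notation C := R[i].
Implicit Types (p q P Q : {poly C}) (w z : C).

Lemma prim_root_exists n : (0 < n)%N -> exists w : C, n.-primitive_root w.
Proof.
move=> n0; pose p : {poly C} := 'X^n - 1.
have [r Dp] := closed_field_poly_normal p.
rewrite (monicP _) ?monicXnsubC // scale1r in Dp.
have rn1 : all n.-unity_root r by apply/allP=> z; rewrite -root_prod_XsubC -Dp.
have sz_r : (n < (size r).+1)%N.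
  by rewrite -(size_prod_XsubC r id) -Dp size_XnsubC.
have [|z _ hz] := hasP (has_prim_root n0 rn1 _ sz_r); last by exists z.
by rewrite -separable_prod_XsubC -Dp separable_Xn_sub_1 // pnatr_eq0 -lt0n.
Qed.

Lemma cabs_unity_root n w : (0 < n)%N -> w ^+ n = 1 -> cabs w = 1.
Proof.
move=> n0 hw; have : cabs w ^+ n = 1 by rewrite -cabsX hw cabs1.
by move/eqP; rewrite pexpr_eq1 ?cabs_ge0 // => /eqP.
Qed.

Lemma cabs_prim_root n w k : n.-primitive_root w -> cabs (w ^+ k) = 1.
Proof.
move=> hw; rewrite cabsX.
by rewrite (cabs_unity_root (prim_order_gt0 hw) (prim_expr_order hw)) expr1n.
Qed.

Lemma prim_root_orthogonality n w k l : n.-primitive_root w ->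
  (k < n)%N -> (l < n)%N ->
  \sum_(j < n) (w ^+ j) ^+ k * ((w ^+ j) ^+ l)^*%C = (k == l)%:R * n%:R.
Proof.
move=> hw hk hl; pose x := w ^+ k * (w ^+ l)^*%C.
have -> : \sum_(j < n) (w ^+ j) ^+ k * ((w ^+ j) ^+ l)^*%C = \sum_(j < n) x ^+ j.
  apply: eq_bigr => j _; rewrite /x exprMn -!rmorphXn /= -!exprM.
  by rewrite (mulnC j) (mulnC j).
have hx : x * w ^+ l = w ^+ k.
  by rewrite /x -mulrA [_^*%C * _]mulrC mulJ_cabs (cabs_prim_root l hw) expr1n mulr1.
have [kl|kl] := eqVneq k l.
  have -> : x = 1.
    by apply: (mulIf (x := w ^+ l)); rewrite ?hx ?kl ?mul1r // -cabs_gt0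
      (cabs_prim_root l hw).
  under eq_bigr do rewrite expr1n.
  by rewrite sumr_const card_ord mul1r.
rewrite mul0r.
have x1 : x - 1 != 0.
  rewrite subr_eq0; apply: contra_neq kl => x1; move: hx; rewrite x1 mul1r => /eqP.
  by rewrite (eq_prim_root_expr hw) !modn_small // => /eqP ->.
apply: (mulfI x1); rewrite mulr0 -subrX1 /x exprMn -rmorphXn /= -!exprM.
by rewrite mulnC exprM mulnC exprM (prim_expr_order hw) !expr1n conjc1 mulr1 subrr.
Qed.

(** Sampling at the [n]-th roots of unity is exact below degree [n]; such finite sums stand in for
    integrals over the circle. *)
Lemma parseval n w p : n.-primitive_root w -> (size p <= n)%N ->
  \sum_(j < n) cabs p.[w ^+ j] ^+ 2 = n%:R * \sum_(k < n) cabs p`_k ^+ 2.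
Proof.
move=> hw sp; apply: complexI.
rewrite rmorphM rmorph_nat !rmorph_sum /=.
transitivity (\sum_(j < n) \sum_(k < n) \sum_(l < n)
   (p`_k * (p`_l)^*%C) * ((w ^+ j) ^+ k * ((w ^+ j) ^+ l)^*%C)).
  apply: eq_bigr => j _; rewrite -mulJ_cabs (horner_coef_wide _ sp).
  rewrite rmorph_sum /= mulr_suml; apply: eq_bigr => k _.
  rewrite mulr_sumr; apply: eq_bigr => l _; rewrite rmorphM /=; ring.
rewrite exchange_big mulr_sumr /=; apply: eq_bigr => k _.
rewrite exchange_big /= (bigD1 k) //= [X in _ + X]big1 ?addr0.
  rewrite -mulr_sumr (prim_root_orthogonality hw) // eqxx mul1r mulJ_cabs.
  by rewrite mulrC.
move=> l kl; rewrite -mulr_sumr (prim_root_orthogonality hw) //.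
by rewrite eq_sym (negbTE kl : (l : nat) == k = false) mul0r mulr0.
Qed.

(* The value at [d = 0] is [0 / 0 = 0]. *)
Lemma sum_geometric_quotient n w k : n.-primitive_root w -> (k <= n)%N ->
  \sum_(d < n) cabs ((w ^+ d) ^+ k - 1) ^+ 2 / cabs (w ^+ d - 1) ^+ 2
  = k%:R * (n%:R - k%:R).
Proof.
move=> hw kn; have n0 := prim_order_gt0 hw.
(* For [z != 1] the quotient is [|g(z)|^2] with [g = 1 + ... + z^(k-1)]. Parseval gives [n k] over
   all roots, and the term [k^2] at [z = 1] is the one missing on the left. *)
pose g : {poly C} := \poly_(l < k) 1.
have sg : (size g <= n)%N by apply: leq_trans (size_poly _ _) kn.
have hg z : g.[z] = \sum_(l < k) z ^+ l.
  by rewrite horner_poly; apply: eq_bigr => l _; rewrite mul1r.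
have := parseval hw sg.
have -> : \sum_(i < n) cabs g`_i ^+ 2 = k%:R.
  rewrite (eq_bigr (fun i : 'I_n => (if (i < k)%N then 1 else 0) : R)); last first.
    by move=> i _; rewrite coef_poly; case: ifP; rewrite ?cabs1 ?cabs0 ?expr1n ?expr0n.
  rewrite -(big_mkord xpredT (fun i => (if (i < k)%N then 1 else 0) : R)).
  rewrite (big_cat_nat (n := k)) //= [X in _ + X]big_nat_cond.
  rewrite [X in _ + X]big1 ?addr0; last by move=> i /andP[/andP[ki _] _]; rewrite ltnNge ki.
  rewrite big_nat_cond (eq_bigr (fun=> 1)); last by move=> i /andP[/andP[_ ->] _].
  by rewrite -big_nat_cond big_mkord sumr_const card_ord.
case: n n0 hw kn sg => // n _ hw kn sg.
rewrite !big_ord_recl /= !expr0 expr1n subrr cabs0 expr0n /= mul0r add0r.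
have -> : cabs g.[1] ^+ 2 = k%:R ^+ 2.
  rewrite hg; under eq_bigr do rewrite expr1n.
  by rewrite sumr_const card_ord cabs_nat.
have -> : \sum_(i < n) cabs g.[w ^+ lift ord0 i] ^+ 2 =
    \sum_(i < n) cabs ((w ^+ lift ord0 i) ^+ k - 1) ^+ 2 / cabs (w ^+ lift ord0 i - 1) ^+ 2.
  apply: eq_bigr => i _; rewrite subrX1 cabsM -hg exprMn.
  rewrite mulrAC divff ?mul1r // expf_neq0 // cabs_eq0 subr_eq0.
  rewrite -[1](expr0 w) (eq_prim_root_expr hw) mod0n modn_small; last exact: ltn_ord.
  by [].
move=> /= h; rewrite mulrBr -expr2; move: h; set S := \sum_(i < n) _ => h.
by rewrite [k%:R * _]mulrC -h addrAC subrr add0r.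
Qed.

(* A discrete form of Douglas' formula for the Dirichlet integral. *)
Lemma discrete_douglas n w p : n.-primitive_root w -> (size p <= n)%N ->
  \sum_(d < n) \sum_(i < n)
     cabs (p.[w ^+ (i + d)] - p.[w ^+ i]) ^+ 2 / cabs (w ^+ d - 1) ^+ 2
  = n%:R * \sum_(k < n) cabs p`_k ^+ 2 * (k%:R * (n%:R - k%:R)).
Proof.
move=> hw sp.
transitivity (\sum_(d < n) n%:R * \sum_(k < n)
   cabs p`_k ^+ 2 * (cabs ((w ^+ d) ^+ k - 1) ^+ 2 / cabs (w ^+ d - 1) ^+ 2)).
  apply: eq_bigr => d _; rewrite -mulr_suml.
  (* [q] is the difference of the rotated polynomial [p (w^d z)] and [p], so Parseval applies for
     each [d]. *)
  pose q : {poly C} := \poly_(k < n) (p`_k * ((w ^+ d) ^+ k - 1)).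
  have := parseval hw (size_poly n (fun k => p`_k * ((w ^+ d) ^+ k - 1))).
  rewrite -/q => h.
  have -> : \sum_(i < n) cabs (p.[w ^+ (i + d)] - p.[w ^+ i]) ^+ 2 =
      \sum_(i < n) cabs q.[w ^+ i] ^+ 2.
    apply: eq_bigr => i _; congr (cabs _ ^+ 2).
    rewrite !(horner_coef_wide _ sp) horner_poly -sumrB; apply: eq_bigr => k _.
    by rewrite exprD exprMn; ring.
  rewrite h -mulrA mulr_suml; congr (_ * _); apply: eq_bigr => k _.
  by rewrite coef_poly ltn_ord cabsM exprMn mulrA.
rewrite -mulr_sumr exchange_big /=; congr (_ * _); apply: eq_bigr => k _.
by rewrite -mulr_sumr (sum_geometric_quotient hw) // ltnW.
Qed.

Lemma dle_poly p n e : (size p <= n)%N ->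
  \sum_(k < n) dirichlet_weighted (pcoef p) k <= e -> dle (pcoef p) e.
Proof.
move=> sp he m; apply: le_trans he.
rewrite -!(big_mkord xpredT (dirichlet_weighted (pcoef p))).
have [mn|nm] := leqP m n.
  rewrite [leRHS](big_cat_nat (n := m)) //= lerDl sumr_ge0 // => i _.
  exact: dirichlet_weighted_ge0.
rewrite (big_cat_nat (n := n)) ?(ltnW nm) //= gerDl big_nat_cond big1 //.
move=> i /andP[/andP[ni _] _].
by rewrite /dirichlet_weighted /pcoef nth_default ?cabs0 ?expr0n ?mulr0 // (leq_trans sp).
Qed.

(** The norm splits into [sum |p_k|^2], a mean of squared values on the circle, and [sum k |p_k|^2],
    a sum of squared difference quotients. Both only see values on the circle, so the two pointwise
    dominations transfer term by term. *)
Lemma dle_lipschitz P Q (K e : R) :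
  (forall z w, cabs z = 1 -> cabs w = 1 ->
     cabs (P.[z] - P.[w]) <= K * cabs (Q.[z] - Q.[w])) ->
  (forall z, cabs z = 1 -> cabs P.[z] <= K * cabs Q.[z]) ->
  dle (pcoef Q) e -> dle (pcoef P) (2 * K ^+ 2 * e).
Proof.
move=> hL hB hQ; pose n := (maxn (size P) (size Q)).+1.
have sP : (size P <= n)%N by rewrite /n leqW // leq_maxl.
have sQ : (size Q <= n)%N by rewrite /n leqW // leq_maxr.
have n2 : (n <= n + n)%N by rewrite leq_addr.
(* With twice as many nodes as coefficients, [k (2n - k)] lies between [n k] and [2 n k]. The
   discrete Douglas sum is then the Dirichlet integral up to a factor [2], the one in
   [2 * K ^+ 2]. *)
have [w hw] := @prim_root_exists (n + n)%N isT.
have hN : (0 : R) < (n + n)%:R by rewrite ltr0n.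
have wide (p : {poly C}) (F : nat -> R) : (size p <= n)%N ->
    \sum_(k < n + n) cabs p`_k ^+ 2 * F k = \sum_(k < n) cabs p`_k ^+ 2 * F k.
  move=> sp; rewrite big_split_ord /= [X in _ + X]big1 ?addr0 // => k _.
  by rewrite nth_default ?cabs0 ?expr0n ?mul0r // (leq_trans sp) ?leq_addr.
have sqK (u v : C) : cabs u <= K * cabs v -> cabs u ^+ 2 <= K ^+ 2 * cabs v ^+ 2.
  by move=> h; rewrite -exprMn lerXn2r ?nnegrE ?cabs_ge0 // (le_trans _ h) ?cabs_ge0.
have h1 : \sum_(k < n) cabs P`_k ^+ 2 <= K ^+ 2 * \sum_(k < n) cabs Q`_k ^+ 2.
  have [w1 hw1] := @prim_root_exists n isT.
  rewrite -(ler_pM2l (x := n%:R)) ?ltr0n // mulrCA -!(parseval hw1) // mulr_sumr.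
  by apply: ler_sum => j _; rewrite sqK ?hB ?(cabs_prim_root _ hw1).
have h2 : \sum_(k < n) cabs P`_k ^+ 2 * (k%:R * ((n + n)%:R - k%:R))
    <= K ^+ 2 * \sum_(k < n) cabs Q`_k ^+ 2 * (k%:R * ((n + n)%:R - k%:R)).
  rewrite -(ler_pM2l hN) mulrCA.
  rewrite -!(wide _ (fun k => k%:R * ((n + n)%:R - k%:R))) //.
  rewrite -!(discrete_douglas hw) ?(leq_trans _ n2) // mulr_sumr.
  apply: ler_sum => d _; rewrite mulr_sumr; apply: ler_sum => i _.
  rewrite mulrA ler_wpM2r ?invr_ge0 ?exprn_ge0 ?cabs_ge0 //.
  by rewrite sqK ?hL ?(cabs_prim_root _ hw).
have hn : (0 : R) < n%:R by rewrite ltr0n.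
have kn (k : 'I_n) : (k%:R : R) <= n%:R by rewrite ler_nat ltnW.
have h3 : \sum_(k < n) cabs P`_k ^+ 2 * k%:R <=
    2 * K ^+ 2 * \sum_(k < n) cabs Q`_k ^+ 2 * k%:R.
  rewrite -(ler_pM2l hn); apply: le_trans (le_trans h2 _).
    rewrite mulr_sumr; apply: ler_sum => k _.
    rewrite mulrCA ler_wpM2l ?exprn_ge0 ?cabs_ge0 // mulrC ler_wpM2l //.
    by rewrite natrD; have := kn k; lra.
  have -> (S : R) : n%:R * (2 * K ^+ 2 * S) = K ^+ 2 * ((n + n)%:R * S).
    by rewrite natrD; ring.
  rewrite ler_wpM2l ?sqr_ge0 // mulr_sumr; apply: ler_sum => k _.
  rewrite [leRHS]mulrCA ler_wpM2l ?exprn_ge0 ?cabs_ge0 // mulrC ler_wpM2r //.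
  by rewrite gerBl.
apply: (dle_poly sP); apply: (@le_trans _ _
    (2 * K ^+ 2 * \sum_(k < n) dirichlet_weighted (pcoef Q) k)); last first.
  by apply: ler_wpM2l; [rewrite mulr_ge0 ?sqr_ge0 | exact: hQ].
have split (p : {poly C}) : \sum_(k < n) dirichlet_weighted (pcoef p) k =
    \sum_(k < n) cabs p`_k ^+ 2 * k%:R + \sum_(k < n) cabs p`_k ^+ 2.
  rewrite -big_split /=; apply: eq_bigr => k _.
  by rewrite /dirichlet_weighted /pcoef -addn1 natrD; ring.
rewrite !split mulrDr; apply: lerD => //; apply: (le_trans h1).
rewrite ler_wpM2r ?sumr_ge0 // => [k _|]; first by rewrite exprn_ge0 ?cabs_ge0.
by have := sqr_ge0 K; lra.
Qed.

Lemma coef_le_circle_bound p (M : R) k :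
  (forall z, cabs z = 1 -> cabs p.[z] <= M) -> cabs p`_k <= M.
Proof.
move=> hM; have M0 : 0 <= M by apply: le_trans (hM 1 (cabs1 _)); exact: cabs_ge0.
pose n := (maxn (size p) k).+1.
have [w hw] := @prim_root_exists n isT.
have kn : (k < n)%N by rewrite ltnS leq_maxr.
have sp : (size p <= n)%N by rewrite leqW ?leq_maxl.
rewrite -(ler_pXn2r (n := 2)) ?nnegrE ?cabs_ge0 //.
apply: (@le_trans _ _ (\sum_(k < n) cabs p`_k ^+ 2)).
  rewrite (bigD1 (Ordinal kn)) //= lerDl sumr_ge0 // => i _.
  by rewrite exprn_ge0 ?cabs_ge0.
rewrite -(ler_pM2l (x := n%:R)) ?ltr0n // -(parseval hw) //.
apply: (@le_trans _ _ (\sum_(j < n) M ^+ 2)).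
  apply: ler_sum => j _; rewrite lerXn2r ?nnegrE ?cabs_ge0 ?hM //.
  exact: (cabs_prim_root _ hw).
by rewrite sumr_const card_ord mulr_natl.
Qed.

(** Bernoulli's inequality for the square root of [x], once squared, gives growth quadratic in
    [n]. *)
Lemma linear_lt_expr (x : R) (d : nat) : 1 < x -> exists n, n%:R * d%:R + 1 < x ^+ n.
Proof.
move=> x1; pose s := Num.sqrt x.
have s1 : 1 < s by rewrite /s -[1]sqrtr1 ltr_sqrt // (lt_trans _ x1).
pose y := s - 1; have y0 : 0 < y by rewrite subr_gt0.
have [n hn] : exists n : nat, d%:R / y ^+ 2 < n%:R.
  exists (Num.bound (d%:R / y ^+ 2)); apply: archi_boundP.
  by rewrite divr_ge0 ?sqr_ge0.
have bern m : 1 + m%:R * y <= s ^+ m.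
  elim: m => [|m ih]; first by rewrite mul0r addr0 expr0.
  rewrite exprS; apply: (@le_trans _ _ (s * (1 + m%:R * y))).
    have -> : s = 1 + y by rewrite /y; ring.
    rewrite -natr1; have : 0 <= m%:R * y ^+ 2 by rewrite mulr_ge0 ?sqr_ge0.
    nra.
  by rewrite ler_wpM2l // ltW // (lt_trans _ s1).
exists n; have -> : x = s ^+ 2 by rewrite sqr_sqrtr // ltW // (lt_trans _ x1).
rewrite -exprM mulnC exprM; have := bern n.
have n0 : 0 < n%:R :> R by apply: le_lt_trans hn; rewrite divr_ge0 ?sqr_ge0.
move: hn; rewrite ltr_pdivrMr ?exprn_gt0 // => hn hb.
apply: (@lt_le_trans _ _ ((1 + n%:R * y) ^+ 2)); last first.
  by rewrite lerXn2r ?nnegrE ?addr_ge0 ?mulr_ge0 ?exprn_ge0 // ltW // (lt_trans _ s1).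
have h2 : n%:R * d%:R < n%:R * (n%:R * y ^+ 2) by rewrite ltr_pM2l.
have h3 : 0 < n%:R * y by rewrite mulr_gt0.
rewrite sqrrD expr1n mul1r exprMn; lra.
Qed.

(* The coefficients of [p ^+ n] are at most [M ^+ n], so that
   [|p(z)|^n <= (n deg p + 1) M^n] on the disc; let [n] tend to infinity. *)
Lemma maximum_principle p (M : R) :
  (forall z, cabs z = 1 -> cabs p.[z] <= M) ->
  forall z, cabs z <= 1 -> cabs p.[z] <= M.
Proof.
move=> hM z hz; have M0 : 0 <= M by apply: le_trans (hM 1 (cabs1 _)); exact: cabs_ge0.
have hn n : cabs p.[z] ^+ n <= (n%:R * (size p)%:R + 1) * M ^+ n.
  rewrite -cabsX -horner_exp horner_coef; apply: (le_trans (cabs_sum _ _ _)).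
  apply: (@le_trans _ _ (\sum_(k < size (p ^+ n)) M ^+ n)).
    apply: ler_sum => k _; rewrite cabsM cabsX -[leRHS]mulr1.
    apply: ler_pM; rewrite ?exprn_ge0 ?cabs_ge0 ?exprn_ile1 ?cabs_ge0 //.
    apply: coef_le_circle_bound => u hu.
    by rewrite horner_exp cabsX lerXn2r ?nnegrE ?cabs_ge0 ?hM.
  rewrite sumr_const card_ord -[leLHS]mulr_natl ler_wpM2r ?exprn_ge0 //.
  rewrite -natrM natr1 ler_nat; apply: leq_trans (size_poly_exp_leq _ _) _.
  by rewrite ltnS mulnC leq_mul2l leq_pred orbT.
rewrite leNgt; apply/negP => hlt.
have [M1|M1] := eqVneq M 0.
  by move: (hn 1%N) hlt; rewrite M1 !expr1 mulr0 => h1 h2; move: (lt_le_trans h2 h1); rewrite ltxx.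
have {}M0 : 0 < M by rewrite lt_def M1.
have hx : 1 < cabs p.[z] / M by rewrite ltr_pdivlMr // mul1r.
have [n] := linear_lt_expr (size p) hx.
by rewrite expr_div_n ltr_pdivlMr ?exprn_gt0 // ltNge hn.
Qed.

End RootsOfUnity.

(** * Near-minimal energy configurations *)

Section DyadicKernel.
Variable R : realType.
Local Notation C := R[i].
Implicit Types (z w x y : C) (s : seq C).

(* The function [(D_m z)^2 / m^2] with [D_m] the Dirichlet kernel: on the
   circle it is a bump of height [1] and width [1/m] around [1], and it is
   positive definite.  Summed over dyadic [m] it is comparable to the
   logarithmic kernel. *)
Definition bump_ker (m : nat) z : R := cabs (\sum_(a < m) z ^+ a) ^+ 2 / m%:R ^+ 2.

Definition dyadic_ker (J : nat) z : R := \sum_(j < J) bump_ker (2 ^ j) z.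

(** Coefficients of [m] times the Fejer kernel, folded onto nonnegative frequencies (hence the
    doubling), since only the real part of the polynomial is used. Truncated subtraction gives [0]
    for positive [k >= m]. *)
Definition fejer_coef (m k : nat) : nat := if k == 0%N then m else (m - k).*2.

Definition dyadic_coef (J k : nat) : R :=
  \sum_(j < J) (fejer_coef (2 ^ j) k)%:R / (2 ^ j)%:R ^+ 2.

Definition dyadic_poly J : {poly C} := \poly_(k < 2 ^ J) ((dyadic_coef J k)%:C)%C.

Lemma sum_ord_const n (c : R) : \sum_(i < n) c = n%:R * c.
Proof. by rewrite sumr_const card_ord mulr_natl. Qed.

Lemma bump_ker_ge0 m z : 0 <= bump_ker m z.
Proof. by rewrite divr_ge0 ?sqr_ge0. Qed.

Lemma dyadic_ker_ge0 J z : 0 <= dyadic_ker J z.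
Proof. by apply: sumr_ge0 => j _; exact: bump_ker_ge0. Qed.

Lemma dyadic_kerS J z : dyadic_ker J.+1 z = dyadic_ker J z + bump_ker (2 ^ J) z.
Proof. by rewrite /dyadic_ker big_ord_recr. Qed.

Lemma bump_ker1 m : (0 < m)%N -> bump_ker m 1 = 1.
Proof.
move=> m0; rewrite /bump_ker; under eq_bigr do rewrite expr1n.
by rewrite sumr_const card_ord cabs_nat divff // expf_neq0 // pnatr_eq0 -lt0n.
Qed.

Lemma dyadic_ker1 J : dyadic_ker J 1 = J%:R.
Proof.
rewrite /dyadic_ker (eq_bigr (fun=> 1)) ?sumr_const ?card_ord // => j _.
by rewrite bump_ker1 // expn_gt0.
Qed.

Lemma bump_ker_le1 m z : cabs z <= 1 -> bump_ker m z <= 1.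
Proof.
move=> hz; rewrite /bump_ker; case: m => [|m].
  by rewrite big_ord0 cabs0 expr0n /= mul0r.
rewrite ler_pdivrMr ?exprn_gt0 ?ltr0n // mul1r lerXn2r ?nnegrE ?cabs_ge0 //.
apply: (le_trans (cabs_sum _ _ _)).
apply: (@le_trans _ _ (\sum_(a < m.+1) 1)); last by rewrite sumr_const card_ord.
by apply: ler_sum => a _; rewrite cabsX exprn_ile1 ?cabs_ge0.
Qed.

Lemma dyadic_ker_le J z : cabs z <= 1 -> dyadic_ker J z <= J%:R.
Proof.
move=> hz; apply: (@le_trans _ _ (\sum_(j < J) 1)); last by rewrite sumr_const card_ord.
by apply: ler_sum => j _; exact: bump_ker_le1.
Qed.

Lemma dyadic_kerJ J z : dyadic_ker J z^*%C = dyadic_ker J z.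
Proof.
apply: eq_bigr => j _; rewrite /bump_ker -[in RHS]cabsJ rmorph_sum /=.
by congr (cabs _ ^+ 2 / _); apply: eq_bigr => a _; rewrite rmorphXn.
Qed.

Lemma le_dyadic_ker J J' z : (J <= J')%N -> dyadic_ker J z <= dyadic_ker J' z.
Proof.
move=> /subnK <-; elim: (J' - J)%N => // n ih.
by rewrite addSn dyadic_kerS (le_trans ih) // lerDl bump_ker_ge0.
Qed.

(** Each [1 - z^a] with [a < m] has modulus at most [m |z - 1| <= 1/2], so the sum of the [z^a] has
    modulus at least [m/2]. *)
Lemma bump_ker_ge m z : (0 < m)%N -> cabs z <= 1 ->
  2 * m%:R * cabs (z - 1) <= 1 -> 1 / 4 <= bump_ker m z.
Proof.
move=> m0 hz hm; have m0' : 0 < m%:R :> R by rewrite ltr0n.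
rewrite /bump_ker ler_pdivlMr ?exprn_gt0 //.
have h1 : m%:R / 2 <= cabs (\sum_(a < m) z ^+ a).
  have -> : \sum_(a < m) z ^+ a = m%:R - \sum_(a < m) (1 - z ^+ a).
    by rewrite sumrB sumr_const card_ord opprB addrC subrK.
  have h2 : cabs (\sum_(a < m) (1 - z ^+ a)) <= m%:R / 2.
    apply: (le_trans (cabs_sum _ _ _)).
    apply: (@le_trans _ _ (\sum_(a < m) (1 / 2))); last first.
      by rewrite sum_ord_const mul1r.
    apply: ler_sum => a _; rewrite -(expr1n _ a).
    apply: (le_trans (@cabs_expB_le _ 1 z 1 1 a _ _)).
    - by move=> k _; rewrite cabs1 expr1n.
    - by move=> k _; rewrite exprn_ile1 ?cabs_ge0.
    rewrite !mulr1 cabsBC ler_pdivlMr // mulrAC mulrC; apply: le_trans hm.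
    by rewrite mulrC (mulrC a%:R) ler_wpM2r ?cabs_ge0 // ler_wpM2l // ler_nat ltnW.
  have := cabsD (m%:R - \sum_(a < m) (1 - z ^+ a)) (\sum_(a < m) (1 - z ^+ a)).
  rewrite subrK cabs_nat; lra.
have : (m%:R / 2) ^+ 2 <= cabs (\sum_(a < m) z ^+ a) ^+ 2.
  by rewrite lerXn2r ?nnegrE ?cabs_ge0 // divr_ge0.
lra.
Qed.

Lemma dyadic_ker_ge_count l J z : cabs z <= 1 -> (l <= J)%N ->
  (forall j, (j < l)%N -> 2 * (2 ^ j)%:R * cabs (z - 1) <= 1) ->
  l%:R / 4 <= dyadic_ker J z.
Proof.
move=> hz lJ hl; apply: le_trans (le_dyadic_ker z lJ).
rewrite /dyadic_ker; apply: (@le_trans _ _ (\sum_(j < l) (1 / 4))).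
  by rewrite sum_ord_const mul1r.
by apply: ler_sum => j _; rewrite bump_ker_ge ?expn_gt0 ?hl.
Qed.

(** Let [l] be the least scale with [2 * 2^l |z - 1| > 1]. The [l] coarser scales contribute at
    least [1/4] each to the kernel, while [- ln |z - 1| <= ln (2^(l+1)) <= l + 1]. *)
Lemma lnV_le_dyadic_ker z : cabs z <= 1 -> z != 1 ->
  exists J0, forall J, (J0 <= J)%N ->
    - ln (cabs (z - 1)) <= 1 + 4 * dyadic_ker J z.
Proof.
move=> hz z1; have d0 : 0 < cabs (z - 1) by rewrite cabs_gt0 subr_eq0.
have [n hn] : exists n, 1 < 2 * (2 ^ n)%:R * cabs (z - 1).
  exists (Num.bound (cabs (z - 1))^-1); set n := Num.bound _.
  rewrite -ltr_pdivrMr // div1r.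
  have : (cabs (z - 1))^-1 < n%:R by rewrite archi_boundP // invr_ge0 ltW.
  have : (n%:R : R) <= (2 ^ n)%:R by rewrite ler_nat ltnW // ltn_expl.
  have : (0 : R) < (2 ^ n)%:R by rewrite ltr0n expn_gt0.
  lra.
have [l hl hmin] := ex_minnP (ex_intro (fun n => 1 < 2 * (2 ^ n)%:R * cabs (z - 1)) n hn).
exists l => J lJ; have := @dyadic_ker_ge_count l J z hz lJ.
have -> : - ln (cabs (z - 1)) = ln ((cabs (z - 1))^-1) by rewrite lnV.
have h2 : ln ((cabs (z - 1))^-1) <= ln (2 ^+ l.+1).
  rewrite ler_ln ?posrE ?invr_gt0 ?exprn_gt0 //.
  by rewrite -div1r ler_pdivrMr // exprS -natrX ltW.
move=> h3; have {}h3 : l%:R / 4 <= dyadic_ker J z.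
  apply: h3 => j jl; rewrite leNgt; apply/negP => /hmin.
  by rewrite leqNgt jl.
have h4 : ln (2 ^+ l.+1) <= l.+1%:R :> R.
  rewrite lnXn // -(mulr_natl (ln 2)) -[leRHS]mulr1 ler_wpM2l //.
  have -> : (2 : R) = 1 + 1 by [].
  exact: le_ln1Dx.
rewrite -natr1 in h4; lra.
Qed.

Lemma fejer_eval m z : cabs z = 1 ->
  complex.Re (\sum_(k < m) (fejer_coef m k)%:R * z ^+ k) = cabs (\sum_(a < m) z ^+ a) ^+ 2.
Proof.
move=> hz; elim: m => [|m ih]; first by rewrite !big_ord0 cabs0 expr0n.
have -> : \sum_(k < m.+1) (fejer_coef m.+1 k)%:R * z ^+ k =
   \sum_(k < m) (fejer_coef m k)%:R * z ^+ k + (1 + 2 * \sum_(k < m) z ^+ k.+1).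
  have -> : \sum_(k < m) (fejer_coef m k)%:R * z ^+ k =
      \sum_(k < m.+1) (fejer_coef m k)%:R * z ^+ k.
    rewrite big_ord_recr /= /fejer_coef; case: m {ih} => [|m] /=.
      by rewrite mul0r addr0.
    by rewrite subnn mul0r addr0.
  rewrite !big_ord_recl /= /fejer_coef /= !expr0 !mulr1 -natr1.
  rewrite mulr_sumr addrACA; congr (_ + _); rewrite -big_split /=.
  apply: eq_bigr => k _; rewrite /bump /= add1n -mulrDl -natrD; congr (_%:R * _).
  by rewrite subSn // doubleS addn2.
rewrite big_ord_recr /= cabsD_sqr cabsX hz !expr1n -ih.
(* On the circle [z^i] times the conjugate of [z^m] is the conjugate of [z^(m-i)]; the summation
   order is reversed. This is the cross term of [|S + z^m|^2]. *)
have -> : (\sum_(i < m) z ^+ i) * (z ^+ m)^*%C = (\sum_(k < m) z ^+ k.+1)^*%C.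
  rewrite mulr_suml rmorph_sum /= (reindex_inj rev_ord_inj) /=; apply: eq_bigr => k _.
  have -> : z ^+ m = z ^+ (m - k.+1) * z ^+ k.+1 by rewrite -exprD subnK.
  rewrite rmorphM /= mulrA mulJ_cabs cabsX hz !expr1n mul1r //.
case: (\sum_(k < m) z ^+ k.+1) => a b; case: (\sum_(k < m) _) => c d /=; ring.
Qed.

Lemma dyadic_poly_eval J z : cabs z = 1 ->
  complex.Re (dyadic_poly J).[z] = dyadic_ker J z.
Proof.
move=> hz; rewrite horner_poly /dyadic_ker.
have -> : \sum_(k < 2 ^ J) ((dyadic_coef J k)%:C)%C * z ^+ k =
  \sum_(j < J) ((((2 ^ j)%:R ^+ 2)^-1)%:C)%C *
     \sum_(k < 2 ^ j) (fejer_coef (2 ^ j) k)%:R * z ^+ k.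
  transitivity (\sum_(k < 2 ^ J) \sum_(j < J) ((((2 ^ j)%:R ^+ 2)^-1)%:C)%C *
      ((fejer_coef (2 ^ j) k)%:R * z ^+ k)).
    apply: eq_bigr => k _; rewrite rmorph_sum /= mulr_suml; apply: eq_bigr => j _.
    by rewrite rmorphM /= rmorph_nat; ring.
  rewrite exchange_big /=; apply: eq_bigr => j _; rewrite -mulr_sumr; congr (_ * _).
  have jJ : (2 ^ j <= 2 ^ J)%N by rewrite leq_exp2l // ltnW.
  rewrite -(big_mkord xpredT (fun k => (fejer_coef (2 ^ j) k)%:R * z ^+ k)).
  rewrite (big_cat_nat (n := (2 ^ j)%N)) //= big_mkord.
  rewrite [X in _ + X]big_nat_cond [X in _ + X]big1 ?addr0 // => k /andP[/andP[jk _] _].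
  rewrite /fejer_coef; have /eqP -> : (2 ^ j - k == 0)%N by rewrite subn_eq0.
  by case: eqP jk => [->|_ _]; rewrite ?leqn0 ?expn_eq0 // mul0r.
rewrite raddf_sum /=; apply: eq_bigr => j _.
rewrite /bump_ker -fejer_eval //; case: (\sum_(k < _) _) => a b /=.
by rewrite mul0r subr0 mulrC.
Qed.

Lemma dyadic_coef_ge0 J k : 0 <= dyadic_coef J k.
Proof. by apply: sumr_ge0 => j _; rewrite divr_ge0 ?sqr_ge0. Qed.

(** Only scales with [2^j > k] contribute, at most [2 / 2^j] each: a geometric series whose first
    term is at most [2 / (k + 1)]. This decay is what absorbs the Dirichlet weight. *)
Lemma dyadic_coef_le J k : k.+1%:R * dyadic_coef J k <= 4.
Proof.
pose S J : R := \sum_(j < J) (if (k < 2 ^ j)%N then (2 ^+ j)^-1 else 0).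
(* The invariant includes the whole remaining geometric tail [2 / 2^J], which makes it stable under
   adding a term; before the first scale above [k] the sum is still [0]. *)
have hS : S J = 0 \/ k.+1%:R * (S J + 2 / 2 ^+ J) <= 2.
  elim: J => [|J ih]; first by left; rewrite /S big_ord0.
  rewrite /S big_ord_recr /= -/(S J).
  have e2 : 2 / 2 ^+ J.+1 = (2 ^+ J)^-1 :> R.
    by rewrite exprS invfM mulrA divff ?mul1r.
  have p0 : 0 < (2 ^+ J : R)^-1 by rewrite invr_gt0 exprn_gt0.
  case: ifP => hk.
    right; rewrite e2.
    have hk' : k.+1%:R * (2 ^+ J)^-1 <= 1 :> R.
      by rewrite ler_pdivrMr ?exprn_gt0 // mul1r -natrX ler_nat.
    case: ih => [->|ih]; first lra.
    by have -> : S J + (2 ^+ J)^-1 + (2 ^+ J)^-1 = S J + 2 / 2 ^+ J by ring.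
  rewrite addr0; case: ih => [->|ih]; [by left | right].
  apply: le_trans ih; rewrite ler_wpM2l // lerD2l e2; lra.
have hS2 : k.+1%:R * S J <= 2.
  case: hS => [->|]; first by rewrite mulr0.
  apply: le_trans; rewrite ler_wpM2l // lerDl divr_ge0 ?exprn_ge0 //.
have : dyadic_coef J k <= 2 * S J.
  rewrite mulr_sumr; apply: ler_sum => j _.
  have p0 : 0 < (2 ^ j)%:R :> R by rewrite ltr0n expn_gt0.
  rewrite -(natrX R 2 j) /fejer_coef; case h: (k < 2 ^ j)%N.
    rewrite ler_pdivrMr ?exprn_gt0 // expr2 -mulrA mulKf ?(gt_eqF p0) //.
    rewrite -natrM ler_nat; case: eqP => _; first by rewrite leq_pmull.
    by rewrite -mul2n leq_mul2l leq_subr.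
  move/negbT: h; rewrite -leqNgt => h.
  have /eqP -> : (2 ^ j - k == 0)%N by rewrite subn_eq0.
  case: eqP h => [->|_ _]; first by rewrite leqn0 expn_eq0.
  by rewrite mul0r mulr0.
move=> h; apply: (@le_trans _ _ (k.+1%:R * (2 * S J))); first by rewrite ler_wpM2l.
rewrite mulrCA; lra.
Qed.

Definition potential J s z : R := \sum_(y <- s) dyadic_ker J (z * y^*%C).

Definition energy J s : R := \sum_(x <- s) potential J s x.

Lemma energy_ge0 J s : 0 <= energy J s.
Proof. by do 2 apply: sumr_ge0 => ? _; exact: dyadic_ker_ge0. Qed.

(** With [sig k] the Fourier coefficients of the uniform measure on [s], [F] has coefficients
    [c k * sig k] and the mean energy is [sum c k |sig k|^2]. The Dirichlet sum
    [sum (k + 1) (c k)^2 |sig k|^2] loses one factor [(k + 1) c k <= 4]. *)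
Lemma potential_poly J s : (0 < size s)%N -> (forall x, x \in s -> cabs x = 1) ->
  exists F : {poly C},
    (forall z, cabs z = 1 -> complex.Re F.[z] = potential J s z / (size s)%:R) /\
    dle (pcoef F) (4 * (energy J s / (size s)%:R ^+ 2)).
Proof.
move=> s0 hs; set m := size s; have m0 : 0 < m%:R :> R by rewrite ltr0n.
pose sig k : C := (m%:R)^-1 * \sum_(y <- s) (y^*%C) ^+ k.
pose F : {poly C} := \poly_(k < 2 ^ J) (((dyadic_coef J k)%:C)%C * sig k).
have hF z : F.[z] = ((m%:R^-1 : R)%:C)%C * \sum_(y <- s) (dyadic_poly J).[z * y^*%C].
  rewrite horner_poly mulr_sumr.
  transitivity (\sum_(k < 2 ^ J) \sum_(y <- s) ((m%:R^-1 : R)%:C)%C *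
     (((dyadic_coef J k)%:C)%C * (z * y^*%C) ^+ k)).
    apply: eq_bigr => k _; rewrite /sig mulr_sumr mulr_sumr mulr_suml.
    apply: eq_bigr => y _; rewrite exprMn natCE fmorphV; ring.
  rewrite exchange_big /=; apply: eq_bigr => y _.
  by rewrite -mulr_sumr horner_poly.
exists F; split=> [z hz|].
  rewrite hF /potential.
  have -> : \sum_(y <- s) dyadic_ker J (z * y^*%C) =
      complex.Re (\sum_(y <- s) (dyadic_poly J).[z * y^*%C]).
    rewrite raddf_sum /= !big_seq; apply: eq_bigr => y ys.
    by rewrite dyadic_poly_eval // cabsM cabsJ hz hs ?mul1r.
  by case: (\sum_(y <- s) _) => a b /=; rewrite mul0r subr0 mulrC.
have hE : energy J s / m%:R ^+ 2 =
    \sum_(k < 2 ^ J) dyadic_coef J k * cabs (sig k) ^+ 2.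
  have -> : energy J s = complex.Re (\sum_(x <- s) \sum_(y <- s) (dyadic_poly J).[x * y^*%C]).
    rewrite raddf_sum /= /energy !big_seq; apply: eq_bigr => x xs.
    rewrite raddf_sum /= /potential !big_seq; apply: eq_bigr => y ys.
    by rewrite dyadic_poly_eval // cabsM cabsJ !hs ?mul1r.
  have -> : \sum_(x <- s) \sum_(y <- s) (dyadic_poly J).[x * y^*%C] =
     ((\sum_(k < 2 ^ J) dyadic_coef J k * cabs (\sum_(y <- s) (y^*%C) ^+ k) ^+ 2)%:C)%C.
    rewrite rmorph_sum /=.
    transitivity (\sum_(x <- s) \sum_(y <- s) \sum_(k < 2 ^ J)
        ((dyadic_coef J k)%:C)%C * (x ^+ k * (y^*%C) ^+ k)).
      apply: eq_bigr => x _; apply: eq_bigr => y _; rewrite horner_poly.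
      by apply: eq_bigr => k _; rewrite exprMn.
    transitivity (\sum_(k < 2 ^ J) \sum_(x <- s) \sum_(y <- s)
        ((dyadic_coef J k)%:C)%C * (x ^+ k * (y^*%C) ^+ k)).
      by rewrite [RHS]exchange_big /=; apply: eq_bigr => x _; rewrite exchange_big.
    apply: eq_bigr => k _; rewrite rmorphM /= -mulJ_cabs.
    have -> : (\sum_(y <- s) (y^*%C) ^+ k)^*%C = \sum_(x <- s) x ^+ k.
      by rewrite rmorph_sum /=; apply: eq_bigr => x _; rewrite rmorphXn /= conjcK.
    rewrite [X in _ * X]mulrC mulr_suml mulr_sumr; apply: eq_bigr => x _.
    by rewrite !mulr_sumr.
  rewrite /= mulr_suml; apply: eq_bigr => k _.
  by rewrite /sig cabsM cabsV cabs_nat exprMn exprVn -mulrA [_ / _]mulrC.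
apply: (dle_poly (size_poly _ _)); rewrite hE mulr_sumr; apply: ler_sum => k _.
rewrite /dirichlet_weighted /pcoef coef_poly ltn_ord cabsM cabs_real.
rewrite ger0_norm ?dyadic_coef_ge0 // exprMn expr2.
have -> (n c u : R) : n * (c * c * u) = (n * c) * (c * u) by ring.
apply: ler_wpM2r; last exact: dyadic_coef_le.
by rewrite mulr_ge0 ?dyadic_coef_ge0 ?sqr_ge0.
Qed.

End DyadicKernel.

(** * Near-minimizers and the polynomials of their potentials *)

Section FeketePoints.
Variable R : realType.
Local Notation C := R[i].
Implicit Types (z w x y : C) (s t : seq C) (E : set C).

Lemma potential_cons J y s z :
  potential J (y :: s) z = dyadic_ker J (z * y^*%C) + potential J s z.
Proof. by rewrite /potential big_cons. Qed.

Lemma dyadic_ker_sym J x y : dyadic_ker J (x * y^*%C) = dyadic_ker J (y * x^*%C).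
Proof. by rewrite -dyadic_kerJ rmorphM /= conjcK mulrC. Qed.

Lemma energy_cons J x s : cabs x = 1 ->
  energy J (x :: s) = J%:R + 2 * potential J s x + energy J s.
Proof.
move=> hx; rewrite /energy big_cons potential_cons mulJ_cabs hx expr1n dyadic_ker1.
under eq_bigr do rewrite potential_cons.
rewrite big_split /= -/(energy J s).
have -> : \sum_(y <- s) dyadic_ker J (y * x^*%C) = potential J s x.
  by apply: eq_bigr => y _; rewrite dyadic_ker_sym.
ring.
Qed.

Lemma perm_potential J s t z : perm_eq s t -> potential J s z = potential J t z.
Proof. exact: perm_big. Qed.

Lemma perm_energy J s t : perm_eq s t -> energy J s = energy J t.
Proof.
move=> st; rewrite /energy (perm_big _ st) /=.
by apply: eq_bigr => x _; exact: perm_potential.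
Qed.

Lemma potential_ge0 J s z : 0 <= potential J s z.
Proof. by apply: sumr_ge0 => y _; exact: dyadic_ker_ge0. Qed.

(** Repeated points are allowed, so a nonempty [E] carries configurations of every size; the kernel
    is finite on the diagonal, with value [J]. *)
Definition config E m s := size s = m /\ forall x, x \in s -> E x.

Lemma near_minimizer E J m : E !=set0 ->
  exists2 s, config E m s & forall t, config E m t -> energy J s <= energy J t + 1.
Proof.
move=> [w Ew]; pose A := [set energy J s | s in config E m].
have Ai : has_inf A.
  split; last by exists 0 => _ [s _ <-]; exact: energy_ge0.
  exists (energy J (nseq m w)), (nseq m w) => //; split; first by rewrite size_nseq.
  by move=> x /nseqP [->].
have [_ [s hs <-] hlt] := inf_adherent (@ltr01 R) Ai.
exists s => // t ht; apply: ltW; apply: (lt_le_trans hlt); rewrite lerD2r.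
by apply: ge_inf; [exact: Ai.2 | exists t].
Qed.

(* Replacing one point of a nearly minimal configuration by [w] cannot lower
   the energy much, hence the potential at [w] is almost the mean energy. *)
Lemma near_minimizer_potential E J m s w : on_circle E -> config E m s ->
  (forall t, config E m t -> energy J s <= energy J t + 1) -> E w ->
  energy J s <= m%:R * (potential J s w + J%:R + 1).
Proof.
move=> hE [sm sE] hmin Ew.
have h x : x \in s -> potential J s x <= potential J s w + J%:R + 1.
  move=> xs; have sx := perm_to_rem xs.
  have hw := hE _ Ew; have hx := hE _ (sE _ xs).
  have : config E m (w :: rem x s).
    split=> [|y].
      rewrite /= size_rem // sm prednK // -sm; by case: (s) xs.
    by rewrite inE => /orP[/eqP ->//|/mem_rem /sE].
  move/hmin; rewrite (perm_energy J sx) !energy_cons //.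
  rewrite !(perm_potential J _ sx) !potential_cons mulJ_cabs hx expr1n dyadic_ker1.
  have := dyadic_ker_ge0 J (w * x^*%C); lra.
rewrite /energy big_seq; apply: (@le_trans _ _
  (\sum_(x <- s | x \in s) (potential J s w + J%:R + 1))); first exact: ler_sum.
by rewrite -big_seq big_const_seq count_predT iter_addr_0 sm mulr_natl.
Qed.

Lemma equilibrium_poly E J (V : R) : on_circle E -> E !=set0 ->
  (forall m s, config E m s -> (0 < m)%N -> V <= energy J s / m%:R ^+ 2) ->
  exists2 V', V <= V' & exists F : {poly C},
    [/\ forall z, cabs z = 1 -> 0 <= complex.Re F.[z],
        forall w, E w -> V' - 1 <= complex.Re F.[w] &
        dle (pcoef F) (4 * V')].
Proof.
(* With [m = J + 1] points the error [(J + 1) / m], due to the diagonal and to the slack of the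
   near-minimizer, is exactly [1]. *)
move=> hE E0 hV; have [s hs hmin] := near_minimizer J J.+1 E0.
have [sm sE] := hs.
exists (energy J s / J.+1%:R ^+ 2); first exact: hV.
have [|F [hF dF]] := @potential_poly R J s _ (fun x xs => hE _ (sE _ xs)).
  by rewrite sm.
rewrite sm in hF dF; exists F; split=> //.
  by move=> z hz; rewrite hF // divr_ge0 ?potential_ge0.
move=> w Ew; rewrite hF ?hE //.
have m0 : 0 < J.+1%:R :> R by rewrite ltr0n.
rewrite lerBlDr ler_pdivrMr ?exprn_gt0 //.
apply: (le_trans (near_minimizer_potential hE hs hmin Ew)).
rewrite expr2 mulrA [leRHS]mulrC ler_wpM2l ?ler0n //.
by rewrite mulrDl divfK ?gt_eqF // mul1r -natr1 addrA.
Qed.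

End FeketePoints.

(** * Measures from limits of configurations *)

Section Angles.
Variable R : realType.
Local Notation C := R[i].
Implicit Types (z w : C) (s : seq C) (E : set C) (x y t : R) (theta : nat -> R).

Definition cis t : C := (cos t +i* sin t)%C.

Lemma cabs_cis t : cabs (cis t) = 1.
Proof. by rewrite /cabs /= cos2Dsin2 sqrtr1. Qed.

Lemma cisB x y : cis x * (cis y)^*%C = cis (x - y).
Proof.
apply/eqP; rewrite eq_complex /= cosB sinB.
by apply/andP; split; apply/eqP; ring.
Qed.

Lemma cisD x y : cis (x + y) = cis x * cis y.
Proof.
apply/eqP; rewrite eq_complex /= cosD sinD.
by apply/andP; split; apply/eqP; ring.
Qed.

Lemma cabs_cisB x y : cabs (cis x - cis y) = cabs (cis (x - y) - 1).
Proof.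
rewrite -cisB -[LHS]mulr1 -(cabs_cis y) -(cabsJ (cis y)) -cabsM mulrBl.
by rewrite mulJ_cabs cabs_cis expr1n.
Qed.

Lemma circle_angle z : cabs z = 1 -> exists2 t, - pi <= t <= pi & z = cis t.
Proof.
move=> hz; have := cabs_sqr z; rewrite hz expr1n.
case: z {hz} => a b /= h.
have ha : -1 <= a <= 1.
  by have := sqr_ge0 b; rewrite !expr2 in h * => b0; apply/andP; split; nra.
have hb : Num.sqrt (1 - a ^+ 2) = `|b|.
  by rewrite h addrAC subrr add0r sqrtr_sqr.
have pi0 : (0 : R) <= pi by exact: pi_ge0.
have [b0|b0] := leP 0 b.
  exists (acos a); first by rewrite acos_lepi // andbT (le_trans _ (acos_ge0 ha)) // oppr_le0.
  by rewrite /cis acosK ?in_itv //= sin_acos // hb ger0_norm.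
exists (- acos a).
  rewrite lerN2 acos_lepi //= (le_trans _ pi0) // oppr_le0; exact: acos_ge0.
by rewrite /cis cosN sinN acosK ?in_itv //= sin_acos // hb ltr0_norm ?opprK.
Qed.

Lemma mvt_lipschitz (f df : R -> R) : (forall x, is_derive x 1 f (df x)) ->
  (forall x, `|df x| <= 1) -> forall x y, `|f x - f y| <= `|x - y|.
Proof.
move=> hf hdf x y; wlog xy : x y / x < y.
  move=> hw; have [xy|yx|->] := ltgtP x y; first exact: hw.
    by rewrite distrC [leRHS]distrC; exact: hw.
  by rewrite !subrr.
have cf : {within `[x, y], continuous f}.
  by apply: derivable_within_continuous => u _; exact: (@ex_derive _ _ _ _ _ _ _ (hf u)).
have [c _ e] := MVT xy (fun u _ => hf u) cf.
by rewrite distrC e normrM [leRHS]distrC ler_piMl.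
Qed.

Lemma cis_lipschitz x y : cabs (cis x - cis y) <= 2 * `|x - y|.
Proof.
apply: (le_trans (cabs_le_ReIm _)) => /=.
have h1 : `|cos x - cos y| <= `|x - y|.
  apply: (@mvt_lipschitz cos (fun u => - sin u)) => // u.
  by rewrite normrN sin_max.
have h2 : `|sin x - sin y| <= `|x - y|.
  apply: (@mvt_lipschitz sin cos) => // u; exact: cos_max.
lra.
Qed.

Definition angle_ker J t : R := dyadic_ker J (cis t).

Lemma angle_ker_ge0 J t : 0 <= angle_ker J t.
Proof. exact: dyadic_ker_ge0. Qed.

Lemma angle_kerN J t : angle_ker J (- t) = angle_ker J t.
Proof.
rewrite /angle_ker -dyadic_kerJ; congr dyadic_ker.
by rewrite /cis cosN sinN /= opprK.
Qed.

Lemma angle_ker_lipschitz J : exists2 L : R, 0 <= L & forall x y,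
  angle_ker J x <= angle_ker J y + L * `|x - y|.
Proof.
have [L L0 hL] := poly_lipschitz (dyadic_poly R J).
exists (L * 2); first by rewrite mulr_ge0.
move=> x y; rewrite /angle_ker -!dyadic_poly_eval ?cabs_cis //.
rewrite -lerBlDl -raddfB /= -mulrA.
apply: (le_trans (ler_norm _)); apply: (le_trans (ler_Re_cabs _)).
apply: (le_trans (hL _ _ _ _)); rewrite ?cabs_cis //.
by rewrite ler_wpM2l // cis_lipschitz.
Qed.

Lemma sum_flatten_nseq (T : Type) (F : T -> R) (l : seq T) N :
  \sum_(x <- flatten (nseq N l)) F x = N%:R * \sum_(x <- l) F x.
Proof.
elim: N => [|N ih] /=; first by rewrite big_nil mul0r.
by rewrite big_cat /= ih -natr1 mulrDl mul1r addrC.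
Qed.

(** Repeating every point [N] times makes the number of sorted angles divisible by [N], so that for
    [N = 2 ^ J] dyadic quantiles sit at integer indices. Beyond the last index the value [pi] keeps
    the sequence monotone on [nat]. *)
Lemma config_angles E m s J N : on_circle E -> config E m s ->
  exists theta : nat -> R,
    [/\ {homo theta : i j / (i <= j)%N >-> i <= j},
        forall i, - pi <= theta i <= pi,
        forall i, (i < m * N)%N -> E (cis (theta i)) &
        \sum_(a < m * N) \sum_(b < m * N) angle_ker J (theta a - theta b)
          = N%:R ^+ 2 * energy J s].
Proof.
move=> hE [sm sE].
have /choice [ang hang] : forall z, exists t, E z -> - pi <= t <= pi /\ z = cis t.
  move=> z.
  have [Ez|nEz] := pselect (E z); last by exists 0.
  by have [t ht e] := circle_angle (hE _ Ez); exists t.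
pose l := flatten (nseq N (map ang s)).
have szl : size l = (m * N)%N.
  rewrite /l size_flatten /shape map_nseq sumn_nseq size_map sm //.
have hl x : x \in l -> - pi <= x <= pi /\ E (cis x).
  move=> /flattenP [u /nseqP [-> _]] /mapP [z /sE Ez ->].
  by have [h1 h2] := hang _ Ez; split=> //; rewrite -h2.
pose t := sort <=%R l.
have szt : size t = (m * N)%N by rewrite size_sort.
have ht i : (i < m * N)%N -> - pi <= nth 0 t i <= pi /\ E (cis (nth 0 t i)).
  move=> hi; apply: hl; rewrite -(mem_sort <=%R) mem_nth // -/t szt //.
have srt : sorted <=%R t by apply: sort_sorted; exact: le_total.
have pi0 : (0 : R) <= pi by exact: pi_ge0.
exists (fun i => if (i < m * N)%N then nth 0 t i else pi); split.
- move=> i j ij; case: ifP => hi; case: ifP => hj //.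
  + apply: (sorted_leq_nth le_trans le_refl 0 srt) => //; rewrite inE szt //.
  + by have [/andP[]] := ht _ hi.
  + by move: hi; rewrite (leq_ltn_trans ij hj).
- move=> i; case: ifP => hi; first exact: (ht _ hi).1.
  by rewrite lexx andbT (le_trans _ pi0) // oppr_le0.
- by move=> i hi; rewrite hi; exact: (ht _ hi).2.
have hsum (F : R -> R) : \sum_(a < m * N) F (if (a < m * N)%N then nth 0 t a else pi) =
    N%:R * \sum_(z <- s) F (ang z).
  transitivity (\sum_(x <- t) F x).
    rewrite (big_nth 0) big_mkord szt; apply: eq_bigr => i _; by rewrite ltn_ord.
  have ptl : perm_eq t l by rewrite perm_sort.
  by rewrite (perm_big _ ptl) sum_flatten_nseq big_map.
transitivity (\sum_(a < m * N) (fun x => N%:R * \sum_(w <- s) angle_ker J (x - ang w))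
     (if (a < m * N)%N then nth 0 t a else pi)).
  by apply: eq_bigr => a _; rewrite -(hsum (fun y => angle_ker J (_ - y))).
rewrite (hsum (fun x => N%:R * \sum_(w <- s) angle_ker J (x - ang w))).
rewrite -mulr_sumr mulrA -expr2; congr (_ * _).
rewrite /energy /potential big_seq [RHS]big_seq; apply: eq_bigr => z zs.
rewrite !big_seq; apply: eq_bigr => w ws.
by rewrite /angle_ker -cisB -(hang _ (sE _ zs)).2 -(hang _ (sE _ ws)).2.
Qed.

(* A monotone sequence has total variation at most [2 pi], so averages over a
   coarse subsample exceed the full averages by [O(1/M)] only. *)
Lemma subsample_sum theta (phi : R -> R) (L : R) r M :
  {homo theta : i j / (i <= j)%N >-> i <= j} -> 0 <= L ->
  (forall x y, phi x <= phi y + L * `|x - y|) ->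
  r%:R * \sum_(i < M) phi (theta (i * r)%N) <=
  \sum_(a < M * r) phi (theta a) + L * r%:R * (theta (M * r)%N - theta 0%N).
Proof.
move=> hmon L0 hL; elim: M => [|M ih].
  by rewrite mul0n !big_ord0 mulr0 subrr mulr0 addr0.
rewrite mulSnr big_ord_recr big_split_ord /= mulrDr.
have h : r%:R * phi (theta (M * r)%N) <= \sum_(p < r) phi (theta (M * r + p)%N) +
    L * r%:R * (theta (M * r + r)%N - theta (M * r)%N).
  rewrite -(sum_ord_const r) [L * _ * _]mulrAC mulrC -(sum_ord_const r) -big_split /=.
  apply: ler_sum => p _; apply: (le_trans (hL _ (theta (M * r + p)%N))).
  rewrite lerD2l ler_wpM2l // distrC ger0_norm ?subr_ge0 ?hmon ?leq_addr //.
  by rewrite lerD2r hmon // leq_add2l ltnW.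
move: ih h; set S := theta (M * r + r)%N; set S' := theta (M * r)%N.
have -> : L * r%:R * (S - theta 0%N) = L * r%:R * (S' - theta 0%N) + L * r%:R * (S - S').
  by ring.
lra.
Qed.

(** [subsample_sum] is applied in each variable, the kernel being even and Lipschitz. Each pass
    costs [2 pi L M r^2], and [K] depends on [J] only. *)
Lemma subsample_energy J : exists2 K : R, 0 <= K & forall theta r M,
  {homo theta : i j / (i <= j)%N >-> i <= j} ->
  (forall i, - pi <= theta i <= pi) ->
  r%:R ^+ 2 * (\sum_(i < M) \sum_(j < M) angle_ker J (theta (i * r)%N - theta (j * r)%N))
  <= \sum_(a < M * r) \sum_(b < M * r) angle_ker J (theta a - theta b)
     + K * M%:R * r%:R ^+ 2.
Proof.
have [L L0 hL] := angle_ker_lipschitz J.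
have pi0 : (0 : R) <= pi by exact: pi_ge0.
exists (L * pi * 4); first by rewrite !mulr_ge0.
move=> theta r M hmon hpi.
have L1 y x x' : angle_ker J (x - y) <= angle_ker J (x' - y) + L * `|x - x'|.
  by apply: (le_trans (hL _ (x' - y))); rewrite opprB addrA subrK.
have tot : theta (M * r)%N - theta 0%N <= 2 * pi.
  by have /andP[_] := hpi (M * r)%N; have /andP[] := hpi 0%N; lra.
have sub (phi : R -> R) : (forall x y, phi x <= phi y + L * `|x - y|) ->
    r%:R * \sum_(i < M) phi (theta (i * r)%N) <=
    \sum_(a < M * r) phi (theta a) + L * r%:R * (2 * pi).
  move=> hphi; apply: (le_trans (subsample_sum r M hmon L0 hphi)).
  by rewrite lerD2l ler_wpM2l ?mulr_ge0.
have L2 x y y' : angle_ker J (x - y) <= angle_ker J (x - y') + L * `|y - y'|.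
  by rewrite -angle_kerN opprB -(angle_kerN J (x - y')) opprB; exact: L1.
rewrite expr2 -mulrA.
apply: (@le_trans _ _ (r%:R * \sum_(i < M) (\sum_(b < M * r) angle_ker J (theta (i * r)%N - theta b) + L * r%:R * (2 * pi)))).
  rewrite ler_wpM2l // mulr_sumr; apply: ler_sum => i _.
  exact: (sub _ (L2 _)).
rewrite big_split /= sum_ord_const mulrDr exchange_big /= mulr_sumr.
apply: (@le_trans _ _ (\sum_(b < M * r) (\sum_(a < M * r) angle_ker J (theta a - theta b) + L * r%:R * (2 * pi)) + r%:R * (M%:R * (L * r%:R * (2 * pi))))).
  rewrite lerD2r; apply: ler_sum => b _; exact: (sub _ (L1 _)).
rewrite big_split /= sum_ord_const exchange_big /= natrM -addrA lerD2l.
by rewrite le_eqVlt; apply/orP; left; apply/eqP; ring.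
Qed.

(** By Tychonoff the sequence has a cluster point in a product of segments. Approximation on any
    finite window, by an arbitrarily late [X J], takes the place of a diagonal subsequence. *)
Lemma pointwise_cluster (X : nat -> nat -> nat -> R) (b : R) :
  (forall J l i, - b <= X J l i <= b) ->
  exists q : nat -> nat -> R, (forall l i, - b <= q l i <= b) /\
    forall B N e, 0 < e -> exists2 J, (N <= J)%N &
      forall l i, (l < B)%N -> (i < B)%N -> `|q l i - X J l i| < e.
Proof.
move=> hX; pose T : topologicalType := prod_topology (fun _ : nat * nat => R : topologicalType).
pose K : set T := [set f : T | forall c, `[- b, b]%classic (f c)].
have cK : compact K.
  exact: (@tychonoff _ (fun _ : nat * nat => R : topologicalType) (fun _ => `[- b, b]%classic) (fun _ => @segment_compact R _ _)).
pose Y (J : nat) : T := fun c : nat * nat => X J c.1 c.2.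
have FK : (Y @ \oo) K.
  by exists 0%N => // J _ c; rewrite /= in_itv /= /Y hX.
have [Th [KTh clTh]] := cK (Y @ \oo) _ FK.
exists (fun l i => Th (l, i)); split=> [l i|B N e e0].
  by have := KTh (l, i); rewrite /= in_itv.
pose A : set T := [set f | exists2 J, (N <= J)%N & f = Y J].
have FA : (Y @ \oo) A by exists N => // J /= NJ; exists J.
pose fam (c : nat * nat) : set T := [set f : T | `|Th c - f c| < e].
have nfam c : nbhs Th (fam c).
  have h := @proj_continuous _ (fun _ : nat * nat => R : topologicalType) c Th.
  exact: (h (ball (Th c : R) e) (nbhsx_ballx (Th c : R) e e0)).
pose W (s : seq (nat * nat)) : set T := [set f : T | forall c, c \in s -> fam c f].
have nW (s : seq (nat * nat)) : nbhs Th (W s).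
  elim: s => [|c s ih]; first by apply: filterS filterT => f _ c.
  apply: filterS (filterI (nfam c) ih) => f [h1 h2] c'.
  by rewrite inE => /orP[/eqP ->//|]; exact: h2.
have [_ [[J NJ ->] hW]] := clTh A _ FA (nW (allpairs pair (iota 0 B) (iota 0 B))).
exists J => // l i lB iB; apply: (hW (l, i)).
by apply/allpairsP; exists (l, i); rewrite /= !mem_iota.
Qed.

Section LimitConfiguration.
Variables (E : set C) (V : R).
Hypotheses (clE : cclosed E) (onE : on_circle E).
Hypothesis lowE : forall J, exists m s,
  [/\ config E m s, (0 < m)%N & energy J s <= V * m%:R ^+ 2].

(** [q l i] is a limiting quantile of order [i / 2^l]. Closed relations pass to the limit. For the
    energy bound [J] is fixed and the configurations have index [J' >= J]:
    [angle_ker J <= angle_ker J'] bounds their energy by [V], and [K] is the subsampling cost. *)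
Lemma limit_quantiles : exists q : nat -> nat -> R,
  [/\ forall l i, q l.+1 (2 * i)%N = q l i,
      forall l i j, (i <= j)%N -> q l i <= q l j,
      forall l i, (i < 2 ^ l)%N -> E (cis (q l i)),
      forall l i, - pi <= q l i <= pi &
      forall J, exists2 K, 0 <= K & forall l,
        \sum_(i < 2 ^ l) \sum_(j < 2 ^ l) angle_ker J (q l i - q l j)
        <= V * (2 ^ l)%:R ^+ 2 + K * (2 ^ l)%:R].
Proof.
have /choice [mt hmt] : forall J, exists mt : nat * (nat -> R),
    [/\ {homo mt.2 : i j / (i <= j)%N >-> i <= j},
        forall i, - pi <= mt.2 i <= pi,
        forall i, (i < mt.1 * 2 ^ J)%N -> E (cis (mt.2 i)),
        (0 < mt.1)%N &
        \sum_(a < mt.1 * 2 ^ J) \sum_(b < mt.1 * 2 ^ J) angle_ker J (mt.2 a - mt.2 b)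
          <= V * (mt.1 * 2 ^ J)%:R ^+ 2].
  move=> J; have [m [s [hs m0 hV]]] := lowE J.
  have [theta [h1 h2 h3 h4]] := config_angles J (2 ^ J) onE hs.
  exists (m, theta); split=> //=; rewrite h4 natrM exprMn mulrA mulrC.
  by rewrite ler_wpM2r ?sqr_ge0.
pose m J := (mt J).1; pose theta J := (mt J).2.
(* The quantile of order [i / 2^l] among [m J * 2 ^ J] angles. It has this meaning for [l <= J],
   which holds once [J] is taken large. *)
pose X J l i := theta J (i * (m J * 2 ^ (J - l)))%N.
have hX J l i : - pi <= X J l i <= pi by have [_ h _ _ _] := hmt J; exact: h.
have [q [hpi hcl]] := pointwise_cluster hX.
have monX J l i j : (i <= j)%N -> X J l i <= X J l j.
  by have [h _ _ _ _] := hmt J => ij; apply: h; rewrite leq_mul2r ij orbT.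
have le_eps (u v : R) : (forall e, 0 < e -> u <= v + e) -> u <= v.
  by move=> h; apply/ler_addgt0Pr.
exists q; split=> //.
- move=> l i; apply/eqP; rewrite -subr_eq0 -normr_le0; apply: le_eps => e e0.
  have e20 : 0 < e / 2 by rewrite divr_gt0.
  have [J lJ hJ] := hcl (maxn l.+2 (2 * i).+1) l.+1 _ e20.
  have h1 := hJ l.+1 (2 * i)%N; rewrite !leq_max !ltnS !leqnn ?orbT in h1.
  have h2 := hJ l i; rewrite !leq_max !ltnS !leqnSn ?orbT in h2.
  have {}h1 := h1 isT isT; have {}h2 := h2 isT.
  have {}h2 : `|q l i - X J l i| < e / 2.
    by apply: h2; rewrite leq_pmull ?orbT.
  have eX : X J l.+1 (2 * i)%N = X J l i.
    rewrite /X; congr (theta J _).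
    by rewrite subnS; case: (J - l)%N (subn_gt0 l J) => [|k]; rewrite ?lJ //= expnS; lia.
  rewrite eX in h1; rewrite add0r.
  have -> : q l.+1 (2 * i)%N - q l i =
     (q l.+1 (2 * i)%N - X J l i) - (q l i - X J l i) by ring.
  by apply: (le_trans (ler_normB _ _)); lra.
- move=> l i j ij; apply: le_eps => e e0.
  have e20 : 0 < e / 2 by rewrite divr_gt0.
  have [J _ hJ] := hcl (maxn l j).+1 0%N _ e20.
  have := hJ l i; rewrite !ltnS !leq_max leqnn ij orbT => /(_ isT isT).
  have := hJ l j; rewrite !ltnS !leq_max !leqnn orbT => /(_ isT isT).
  have := monX J l _ _ ij.
  by rewrite !ltr_norml => ? /andP[? ?] /andP[? ?]; lra.
- move=> l i il; apply: clE => e e0.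
  have e40 : 0 < e / 2 by rewrite divr_gt0.
  have [J lJ hJ] := hcl (maxn l i).+1 l _ e40.
  exists (cis (X J l i)).
    have [_ _ + m0 _] := hmt J; apply.
    rewrite mulnCA ltn_mul2l m0 /= -[X in (_ < 2 ^ X)%N](subnKC lJ) expnD.
    by rewrite ltn_mul2r il expn_gt0.
  apply: (le_lt_trans (cis_lipschitz _ _)).
  have := hJ l i; rewrite !ltnS !leq_max !leqnn orbT => /(_ isT isT); lra.
move=> J; have [K K0 hK] := subsample_energy J.
have [L L0 hL] := angle_ker_lipschitz J.
exists K => // l; set M := (2 ^ l)%N; apply: le_eps => e e0.
have M0 : 0 < M%:R :> R by rewrite ltr0n expn_gt0.
(* Each of the [M^2] kernel values moves by at most [2 L d]; the [+ 1] covers [L = 0]. *)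
pose d := e / (M%:R ^+ 2 * (2 * L + 1)).
have L1 : 0 < 2 * L + 1 by lra.
have d0 : 0 < d by rewrite divr_gt0 // mulr_gt0 // exprn_gt0.
have [J' lJ' hJ'] := hcl (maxn l M).+1 (maxn l J) _ d0.
rewrite geq_max in lJ'; have /andP[lJ1 lJ2] := lJ'.
have hclose i : (i < M)%N -> `|q l i - X J' l i| < d.
  by move=> iM; apply: hJ'; rewrite ltnS leq_max ?leqnn // (ltnW iM) orbT.
have [hm1 hm2 _ m0 hm3] := hmt J'.
pose r := (m J' * 2 ^ (J' - l))%N.
have eMr : (m J' * 2 ^ J' = M * r)%N.
  by rewrite /r mulnCA -expnD subnKC.
have r0 : 0 < r%:R :> R by rewrite ltr0n muln_gt0 m0 expn_gt0.
have hX2 : \sum_(i < M) \sum_(j < M) angle_ker J (X J' l i - X J' l j) <=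
    V * M%:R ^+ 2 + K * M%:R.
  rewrite -(ler_pM2l (x := r%:R ^+ 2)) ?exprn_gt0 //.
  apply: (le_trans (hK (theta J') r M hm1 hm2)).
  have -> : r%:R ^+ 2 * (V * M%:R ^+ 2 + K * M%:R) =
    V * (M * r)%:R ^+ 2 + K * M%:R * r%:R ^+ 2 by rewrite natrM; ring.
  rewrite lerD2r -eMr; apply: le_trans hm3.
  by do 2 (apply: ler_sum => ? _); exact: le_dyadic_ker.
apply: (@le_trans _ _ (\sum_(i < M) \sum_(j < M)
   (angle_ker J (X J' l i - X J' l j) + L * (2 * d)))).
  apply: ler_sum => i _; apply: ler_sum => j _.
  apply: (le_trans (hL _ (X J' l i - X J' l j))); rewrite lerD2l ler_wpM2l //.
  have -> : q l i - q l j - (X J' l i - X J' l j) =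
    (q l i - X J' l i) - (q l j - X J' l j) by ring.
  apply: (le_trans (ler_normB _ _)).
  by have := hclose _ (ltn_ord i); have := hclose _ (ltn_ord j); lra.
under eq_bigr do rewrite big_split /= sum_ord_const.
rewrite big_split /= sum_ord_const; apply: lerD => //.
have -> : M%:R * (M%:R * (L * (2 * d))) = e * (2 * L / (2 * L + 1)).
  by rewrite /d; field; rewrite !gt_eqF.
rewrite -[leRHS]mulr1 ler_wpM2l ?(ltW e0) // ler_pdivrMr //; lra.
Qed.

End LimitConfiguration.

End Angles.

(** * Integral inequalities for arbitrary integrands *)

Section IntegralsWithoutMeasurability.
Context d (T : measurableType d) (R : realType).
Variable mu : {measure set T -> \bar R}.
Local Open Scope ereal_scope.

(* The integral of a nonnegative function is a supremum over the simple
   functions below it, so that no measurability of [f] or [g] is needed. *)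
Lemma le_integral_nonneg (f g : T -> \bar R) :
  (forall x, f x <= g x) -> (forall x, 0 <= g x) ->
  \int[mu]_x f x <= \int[mu]_x g x.
Proof.
move=> fg g0; rewrite integralE.
apply: (@le_trans _ _ (\int[mu]_x f^\+ x)).
  by rewrite -[leRHS]sube0; apply: leeB => //; apply: integral_ge0.
rewrite !ge0_integralTE //.
apply: ereal_sup_le => _ [h hf <-]; exists h => // x.
by apply: (le_trans (hf x)); rewrite funeposE ge_max fg g0.
Qed.

Lemma integral_ge_cst (f : T -> \bar R) (N : set T) (c : R) :
  mu setT = 1 -> measurable N -> mu N = 0 -> (0 <= c)%R ->
  (forall x, ~ N x -> - c%:E <= f x) -> - c%:E <= \int[mu]_x f x.
Proof.
move=> mu1 mN N0 c0 hf; rewrite integralE.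
have hneg : \int[mu]_x f^\- x <= c%:E.
  apply: (@le_trans _ _ (\int[mu]_x (cst c%:E x + ((cst +oo) \_ N) x))).
    have pt0 : (point : \bar R) = 0 by [].
    apply: le_integral_nonneg => x; rewrite /patch /= ?pt0; case: ifPn => hx.
    - by rewrite addey // leey.
    - rewrite adde0 funenegE ge_max; apply/andP; split; last by rewrite lee_fin.
      by rewrite leeNl hf // => Nx; move/negP: hx; apply; rewrite inE.
    - by rewrite addey // leey.
    - by rewrite adde0 lee_fin.
  rewrite ge0_integralD //=.
  - rewrite integral_cst // mu1 mule1 -integral_mkcond.
    by rewrite (null_set_integral mN) ?adde0.
  - by move=> x _; rewrite /patch; case: ifP => _; [exact: leey | exact: lexx].
  - by apply: (measurable_restrictT _ mN).1; exact: measurable_cst.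
have pos : 0 <= \int[mu]_x f^\+ x by apply: integral_ge0 => x _.
apply: (@le_trans _ _ (0 - \int[mu]_x f^\- x)); first by rewrite sub0e leeN2.
exact: leeB.
Qed.

End IntegralsWithoutMeasurability.

Section PushForward.
Context d d' (X : measurableType d) (Y : measurableType d') (R : realType).
Variables (m : {measure set X -> \bar R}) (psi : X -> Y).
Hypothesis mpsi : measurable_fun setT psi.
Import HBNNSimple.
Local Open Scope ereal_scope.

Lemma pushforward_measure : exists mu : {measure set Y -> \bar R},
  forall A, mu A = m (psi @^-1` A).
Proof. by unshelve eexists (pushforward m psi : {measure set Y -> \bar R}). Qed.

(** Change of variables is exact for each simple function below [f]; taking the supremum gives one
    inequality for arbitrary [f], in the direction wanted for an upper bound on energy. *)
Lemma integral_pushforward_le (mu : {measure set Y -> \bar R}) (f : Y -> \bar R) :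
  (forall A, mu A = m (psi @^-1` A)) -> (forall y, 0 <= f y) ->
  \int[mu]_y f y <= \int[m]_x f (psi x).
Proof.
move=> hmu f0; rewrite ge0_integralTE //; apply: ge_ereal_sup => _ [h hf <-].
have -> : (mu : set Y -> \bar R) = pushforward m psi by apply/funext => A; exact: hmu.
have -> : sintegral (pushforward m psi) h = \int[pushforward m psi]_y (h y)%:E.
  by rewrite integral_nnsfun // patch_setT.
rewrite ge0_integral_pushforward //.
- by apply: le_integral_nonneg => x; [exact: hf | exact: f0].
- exact/measurable_EFinP/measurable_funP.
- by move=> y _; rewrite lee_fin.
Qed.

End PushForward.

Section ClosedMeasurable.
Variable R : realType.
Local Notation C := R[i].

(** The complement is the countable union of the boxes with rational centre that it contains; [B']
    empties the other boxes. *)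
Lemma measurable_cclosedC (E : set C) : cclosed E ->
  measurable [set p : R * R | ~ E (cpt p)].
Proof.
move=> clE; set N := [set p | _].
pose I (a : rat) (n : nat) : set R := `]ratr a - n.+1%:R^-1, ratr a + n.+1%:R^-1[%classic.
pose B (a b : rat) (n : nat) : set (R * R) := I a n `*` I b n.
pose B' a b n := if pselect (B a b n `<=` N) then B a b n else set0.
have -> : N = \bigcup_(a : rat) \bigcup_(b : rat) \bigcup_n B' a b n.
  apply/seteqP; split=> p; last first.
    by move=> [a _ [b _ [n _]]]; rewrite /B'; case: pselect => // h /h.
  move=> Np.
  have [e e0 he] : exists2 e : R, 0 < e & forall w, E w -> e <= cabs (cpt p - w).
    apply: contrapT => h; apply: Np; apply: clE => e e0.
    apply: contrapT => h2; apply: h; exists e => // w Ew.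
    by rewrite leNgt; apply/negP => lt; apply: h2; exists w.
  (* Two points of a box differ by at most [2 / (n + 1)] in each coordinate, hence by at most
     [4 / (n + 1) < e] in modulus. *)
  pose n := Num.truncn (4 / e).
  have n0 : (0 : R) < n.+1%:R^-1 by rewrite invr_gt0.
  have hn : 4 * n.+1%:R^-1 < e.
    rewrite ltr_pdivrMr ?ltr0n // mulrC -ltr_pdivrMr //.
    have /andP[_] := truncn_itv (ltW (divr_gt0 (ltr0n R 4) e0)); exact.
  have lt1 (u : R) : u - n.+1%:R^-1 < u + n.+1%:R^-1.
    by rewrite ltrD2l (lt_trans _ n0) // oppr_lt0.
  have key (u v d : R) : u - d < v -> v < u + d -> (v - d < u) && (u < v + d).
    by move=> *; apply/andP; split; lra.
  have key2 (a u v d : R) : a - d < u -> u < a + d -> a - d < v -> v < a + d ->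
      `|u - v| <= 2 * d.
    by move=> *; rewrite ler_norml; apply/andP; split; lra.
  have [a ha] : exists a : rat, p.1 \in `]ratr a - n.+1%:R^-1, ratr a + n.+1%:R^-1[.
    have [a] := rat_in_itvoo (lt1 p.1).
    by rewrite !in_itv /= => /andP[h1 h2]; exists a; rewrite in_itv /= key.
  have [b hb] : exists b : rat, p.2 \in `]ratr b - n.+1%:R^-1, ratr b + n.+1%:R^-1[.
    have [b] := rat_in_itvoo (lt1 p.2).
    by rewrite !in_itv /= => /andP[h1 h2]; exists b; rewrite in_itv /= key.
  exists a => //; exists b => //; exists n => //.
  rewrite /B'; case: pselect => h; first by split.
  exfalso; apply: h => p' []; rewrite /I /= !in_itv /= => /andP[h1 h2] /andP[h3 h4].
  move=> /he; rewrite leNgt => /negP; apply.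
  apply: le_lt_trans hn; apply: (le_trans (cabs_le_ReIm _)) => /=.
  move: ha hb; rewrite !in_itv /= => /andP[h5 h6] /andP[h7 h8].
  have -> : 4 * n.+1%:R^-1 = 2 * n.+1%:R^-1 + 2 * n.+1%:R^-1 :> R by ring.
  by apply: lerD; [apply: (key2 (ratr a)) | apply: (key2 (ratr b))].
apply: bigcupT_measurable_rat => a; apply: bigcupT_measurable_rat => b.
apply: bigcupT_measurable => n; rewrite /B'; case: (pselect _) => h.
  by apply: measurableX; exact: measurable_itv.
exact: measurable0.
Qed.

End ClosedMeasurable.

Section UnitInterval.
Variable R : realType.

Definition unit_itv : set R := `[0, 1[%classic.

Lemma measurable_unit_itv : measurable unit_itv.
Proof. exact: measurable_itv. Qed.

(* The library's Lebesgue measure lives on the alias [measurableTypeR R]; here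
   it is transported to [R] itself. *)
Definition unit_leb (A : set R) : \bar R := lebesgue_measure (A `&` unit_itv).

Let restr : {measure set (measurableTypeR R) -> \bar R} :=
  mrestr (@lebesgue_measure R) measurable_unit_itv.

Let unit_leb0 : unit_leb set0 = 0%E.
Proof. exact: (measure0 restr). Qed.

Let unit_leb_ge0 A : (0 <= unit_leb A)%E.
Proof. exact: (measure_ge0 restr). Qed.

Let unit_leb_sigma_additive : semi_sigma_additive unit_leb.
Proof. exact: (@measure_semi_sigma_additive _ (measurableTypeR R) R restr). Qed.

HB.instance Definition _ := isMeasure.Build _ R R unit_leb
  unit_leb0 unit_leb_ge0 unit_leb_sigma_additive.

Lemma unit_lebT : unit_leb setT = 1%E.
Proof.
rewrite /unit_leb setTI /unit_itv lebesgue_measure_itv /= lte_fin.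
by rewrite ltr01 -EFinB subr0.
Qed.

Let unit_leb_fin : fin_num_fun unit_leb.
Proof.
move=> A mA; rewrite ge0_fin_numE //.
apply: (@le_lt_trans _ _ (unit_leb setT)); last by rewrite unit_lebT ltry.
by rewrite le_measure ?inE.
Qed.

HB.instance Definition _ := Measure_isFinite.Build _ _ _ unit_leb unit_leb_fin.

End UnitInterval.

(** * The limit measure and its quantile function *)

Section LimitMeasure.
Variable R : realType.
Local Notation C := R[i].
Variables (q : nat -> nat -> R).
Hypothesis q_refine : forall l i, q l.+1 (2 * i)%N = q l i.
Hypothesis q_mono : forall l i j, (i <= j)%N -> q l i <= q l j.
Hypothesis q_pi : forall l i, - pi <= q l i <= pi.

Definition dyadic_index (l : nat) (x : R) : nat := Num.truncn ((2 ^ l)%:R * x).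

(** The inverse distribution function of the limit measure, which is built as an image of Lebesgue
    measure on [[0, 1[]; monotonicity gives measurability. *)
Definition quantile (x : R) : R := sup [set q l (dyadic_index l x) | l in setT].

Lemma quantile_ub x : has_sup [set q l (dyadic_index l x) | l in setT].
Proof.
split; first by exists (q 0%N (dyadic_index 0 x)), 0%N.
by exists pi => _ [l _ <-]; have /andP[] := q_pi l (dyadic_index l x).
Qed.

Lemma le_quantile l x : q l (dyadic_index l x) <= quantile x.
Proof. by apply: (sup_upper_bound (quantile_ub x)); exists l. Qed.

Lemma quantile_le x (b : R) : (forall l, q l (dyadic_index l x) <= b) -> quantile x <= b.
Proof.
move=> h; apply: ge_sup; first exact: (quantile_ub x).1.
by move=> _ [l _ <-].
Qed.

Lemma le_dyadic_index l x y : x <= y -> (dyadic_index l x <= dyadic_index l y)%N.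
Proof.
move=> xy; rewrite /dyadic_index; have [x0|x0] := ltP ((2 ^ l)%:R * x) 0.
  have /eqP -> // : Num.truncn ((2 ^ l)%:R * x) == 0%N.
  by rewrite -leqn0 truncn_le_nat (lt_trans x0).
rewrite truncn_ge_nat; first by rewrite (le_trans _ (ler_wpM2l _ xy)) // truncn_le.
by rewrite (le_trans x0) // ler_wpM2l.
Qed.

Lemma quantile_nondecreasing : {homo quantile : x y / x <= y}.
Proof.
move=> x y xy; apply: quantile_le => l; apply: le_trans (le_quantile l y).
by apply: q_mono; exact: le_dyadic_index.
Qed.

Lemma measurable_quantile : measurable_fun setT quantile.
Proof. by apply: measurable_realfun.nondecreasing_measurable => // x y; exact: quantile_nondecreasing. Qed.

Lemma q_refineX l k i : q (l + k) (i * 2 ^ k)%N = q l i.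
Proof.
elim: k i => [|k ih] i; first by rewrite addn0 muln1.
by rewrite addnS expnS mulnCA q_refine ih.
Qed.

Definition dyadic_itv (l i : nat) : set R :=
  `[i%:R / (2 ^ l)%:R, i.+1%:R / (2 ^ l)%:R[%classic.

Lemma measurable_dyadic_itv l i : measurable (dyadic_itv l i).
Proof. exact: measurable_itv. Qed.

Lemma dyadic_itvP l i x : dyadic_itv l i x <->
  i%:R <= (2 ^ l)%:R * x < i.+1%:R.
Proof.
have p0 : 0 < (2 ^ l)%:R :> R by rewrite ltr0n expn_gt0.
by rewrite /dyadic_itv /= in_itv /= ler_pdivrMr // ltr_pdivlMr // ![x * _]mulrC.
Qed.

Lemma dyadic_indexE l i x : dyadic_itv l i x -> dyadic_index l x = i.
Proof. by move=> /dyadic_itvP h; apply: truncn_def. Qed.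

Lemma quantile_dyadic l i x : dyadic_itv l i x -> q l i <= quantile x <= q l i.+1.
Proof.
move=> hx; have hi := dyadic_indexE hx; apply/andP; split.
  by rewrite -[X in q l X]hi; exact: le_quantile.
have /dyadic_itvP /andP[h1 h2] := hx.
have x0 : 0 <= x.
  have : 0 <= (2 ^ l)%:R * x by apply: le_trans h1.
  by rewrite pmulr_rge0 // ltr0n expn_gt0.
(* Both levels are compared through [q_refineX]: a finer index is at most [(i + 1) 2^(l'-l)], and a
   coarser index times [2^(l-l')] is at most [i]. *)
apply: quantile_le => l'; have [ll'|l'l] := leqP l l'.
  rewrite -(subnKC ll') -[leRHS](q_refineX l (l' - l)); apply: q_mono.
  apply: ltnW; rewrite /dyadic_index truncn_lt_nat ?mulr_ge0 //.
  by rewrite expnD !natrM mulrAC ltr_pM2r // ltr0n expn_gt0.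
rewrite -[leLHS](q_refineX l' (l - l')) subnKC ?(ltnW l'l) //; apply: q_mono.
apply: leqW; rewrite -hi /dyadic_index truncn_ge_nat ?mulr_ge0 //.
rewrite natrM -[in leRHS](subnKC (ltnW l'l)) expnD natrM mulrAC ler_wpM2r //.
by rewrite truncn_le mulr_ge0.
Qed.

Lemma unit_itv_dyadic l x : @unit_itv R x ->
  exists2 i, (i < 2 ^ l)%N & dyadic_itv l i x.
Proof.
rewrite /unit_itv /= in_itv /= => /andP[x0 x1].
have p0 : 0 < (2 ^ l)%:R :> R by rewrite ltr0n expn_gt0.
exists (dyadic_index l x).
  by rewrite truncn_lt_nat ?mulr_ge0 // -[ltRHS]mulr1 ltr_pM2l.
by apply/dyadic_itvP/truncn_itv; rewrite mulr_ge0.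
Qed.

Lemma quantile_in (E : set C) x : cclosed E ->
  (forall l i, (i < 2 ^ l)%N -> E (cis (q l i))) -> @unit_itv R x -> E (cis (quantile x)).
Proof.
move=> clE hE hx; apply: clE => e e0.
have e20 : 0 < e / 2 by rewrite divr_gt0.
have [_ [l _ <-] hl] := sup_adherent e20 (quantile_ub x).
have [i il hi] := unit_itv_dyadic l hx.
exists (cis (q l i)); first exact: hE.
have h := le_quantile l x; rewrite (dyadic_indexE hi) -/(quantile x) in hl h.
apply: (le_lt_trans (cis_lipschitz _ _)); rewrite ger0_norm ?subr_ge0 //.
rewrite mulrC -ltr_pdivlMr //; lra.
Qed.

Lemma unit_leb_dyadic l i : (i < 2 ^ l)%N ->
  @unit_leb R (dyadic_itv l i) = ((2 ^ l)%:R^-1)%:E.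
Proof.
move=> il; have p0 : 0 < (2 ^ l)%:R :> R by rewrite ltr0n expn_gt0.
rewrite /unit_leb setIidl.
  rewrite /dyadic_itv lebesgue_measure_itv /= lte_fin ltr_pM2r ?invr_gt0 //.
  by rewrite ltr_nat ltnSn -EFinB -mulrBl -natr1 addrAC subrr add0r mul1r.
move=> x /dyadic_itvP /andP[h1 h2]; rewrite /unit_itv /= in_itv /=; apply/andP; split.
  by rewrite -(pmulr_rge0 _ p0) (le_trans _ h1).
rewrite -(ltr_pM2l p0) mulr1; apply: (lt_le_trans h2); by rewrite ler_nat.
Qed.

Lemma integral_scaled_indic (A : set R) (k : R) : measurable A -> 0 <= k ->
  (\int[@unit_leb R]_x (k * \1_A x)%:E = k%:E * unit_leb A)%E.
Proof.
move=> mA k0.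
have mi : measurable_fun setT (fun x => (\1_A x : R)%:E).
  exact/measurable_EFinP/measurable_indic.
have -> : (fun x => (k * \1_A x)%:E) = (fun x => k%:E * (\1_A x : R)%:E)%E.
  by apply/funext => x; rewrite EFinM.
rewrite (@ge0_integralZl_EFin _ _ R (@unit_leb R) setT measurableT _ _ mi) //.
by rewrite (@integral_indic _ _ R (@unit_leb R) setT measurableT) // setIT.
Qed.

(** [h] is dominated by a step function plus [b] off [[0, 1[], a set of measure zero for [unit_leb];
    the bound [b] only makes the majorant valid everywhere. *)
Lemma integral_step_le (h : R -> \bar R) (c : nat -> R) (b : R) l :
  0 <= b -> (forall i, 0 <= c i) -> (forall x, (h x <= b%:E)%E) ->
  (forall i x, (i < 2 ^ l)%N -> dyadic_itv l i x -> (h x <= (c i)%:E)%E) ->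
  (\int[@unit_leb R]_x h x <= ((\sum_(i < 2 ^ l) c i) / (2 ^ l)%:R)%:E)%E.
Proof.
move=> b0 c0 hb hc.
pose g (j : 'I_(2 ^ l)) (x : R) : R := c j * \1_(dyadic_itv l j) x.
pose g' (x : R) : R := b * \1_(~` @unit_itv R) x.
have g0 j x : (0 <= g j x) by rewrite mulr_ge0.
have g'0 x : (0 <= g' x) by rewrite mulr_ge0.
have mg j : measurable_fun setT (g j).
  by apply: measurable_funM => //; apply: measurable_indic; exact: measurable_dyadic_itv.
have mg' : measurable_fun setT g'.
  by apply: measurable_funM => //; apply: measurable_indic; exact: (measurableC (@measurable_unit_itv R)).
have hg x : (h x <= (\sum_(j < 2 ^ l) (g j x)%:E) + (g' x)%:E)%E.
  have s0 : (0 <= \sum_(j < 2 ^ l) (g j x)%:E)%E.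
    by apply: sume_ge0 => j _; rewrite lee_fin.
  have [hx|hx] := pselect (@unit_itv R x).
    have [i il hi] := unit_itv_dyadic l hx.
    apply: (@le_trans _ _ (\sum_(j < 2 ^ l) (g j x)%:E)); last by rewrite leeDl // lee_fin.
    rewrite (bigD1 (Ordinal il)) //=.
    apply: (@le_trans _ _ (c i)%:E); first exact: hc.
    rewrite /g indicE mem_set // mulr1 leeDl // sume_ge0 // => j _.
    by rewrite lee_fin mulr_ge0.
  rewrite /g' indicE mem_set // mulr1.
  by apply: (le_trans (hb x)); rewrite leeDr.
apply: (@le_trans _ _
    (\int[@unit_leb R]_x ((\sum_(j < 2 ^ l) (g j x)%:E) + (g' x)%:E))%E).
  apply: le_integral_nonneg => x; first exact: hg.
  by apply: adde_ge0; [apply: sume_ge0 => j _|]; rewrite lee_fin.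
rewrite ge0_integralD //=.
- have -> : (\int[@unit_leb R]_x (g' x)%:E = 0)%E.
    rewrite integral_scaled_indic //; last exact: (measurableC (@measurable_unit_itv R)).
    by rewrite /unit_leb setICl measure0 mule0.
  rewrite adde0 ge0_integral_sum //; last 2 first.
  + by move=> j; exact/measurable_EFinP.
  + by move=> j x _; rewrite lee_fin.
  rewrite mulr_suml -sumEFin le_eqVlt; apply/orP; left; apply/eqP.
  apply: eq_bigr => j _; rewrite integral_scaled_indic //; last exact: measurable_dyadic_itv.
  by rewrite EFinM; congr (_ * _)%E; exact: unit_leb_dyadic.
- by move=> x _; apply: sume_ge0 => j _; rewrite lee_fin.
- by apply: emeasurable_sum => j; exact/measurable_EFinP.
- by move=> x _; rewrite lee_fin.
- exact/measurable_EFinP.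
Qed.

(** On a dyadic interval the error is [L] times the increment of [q l]. The increments telescope to
    at most [2 pi], and each interval has mass [2^-l]. *)
Lemma integral_quantile_le (phi : R -> R) (L b t : R) l :
  0 <= L -> (forall x, 0 <= phi x <= b) ->
  (forall x y, phi x <= phi y + L * `|x - y|) ->
  (\int[@unit_leb R]_y (phi (t - quantile y))%:E <=
   ((\sum_(i < 2 ^ l) phi (t - q l i) + L * (2 * pi)) / (2 ^ l)%:R)%:E)%E.
Proof.
move=> L0 hb hL.
pose c i := phi (t - q l i) + L * (q l i.+1 - q l i).
have b0 : 0 <= b by have /andP[h1 h2] := hb 0; exact: le_trans h2.
have c0 i : 0 <= c i.
  rewrite addr_ge0 ?mulr_ge0 ?subr_ge0 ?q_mono //; by have /andP[] := hb (t - q l i).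
apply: (le_trans (@integral_step_le _ c b l b0 c0 _ _)).
- by move=> x; rewrite lee_fin; have /andP[] := hb (t - quantile x).
- move=> i x _ /quantile_dyadic /andP[h1 h2]; rewrite lee_fin.
  apply: (le_trans (hL _ (t - q l i))); rewrite lerD2l ler_wpM2l //.
  have -> : t - quantile x - (t - q l i) = - (quantile x - q l i) by ring.
  by rewrite normrN ger0_norm ?subr_ge0 // lerD2r.
rewrite lee_fin ler_wpM2r ?invr_ge0 // /c big_split /= lerD2l -mulr_sumr ler_wpM2l //.
rewrite -(big_mkord xpredT (fun i => q l i.+1 - q l i)) telescope_sumr //.
by have /andP[_] := q_pi l (2 ^ l); have /andP[] := q_pi l 0; lra.
Qed.

(** Discretizing both variables at level [l] costs [4 pi L / 2^l], and the hypothesis adds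
    [K / 2^l]; both vanish as [l] grows. *)
Lemma double_integral_quantile_le (phi : R -> R) (L b S K : R) :
  0 <= L -> (forall x, 0 <= phi x <= b) ->
  (forall x y, phi x <= phi y + L * `|x - y|) -> 0 <= K ->
  (forall l, \sum_(i < 2 ^ l) \sum_(j < 2 ^ l) phi (q l i - q l j) <=
     S * (2 ^ l)%:R ^+ 2 + K * (2 ^ l)%:R) ->
  (\int[@unit_leb R]_x \int[@unit_leb R]_y (phi (quantile x - quantile y))%:E <= S%:E)%E.
Proof.
move=> L0 hb hL K0 hS; apply/lee_addgt0Pr => e e0.
have pi0 : (0 : R) <= pi by exact: pi_ge0.
pose K' := K + 4 * (L * pi).
have K'0 : 0 <= K' by rewrite addr_ge0 // !mulr_ge0.
pose l := Num.truncn (K' / e).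
have M0 : 0 < (2 ^ l)%:R :> R by rewrite ltr0n expn_gt0.
have hl : K' / (2 ^ l)%:R <= e.
  rewrite ler_pdivrMr // mulrC -ler_pdivrMr //.
  have /andP[_ /ltW h] := truncn_itv (divr_ge0 K'0 (ltW e0)).
  by apply: (le_trans h); rewrite ler_nat -/l ltn_expl.
have Mn0 := gt_eqF M0.
pose D i := q l i.+1 - q l i.
have D0 i : 0 <= D i by rewrite subr_ge0 q_mono.
have sumD : \sum_(i < 2 ^ l) D i <= 2 * pi.
  rewrite -(big_mkord xpredT D) telescope_sumr //.
  by have /andP[_] := q_pi l (2 ^ l); have /andP[] := q_pi l 0; lra.
pose c i := (\sum_(j < 2 ^ l) (phi (q l i - q l j) + L * D i) + L * (2 * pi)) / (2 ^ l)%:R.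
have phi0 x : 0 <= phi x by have /andP[] := hb x.
have b0 : 0 <= b by have /andP[h1 h2] := hb 0; exact: le_trans h2.
have c0 i : 0 <= c i.
  rewrite divr_ge0 // addr_ge0 ?mulr_ge0 //; apply: sumr_ge0 => j _.
  by rewrite addr_ge0 ?mulr_ge0.
pose B := ((2 ^ l)%:R * b + L * (2 * pi)) / (2 ^ l)%:R.
have B0 : 0 <= B by rewrite divr_ge0 ?addr_ge0 ?mulr_ge0.
apply: (le_trans (@integral_step_le _ c B l B0 c0 _ _)).
- move=> x; apply: (le_trans (@integral_quantile_le phi L b (quantile x) l L0 hb hL)).
  rewrite lee_fin ler_wpM2r ?invr_ge0 // lerD2r -sum_ord_const; apply: ler_sum => i _.
  by have /andP[] := hb (quantile x - q l i).
- move=> i x _ /quantile_dyadic /andP[h1 h2].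
  apply: (le_trans (@integral_quantile_le phi L b (quantile x) l L0 hb hL)).
  rewrite lee_fin ler_wpM2r ?invr_ge0 // lerD2r; apply: ler_sum => j _.
  apply: (le_trans (hL _ (q l i - q l j))); rewrite lerD2l ler_wpM2l //.
  have -> : quantile x - q l j - (q l i - q l j) = quantile x - q l i by ring.
  by rewrite ger0_norm ?subr_ge0 // lerD2r.
rewrite -EFinD lee_fin.
have -> : \sum_(i < 2 ^ l) c i =
   (\sum_(i < 2 ^ l) \sum_(j < 2 ^ l) phi (q l i - q l j)) / (2 ^ l)%:R
   + L * (\sum_(i < 2 ^ l) D i) + L * (2 * pi).
  rewrite /c -mulr_suml big_split /= sum_ord_const.
  under eq_bigr do rewrite big_split /= sum_ord_const.
  rewrite big_split /= -mulr_sumr -mulr_sumr.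
  by field; rewrite Mn0.
have hS' := hS l; set SS := \sum_(i < 2 ^ l) \sum_(j < 2 ^ l) _ in hS' *.
set M := (2 ^ l)%:R in M0 Mn0 hl hS' *.
have h1 : SS / M <= S * M + K.
  by rewrite ler_pdivrMr // mulrDl -mulrA -expr2.
have h2 : L * (\sum_(i < 2 ^ l) D i) <= L * (2 * pi) by rewrite ler_wpM2l.
apply: (@le_trans _ _ (S + K' / M)); last by rewrite lerD2l.
rewrite ler_pdivrMr //.
have -> : (S + K' / M) * M = S * M + K' by field; rewrite Mn0.
rewrite /K'; lra.
Qed.

Lemma measurable_angle_ker J : measurable_fun setT (@angle_ker R J).
Proof.
apply: continuous_measurable_fun => x; apply/cvgrPdist_lt => e e0.
have [L L0 hL] := @angle_ker_lipschitz R J.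
have L1 : 0 < L + 1 by rewrite ltr_wpDl.
have d0 : 0 < e / (L + 1) by rewrite divr_gt0.
near=> y; have hy : `|x - y| < e / (L + 1).
  by near: y; apply: (@cvgr_dist_lt _ _ _ _ _ id x cvg_id).
have hy' : (L + 1) * `|x - y| < e by rewrite mulrC -ltr_pdivlMr.
have := hL x y; have := hL y x; rewrite (distrC y x).
have := normr_ge0 (x - y); rewrite mulrDl mul1r in hy' => ? ? ?.
by rewrite ltr_norml; apply/andP; split; lra.
Unshelve. all: by end_near.
Qed.

End LimitMeasure.

Section LogEnergyOfQuantiles.
Variable R : realType.
Local Notation C := R[i].
Variables (q : nat -> nat -> R).
Hypothesis q_refine : forall l i, q l.+1 (2 * i)%N = q l i.
Hypothesis q_mono : forall l i j, (i <= j)%N -> q l i <= q l j.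
Hypothesis q_pi : forall l i, - pi <= q l i <= pi.

Let mQ : measurable_fun setT (quantile q).
Proof. exact: measurable_quantile. Qed.

Definition quantile_point (x : R) : R * R := (cos (quantile q x), sin (quantile q x)).

Lemma measurable_quantile_point : measurable_fun setT quantile_point.
Proof.
by apply: measurable_fun_pair; apply: measurableT_comp => //;
  try exact: mQ; apply: continuous_measurable_fun;
  [exact: continuous_cos | exact: continuous_sin].
Qed.

(** Off the diagonal one large [J] suffices. On it the truncated kernels equal [1 + 4 J], which
    forces [u = +oo], the value of [log_kernel] there. *)
Lemma log_kernel_le x y (u : \bar R) :
  (forall J, (1 + 4 * angle_ker J (quantile q x - quantile q y))%:E <= u)%E ->
  (log_kernel (quantile_point x) (quantile_point y) <= u)%E.
Proof.
set a := quantile q x; set b := quantile q y => hu; rewrite /log_kernel.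
have -> : cpt (quantile_point x) = cis a by [].
have -> : cpt (quantile_point y) = cis b by [].
rewrite cabs_cisB.
have eqE : (cis a == cis b) = (cis (a - b) == 1).
  by rewrite -subr_eq0 -cabs_eq0 cabs_cisB cabs_eq0 subr_eq0.
rewrite eqE; case: eqVneq => [e|ne]; last first.
  have [|J0 hJ] := @lnV_le_dyadic_ker R (cis (a - b)) _ ne; first by rewrite cabs_cis.
  by apply: (le_trans _ (hu J0)); rewrite lee_fin hJ.
have hJ J : ((J%:R : R)%:E <= u)%E.
  apply: (le_trans _ (hu J)); rewrite lee_fin /angle_ker e dyadic_ker1.
  have := ler0n R J; lra.
case: u {hu} hJ => [r| |] hJ; [|by []|by have := hJ 0%N].
have := hJ (Num.truncn `|r|).+1; rewrite lee_fin leNgt => /negP [].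
apply: (le_lt_trans (ler_norm r)).
by have /andP[] := truncn_itv (normr_ge0 r).
Qed.

(** The kernels [1 + 4 * angle_ker J] increase with [J], their limit dominates the positive part of
    [log_kernel], and all their double integrals are at most [1 + 4 V]; monotone convergence is used
    in each variable. *)
Lemma double_integral_log_kernel_le (V : R) :
  (forall J, exists2 K, 0 <= K & forall l,
     \sum_(i < 2 ^ l) \sum_(j < 2 ^ l) angle_ker J (q l i - q l j)
     <= V * (2 ^ l)%:R ^+ 2 + K * (2 ^ l)%:R) ->
  (\int[@unit_leb R]_x \int[@unit_leb R]_y
     maxe (log_kernel (quantile_point x) (quantile_point y)) 0 <= (1 + 4 * V)%:E)%E.
Proof.
move=> hV; pose phi J t : R := 1 + 4 * angle_ker J t.
have phi0 J t : 0 <= phi J t by rewrite addr_ge0 // mulr_ge0 // angle_ker_ge0.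
have mphi J : measurable_fun setT (phi J).
  apply: measurable_funD => //; apply: measurable_funM => //.
  exact: (measurable_angle_ker J).
have nphi t : {homo phi^~ t : m n / (m <= n)%N >-> m <= n}.
  by move=> m n mn; rewrite lerD2l ler_wpM2l // le_dyadic_ker.
pose g J (x y : R) := (phi J (quantile q x - quantile q y))%:E.
have mdiff : measurable_fun setT (fun z : R * R => quantile q z.1 - quantile q z.2).
  by apply: measurable_funB; apply: measurableT_comp => //; exact: mQ.
have mg2 J : measurable_fun setT (fun z : R * R => g J z.1 z.2).
  by apply/measurable_EFinP; apply: measurableT_comp.
have mg1 J x : measurable_fun setT (g J x).
  apply/measurable_EFinP; apply: (measurableT_comp (mphi J)).
  by apply: measurable_funB => //; exact: mQ.
have mG J : measurable_fun setT (fun x => \int[@unit_leb R]_y g J x y)%E.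
  apply: (@measurable_fun_fubini_tonelli_F _ _ _ _ _ (@unit_leb R) (fun z => g J z.1 z.2)) => //.
  by move=> z; rewrite lee_fin.
have ng x y : {homo (fun J => g J x y) : m n / (m <= n)%N >-> (m <= n)%E}.
  by move=> m n mn; rewrite lee_fin nphi.
have g0 J x y : (0 <= g J x y)%E by rewrite lee_fin.
have hle J : (\int[@unit_leb R]_x \int[@unit_leb R]_y g J x y <= (1 + 4 * V)%:E)%E.
  have [L L0 hL] := @angle_ker_lipschitz R J; have [K K0 hK] := hV J.
  apply: (double_integral_quantile_le q_refine q_mono q_pi (phi := phi J) (L := 4 * L) (b := 1 + 4 * J%:R) (K := 4 * K)).
  - by rewrite mulr_ge0.
  - move=> t; rewrite phi0 /= lerD2l ler_wpM2l // dyadic_ker_le //.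
    by rewrite cabs_cis.
  - by move=> s t; have := hL s t; rewrite /phi; lra.
  - by rewrite mulr_ge0.
  - move=> l; rewrite /phi.
    under eq_bigr do rewrite big_split /= sum_ord_const -mulr_sumr.
    rewrite big_split /= sum_ord_const -mulr_sumr; have := hK l; lra.
apply: (@le_trans _ _ (\int[@unit_leb R]_x \int[@unit_leb R]_y limn (fun J => g J x y))%E).
  have lim_ge x y J : (g J x y <= limn (fun J => g J x y))%E.
    rewrite (cvg_lim _ (ereal_nondecreasing_cvgn (ng x y))) //.
    by apply: ereal_sup_ubound; exists J.
  have lim0 x y : (0 <= limn (fun J => g J x y))%E by exact: le_trans (lim_ge x y 0%N).
  apply: le_integral_nonneg => x; last by apply: integral_ge0.
  apply: le_integral_nonneg => y //.
  by rewrite ge_max lim0 andbT; apply: log_kernel_le => J; exact: lim_ge.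
have -> : (\int[@unit_leb R]_x \int[@unit_leb R]_y limn (fun J => g J x y) =
  \int[@unit_leb R]_x limn (fun J => \int[@unit_leb R]_y g J x y))%E.
  apply: eq_integral => x _; rewrite monotone_convergence //.
rewrite monotone_convergence //.
- apply: lime_le; last by apply: nearW => J; exact: hle.
  apply/cvg_ex; eexists; apply: ereal_nondecreasing_cvgn => m n mn.
  apply: le_integral_nonneg => x; last by apply: integral_ge0.
  by apply: le_integral_nonneg => y //; exact: ng.
- by move=> J x _; apply: integral_ge0.
- move=> x _ m n mn; apply: le_integral_nonneg => y //; exact: ng.
Qed.

End LogEnergyOfQuantiles.

(** * From capacity zero to large discrete energies *)

Section Capacity.
Variable R : realType.
Local Notation C := R[i].
Variable E : set C.
Hypotheses (clE : cclosed E) (onE : on_circle E).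

Lemma finite_energy_measure (V : R) :
  (forall J, exists m s,
    [/\ config E m s, (0 < m)%N & energy J s <= V * m%:R ^+ 2]) ->
  exists2 mu : {measure set (R * R)%type -> \bar R},
    prob_measure_on E mu & (log_energy mu <= (1 + 4 * V)%:E)%E.
Proof.
move=> /(limit_quantiles clE onE) [q [q1 q2 q3 q4 q5]].
pose psi := quantile_point q.
have mpsi : measurable_fun setT psi by exact: measurable_quantile_point.
have [mu hmu] := pushforward_measure (@unit_leb R) mpsi.
exists mu.
  split; first by rewrite hmu preimage_setT; exact: unit_lebT.
  transitivity (lebesgue_measure (psi @^-1` [set p | ~ E (cpt p)] `&` @unit_itv R)).
    exact: hmu.
  rewrite (_ : _ `&` _ = set0) ?measure0 //.
  apply/seteqP; split=> // x [/= hx1 hx2]; apply: hx1.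
  exact: (quantile_in q4 clE q3 hx2).
rewrite /log_energy.
pose F p := (\int[@unit_leb R]_y maxe (log_kernel p (psi y)) 0)%E.
have F0 p : (0 <= F p)%E.
  by apply: integral_ge0 => y _; rewrite le_max lexx orbT.
apply: (@le_trans _ _ (\int[mu]_p F p)%E).
  apply: le_integral_nonneg => // p.
  apply: (@le_trans _ _ (\int[mu]_r maxe (log_kernel p r) 0)%E).
    by apply: le_integral_nonneg => r; rewrite le_max lexx ?orbT.
  apply: (integral_pushforward_le mpsi hmu) => r.
  by rewrite le_max lexx orbT.
apply: (le_trans (integral_pushforward_le mpsi hmu F0)).
exact: (double_integral_log_kernel_le q1 q2 q4 q5).
Qed.

(** Points of the circle are at distance at most [2]. This excludes the value [-oo] of
    [robin_constant], which [log_capacity] would also send to [0]. *)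
Lemma log_energy_ge (mu : {measure set (R * R)%type -> \bar R}) :
  prob_measure_on E mu -> (- (ln 2)%:E <= log_energy mu)%E.
Proof.
move=> [mu1 muE]; have mE := measurable_cclosedC clE.
have l0 : 0 <= ln 2 :> R by rewrite ln_ge0 // ler1n.
apply: (integral_ge_cst mu1 mE muE l0) => p /= Ep.
apply: (integral_ge_cst mu1 mE muE l0) => r /= Er.
have {}Ep : E (cpt p) by apply: contrapT.
have {}Er : E (cpt r) by apply: contrapT.
rewrite /log_kernel; case: eqVneq => [|ne]; first by rewrite leey.
rewrite lee_fin lerN2 ler_ln ?posrE ?cabs_gt0 ?subr_eq0 //.
by apply: (le_trans (cabsB _ _)); rewrite (onE Ep) (onE Er).
Qed.

(** Otherwise every [J] has a configuration of mean energy below [V]; the limit measure then has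
    energy at most [1 + 4 V], the Robin constant is finite and the capacity is an exponential, hence
    positive. *)
Lemma capacity_zero_energy (V : R) : log_capacity E = 0 ->
  exists J, forall m s, config E m s -> (0 < m)%N -> V <= energy J s / m%:R ^+ 2.
Proof.
move=> cap0; apply: contrapT => hno.
have [J|mu hmu hle] := @finite_energy_measure V.
  apply: contrapT => h; apply: hno; exists J => m s hs m0.
  rewrite leNgt; apply/negP => lt; apply: h; exists m, s; split=> //.
  by rewrite -ler_pdivrMr ?exprn_gt0 ?ltr0n // ltW.
have h1 : (robin_constant E <= (1 + 4 * V)%:E)%E.
  by apply: le_trans hle; apply: ereal_inf_lbound; exists mu.
have h2 : (- (ln 2)%:E <= robin_constant E)%E.
  by apply: le_ereal_inf_tmp => _ [nu hnu <-]; exact: log_energy_ge.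
move: cap0; rewrite /log_capacity.
case: (robin_constant E) h1 h2 => [v| |] // _ _ /eqP.
by rewrite gt_eqF // expR_gt0.
Qed.

End Capacity.

(** * Cut-off polynomials and density in [C(E)] *)

Section CutOff.
Variable R : realType.
Local Notation C := R[i].
Implicit Types (z w u : C) (E : set C).

Lemma expR1_le4 : expR 1 <= 4 :> R.
Proof.
have h : 2^-1 <= (expR 2^-1)^-1 :> R.
  have := expR_ge1Dx (- 2^-1 : R); rewrite expRN; lra.
have e0 := expR_gt0 (2^-1 : R).
have h2 : expR 2^-1 <= 2 :> R by rewrite -lef_pV2 ?posrE.
have -> : (1 : R) = 2^-1 + 2^-1 by lra.
rewrite expRD; have := ler_pM (ltW e0) (ltW e0) h2 h2; lra.
Qed.

Lemma exprD1V_le4 m : (0 < m)%N -> (1 + m%:R^-1) ^+ m <= 4 :> R.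
Proof.
move=> m0; have mn0 : m%:R != 0 :> R by rewrite pnatr_eq0 -lt0n.
apply: le_trans expR1_le4.
have -> : expR 1 = expR (m%:R^-1) ^+ m :> R by rewrite -expRM_natl mulfV.
by rewrite lerXn2r ?nnegrE ?expR_ge0 ?addr_ge0 ?invr_ge0 // expR_ge1Dx.
Qed.

Lemma cabs_1Bdiv_sqr u m : (0 < m)%N ->
  cabs (1 - u / m%:R) ^+ 2 = 1 - 2 * complex.Re u / m%:R + cabs u ^+ 2 / m%:R ^+ 2.
Proof.
move=> m0; have mn0 : m%:R != 0 :> R by rewrite pnatr_eq0 -lt0n.
rewrite cabsB_sqr cabs1 expr1n cabsM cabsV cabs_nat exprMn exprVn.
have -> : complex.Re (1 * (u / m%:R)^*%C) = complex.Re u / m%:R.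
  by rewrite mul1r natCE -fmorphV; case: u => a b /=; rewrite mulr0 subr0.
by rewrite addrAC mulrA.
Qed.

(** Since [Re u >= 0], [|1 - u/m|^2 <= 1 + |u|^2 / m^2 <= 1 + 1/m]. Powers up to [m] stay below [4],
    and the square root gives [2]. *)
Lemma expr_1Bdiv_le2 u m k : (0 < m)%N -> 0 <= complex.Re u ->
  cabs u ^+ 2 <= m%:R -> (k <= m)%N -> cabs (1 - u / m%:R) ^+ k <= 2.
Proof.
move=> m0 u0 um km; have mp : 0 < m%:R :> R by rewrite ltr0n.
rewrite -(ler_pXn2r (n := 2)) ?nnegrE ?exprn_ge0 ?cabs_ge0 //.
rewrite exprAC cabs_1Bdiv_sqr //.
have h : 1 - 2 * complex.Re u / m%:R + cabs u ^+ 2 / m%:R ^+ 2 <= 1 + m%:R^-1.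
  have h1 : 0 <= 2 * complex.Re u / m%:R by rewrite divr_ge0 ?mulr_ge0.
  have h2 : cabs u ^+ 2 / m%:R ^+ 2 <= m%:R^-1.
    by rewrite ler_pdivrMr ?exprn_gt0 // expr2 mulKf ?gt_eqF.
  lra.
have h0 : 0 <= 1 - 2 * complex.Re u / m%:R + cabs u ^+ 2 / m%:R ^+ 2.
  by rewrite -cabs_1Bdiv_sqr // sqr_ge0.
apply: (@le_trans _ _ ((1 + m%:R^-1) ^+ k)).
  by apply: lerXn2r; rewrite ?nnegrE // addr_ge0 ?invr_ge0.
apply: (@le_trans _ _ ((1 + m%:R^-1) ^+ m)).
  by apply: ler_weXn2l => //; rewrite lerDl invr_ge0.
by apply: (le_trans (exprD1V_le4 m0)); rewrite -natrX.
Qed.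

(** With [x = N/m], [|1 - u/m|^2 <= 1 - x]. Now [(1 - x)^m (1 + x)^m <= 1] and [(1 + x)^m >= 1 + N]
    by Bernoulli. *)
Lemma expr_1Bdiv_small u m (N : R) : (0 < m)%N -> 0 < N -> N <= complex.Re u ->
  cabs u ^+ 2 <= N * m%:R -> (cabs (1 - u / m%:R) ^+ m) ^+ 2 <= (1 + N)^-1.
Proof.
move=> m0 N0 Nu um; have mp : 0 < m%:R :> R by rewrite ltr0n.
rewrite exprAC; set x := N / m%:R.
have x0 : 0 < x by rewrite divr_gt0.
have h : cabs (1 - u / m%:R) ^+ 2 <= 1 - x.
  rewrite cabs_1Bdiv_sqr //.
  have h1 : cabs u ^+ 2 / m%:R ^+ 2 <= x.
    rewrite ler_pdivrMr ?exprn_gt0 // /x expr2 mulrA divfK ?gt_eqF //.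
  have h2 : x <= complex.Re u / m%:R by rewrite ler_wpM2r ?invr_ge0.
  have -> : 2 * complex.Re u / m%:R = 2 * (complex.Re u / m%:R) by rewrite mulrA.
  lra.
have x1 : 0 <= 1 - x by apply: le_trans h; exact: sqr_ge0.
apply: (@le_trans _ _ ((1 - x) ^+ m)); first by rewrite lerXn2r ?nnegrE ?sqr_ge0.
rewrite -div1r ler_pdivlMr ?addr_gt0 //.
have bern k : 1 + k%:R * x <= (1 + x) ^+ k.
  elim: k => [|k ih]; first by rewrite mul0r addr0 expr0.
  rewrite exprS; apply: (@le_trans _ _ ((1 + x) * (1 + k%:R * x))).
    rewrite -natr1; have : 0 <= k%:R * x ^+ 2 by rewrite mulr_ge0 ?sqr_ge0.
    nra.
  by rewrite ler_wpM2l // addr_ge0 // ltW.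
have hm : 1 + N <= (1 + x) ^+ m.
  have := bern m; rewrite /x; have -> : m%:R * (N / m%:R) = N; last by [].
  by rewrite mulrC divfK ?gt_eqF.
apply: (@le_trans _ _ ((1 - x) ^+ m * (1 + x) ^+ m)).
  by rewrite ler_wpM2l ?exprn_ge0.
have y0 : 0 <= (1 - x) * (1 + x) by apply: mulr_ge0 => //; lra.
have y1 : (1 - x) * (1 + x) <= 1 by have := sqr_ge0 x; nra.
by rewrite -exprMn; exact: exprn_ile1.
Qed.

Lemma horner_1BexprB (G : {poly C}) (c z : C) m :
  (1 - (1 - c *: G) ^+ m).[z] = 1 - (1 - G.[z] * c) ^+ m.
Proof. by rewrite !hornerE [c * _]mulrC. Qed.

(* [h = 1 - (1 - F/m)^m] is a polynomial substitute for [1 - exp (-F)], where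
   [F] has nonnegative real part on the circle, large real part on [E] and
   small Dirichlet norm. *)
Lemma cutoff_poly E (d : R) : cclosed E -> on_circle E -> log_capacity E = 0 -> 0 < d ->
  exists h : {poly C},
    [/\ forall z, cabs z = 1 -> cabs h.[z] <= 3,
        forall w, E w -> cabs (h.[w] - 1) <= d &
        dle (pcoef h) d].
Proof.
move=> clE onE cap0 d0.
have [E0|nE] := pselect (E !=set0); last first.
  exists 0; split=> [z _|w Ew|n]; first by rewrite horner0 cabs0.
    by exfalso; apply: nE; exists w.
  rewrite big1 ?(ltW d0) // => k _.
  by rewrite /dirichlet_weighted /pcoef coef0 cabs0 expr0n mulr0.
(* Chosen so that [(1 + N)^-1 <= d^2], the squared error on [E]. *)
pose N : R := (d ^+ 2)^-1.
have N0 : 0 < N by rewrite invr_gt0 exprn_gt0.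
(* [2 * 4 ^+ 2] comes from [dle_lipschitz] with constant [4], and [16 N^2 / V'] bounds the squared
   norm of [G]; the summand [W / d] of [V] then gives [W / V' <= d]. *)
have [W W0 eW] : exists2 W : R, 0 <= W & W = 2 * 4 ^+ 2 * (16 * N ^+ 2).
  by eexists; last reflexivity; rewrite !mulr_ge0 ?exprn_ge0 ?(ltW N0).
pose V : R := 2 + W / d.
have V2 : 2 <= V by rewrite lerDl divr_ge0 // ltW.
have [J hJ] := capacity_zero_energy clE onE V cap0.
have [V' VV' [F [F0 FE dF]]] := equilibrium_poly onE E0 hJ.
have V'0 : 0 < V' by lra.
(* As [V' >= 2], [V' - 1 >= V' / 2], so this scaling raises the real part on [E] to at least [N]. *)
pose t : R := 2 * N / V'.
have t0 : 0 < t by rewrite divr_gt0 // mulr_gt0.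
pose G : {poly C} := (t%:C)%C *: F.
have ReG z : complex.Re G.[z] = t * complex.Re F.[z].
  by rewrite /G hornerZ; case: (F.[z]) => a b /=; rewrite mul0r subr0.
have G0 z : cabs z = 1 -> 0 <= complex.Re G.[z].
  by move=> hz; rewrite ReG mulr_ge0 ?F0 // ltW.
have GE w : E w -> N <= complex.Re G.[w].
  move=> Ew; rewrite ReG; apply: (@le_trans _ _ (t * (V' / 2))).
    have -> : t * (V' / 2) = N by rewrite /t; field; rewrite gt_eqF.
    by [].
  rewrite ler_wpM2l ?(ltW t0) //; apply: le_trans (FE _ Ew); lra.
have dG : dle (pcoef G) (16 * N ^+ 2 / V').
  have -> : 16 * N ^+ 2 / V' = cabs ((t%:C)%C : C) ^+ 2 * (4 * V').
    by rewrite cabs_real ger0_norm ?(ltW t0) // /t; field; rewrite gt_eqF.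
  by apply: dle_eq (dle_scale (t%:C)%C dF) => k; rewrite /pcoef coefZ.
have [K K0 hK] := poly_bounded G.
pose m := (Num.truncn (K ^+ 2 + K ^+ 2 / N)).+1.
have [mK mKN] : K ^+ 2 <= m%:R /\ K ^+ 2 <= N * m%:R.
  have p1 : 0 <= K ^+ 2 by exact: sqr_ge0.
  have p2 : 0 <= K ^+ 2 / N by rewrite divr_ge0 // ltW.
  have /andP[_ /ltW h] := truncn_itv (addr_ge0 p1 p2).
  split; first by apply: le_trans h; rewrite lerDl.
  by rewrite mulrC -ler_pdivrMr //; apply: le_trans h; rewrite lerDr.
have m0 : (0 < m)%N by [].
have hK1 z : cabs z = 1 -> cabs G.[z] ^+ 2 <= K ^+ 2.
  by move=> hz; rewrite lerXn2r ?nnegrE ?cabs_ge0 ?(ltW K0) // hK // hz.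
have A2 z k : cabs z = 1 -> (k <= m)%N -> cabs (1 - G.[z] / m%:R) ^+ k <= 2.
  by move=> hz km; apply: expr_1Bdiv_le2 => //; [exact: G0 | exact: le_trans (hK1 _ hz) mK].
pose h : {poly C} := 1 - (1 - (m%:R^-1) *: G) ^+ m.
have hh z : h.[z] = 1 - (1 - G.[z] / m%:R) ^+ m.
  exact: horner_1BexprB.
have mn0 : m%:R != 0 :> R by rewrite pnatr_eq0.
exists h; split.
- move=> z hz; rewrite hh; apply: (le_trans (cabsB _ _)).
  rewrite cabs1 cabsX; have := A2 z m hz (leqnn m); lra.
- move=> w Ew; rewrite hh addrAC subrr add0r cabsN cabsX.
  rewrite -(ler_pXn2r (n := 2)) ?nnegrE ?exprn_ge0 ?cabs_ge0 ?(ltW d0) //.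
  have := @expr_1Bdiv_small G.[w] m N m0 N0 (GE _ Ew) (le_trans (hK1 _ (onE _ Ew)) mKN).
  move=> hs; apply: (le_trans hs); rewrite -[leRHS]invrK lef_pV2 ?posrE ?addr_gt0 //.
  by rewrite -/N; lra.
(* The [m] from the difference of powers cancels the [1/m] in the bases, so the constant [4 = 2 * 2]
   does not involve [m], although [m] depends on the sup norm of [G]. *)
have lip (z w u v : C) : (forall k, (k <= m)%N -> cabs z ^+ k <= 2) ->
    (forall k, (k <= m)%N -> cabs w ^+ k <= 2) ->
    z = 1 - u / m%:R -> w = 1 - v / m%:R ->
    cabs (w ^+ m - z ^+ m) <= 4 * cabs (u - v).
  move=> hz hw ez ew; apply: (le_trans (cabs_expB_le hw hz)).
  have -> : w - z = (u - v) / m%:R by rewrite ez ew; ring.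
  rewrite cabsM cabsV cabs_nat.
  have -> : m%:R * (2 * 2) * (cabs (u - v) / m%:R) = 4 * cabs (u - v) by field.
  by [].
have := @dle_lipschitz R h G 4 (16 * N ^+ 2 / V') _ _ dG.
rewrite [2 * _ * (_ / _)]mulrA -eW => hd; apply: (@dle_le _ _ (W / V')).
  rewrite ler_pdivrMr // mulrC -ler_pdivrMr //; rewrite /V in VV'; lra.
apply: hd.
- move=> z w hz hw; rewrite !hh.
  have -> (a b : C) : 1 - a - (1 - b) = b - a by ring.
  by apply: (lip (1 - G.[z] / m%:R) (1 - G.[w] / m%:R)) => // k km; exact: A2.
- move=> z hz; rewrite hh -{1}(expr1n _ m) -[in leRHS](subr0 G.[z]).
  apply: (lip (1 - G.[z] / m%:R) 1) => //.
  + by move=> k km; exact: A2.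
  + by move=> k _; rewrite cabs1 expr1n ler1n.
  + by rewrite mul0r subr0.
Qed.

End CutOff.

(** * Uniform approximation on [E] by polynomials *)

Section PolynomialDensity.
Variable R : realType.
Local Notation C := R[i].
Variable E : set C.
Hypotheses (clE : cclosed E) (onE : on_circle E) (cap0 : log_capacity E = 0).
Implicit Types (z w : C) (u v : C -> C) (p q : {poly C}).

Definition papprox u := forall e : R, 0 < e ->
  exists p : {poly C}, forall z, E z -> cabs (p.[z] - u z) < e.

Lemma papprox_poly p : papprox (horner p).
Proof. by move=> e e0; exists p => z _; rewrite subrr cabs0. Qed.

Lemma papprox_ext u v : (forall z, E z -> u z = v z) -> papprox u -> papprox v.
Proof. by move=> uv hu e /hu [p hp]; exists p => z Ez; rewrite -uv ?hp. Qed.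

Lemma papprox_cst (c : C) : papprox (fun=> c).
Proof.
by apply: papprox_ext (papprox_poly c%:P) => z _; rewrite hornerC.
Qed.

Lemma papprox_id : papprox id.
Proof. by apply: papprox_ext (papprox_poly 'X) => z _; rewrite hornerX. Qed.

Lemma poly_bounded_on p : exists2 B : R, 0 < B & forall z, E z -> cabs p.[z] <= B.
Proof.
have [B B0 hB] := poly_bounded p; exists B => // z /onE hz.
by apply: hB; rewrite hz.
Qed.

Lemma papprox_bounded u : papprox u ->
  exists2 B : R, 0 < B & forall z, E z -> cabs (u z) <= B.
Proof.
move=> hu; have [p hp] := hu 1 ltr01; have [B B0 hB] := poly_bounded_on p.
exists (B + 1); first by rewrite addr_gt0.
move=> z Ez; have -> : u z = p.[z] - (p.[z] - u z) by ring.
by apply: (le_trans (cabsB _ _)); rewrite lerD ?hB // ltW ?hp.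
Qed.

Lemma papproxD u v : papprox u -> papprox v -> papprox (fun z => u z + v z).
Proof.
move=> hu hv e e0; have e20 : 0 < e / 2 by rewrite divr_gt0.
have [p hp] := hu _ e20; have [q hq] := hv _ e20.
exists (p + q) => z Ez; rewrite hornerD.
have -> : p.[z] + q.[z] - (u z + v z) = (p.[z] - u z) + (q.[z] - v z) by ring.
apply: (le_lt_trans (cabsD _ _)); have := hp _ Ez; have := hq _ Ez; lra.
Qed.

Lemma papproxM u v : papprox u -> papprox v -> papprox (fun z => u z * v z).
Proof.
move=> hu hv e e0; have [B B0 hB] := papprox_bounded hv.
have [p hp] := hu _ (divr_gt0 e0 (mulr_gt0 (ltr0n R 2) B0)).
have [D D0 hD] := poly_bounded_on p.
have [q hq] := hv _ (divr_gt0 e0 (mulr_gt0 (ltr0n R 2) D0)).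
exists (p * q) => z Ez; rewrite hornerM.
have -> : p.[z] * q.[z] - u z * v z = p.[z] * (q.[z] - v z) + v z * (p.[z] - u z) by ring.
apply: (le_lt_trans (cabsD _ _)); rewrite !cabsM.
have h1 : cabs p.[z] * cabs (q.[z] - v z) <= D * cabs (q.[z] - v z).
  by rewrite ler_wpM2r ?cabs_ge0 ?hD.
have h2 : cabs (v z) * cabs (p.[z] - u z) <= B * cabs (p.[z] - u z).
  by rewrite ler_wpM2r ?cabs_ge0 ?hB.
have h3 : D * cabs (q.[z] - v z) < e / 2.
  have := hq _ Ez; rewrite ltr_pdivlMr ?mulr_gt0 // => h3; lra.
have h4 : B * cabs (p.[z] - u z) < e / 2.
  have := hp _ Ez; rewrite ltr_pdivlMr ?mulr_gt0 // => h4; lra.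
lra.
Qed.

Lemma papproxX u n : papprox u -> papprox (fun z => u z ^+ n).
Proof.
move=> hu; elim: n => [|n ih].
  by apply: papprox_ext (papprox_cst 1) => z _; rewrite expr0.
by apply: papprox_ext (papproxM hu ih) => z _; rewrite exprS.
Qed.

Lemma papprox_sum (I : eqType) (s : seq I) (F : I -> C -> C) :
  (forall i, i \in s -> papprox (F i)) -> papprox (fun z => \sum_(i <- s) F i z).
Proof.
elim: s => [_|i s ih hF].
  by apply: papprox_ext (papprox_cst 0) => z _; rewrite big_nil.
have hi : papprox (F i) by apply: hF; rewrite inE eqxx.
have hs : papprox (fun z => \sum_(i <- s) F i z).
  by apply: ih => j js; apply: hF; rewrite inE js orbT.
by apply: papprox_ext (papproxD hi hs) => z _; rewrite big_cons.
Qed.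

Lemma papprox_lim u :
  (forall e : R, 0 < e -> exists2 v, papprox v & forall z, E z -> cabs (v z - u z) < e) ->
  papprox u.
Proof.
move=> hu e e0; have e20 : 0 < e / 2 by rewrite divr_gt0.
have [v hv vu] := hu _ e20; have [p hp] := hv _ e20.
exists p => z Ez; apply: (le_lt_trans (cabsDD _ (v z) _)).
have := hp _ Ez; have := vu _ Ez; lra.
Qed.

(* If [h] is close to [1] on [E] and small at [0], then [q = (1 - h)/(1 - h(0))]
   is small on [E] while [q(0) = 1], so that [(1 - q)/z] is a polynomial. *)
Lemma papprox_conj : papprox (fun z => z^*%C).
Proof.
(* [|h(0)|^2 <= d <= 1/16] gives [|1 - h(0)| >= 3/4]; then [q] is at most [4/3 d <= 2/3 e] on
   [E]. *)
move=> e e0; pose d := Num.min (1 / 16) (e / 2).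
have d0 : 0 < d by rewrite lt_min !divr_gt0.
have [h [_ hE hd]] := cutoff_poly clE onE cap0 d0.
have h0 : cabs h.[0] <= 1 / 4.
  rewrite horner_coef0 -(ler_pXn2r (n := 2)) ?nnegrE ?cabs_ge0 ?divr_ge0 //.
  have h1 : cabs h`_0 ^+ 2 <= d.
    have := hd 1%N; rewrite big_ord_recl big_ord0 addr0 /dirichlet_weighted /pcoef /=.
    by rewrite mulr1n mul1r.
  apply: (le_trans h1); apply: (@le_trans _ _ (1 / 16)); last lra.
  by rewrite ge_min lexx.
pose a := 1 - h.[0].
have ha : 3 / 4 <= cabs a.
  have := cabsD a h.[0]; rewrite /a subrK cabs1; lra.
have a0 : a != 0 by rewrite -cabs_gt0; lra.
pose q : {poly C} := a^-1 *: (1 - h).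
have : root (1 - q) 0.
  by rewrite /root /q !hornerE -/a mulVf // subrr.
move=> /factor_theorem [r hr].
exists r => z Ez.
have hz := onE Ez; have z0 : z != 0 by rewrite -cabs_gt0 hz.
have e1 : r.[z] * z = 1 - q.[z].
  have : (1 - q).[z] = (r * ('X - 0%:P)).[z] by rewrite hr.
  by rewrite hornerM hornerXsubC subr0 => <-; rewrite hornerD hornerN -polyC1 hornerC.
have -> : r.[z] - z^*%C = - q.[z] * z^*%C.
  apply: (mulIf z0); rewrite mulrBl e1 -mulrA [z^*%C * z]mulrC mulJ_cabs hz expr1n.
  by rewrite mulr1 addrAC subrr add0r.
rewrite cabsM cabsN cabsJ hz mulr1 /q hornerZ cabsM cabsV !hornerE (cabsBC 1 h.[z]).
have h1 := hE _ Ez.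
have h2 : (cabs a)^-1 <= 4 / 3 by rewrite -[leRHS]invrK lef_pV2 ?posrE; lra.
apply: (@le_lt_trans _ _ (4 / 3 * d)).
  by apply: ler_pM; rewrite ?invr_ge0 ?cabs_ge0.
have : d <= e / 2 by rewrite ge_min lexx orbT.
lra.
Qed.

Lemma exists_expr_lt (r e : R) : 0 <= r -> r < 1 -> 0 < e -> exists n, r ^+ n < e.
Proof.
move=> r0 r1 e0; have /cvgrPdist_lt /(_ e e0) [n _ hn] :
  (fun n => r ^+ n) @ \oo --> (0 : R) by apply: cvg_expr; rewrite ger0_norm.
by exists n; have := hn n (leqnn n); rewrite /= sub0r normrN ger0_norm ?exprn_ge0.
Qed.

(** [1/b] is the geometric series of ratio [1 - b/hi], divided by [hi]; the ratio lies between [0]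
    and [1 - lo/hi < 1], so convergence is uniform on [E]. *)
Lemma papprox_invr (b : C -> R) (lo hi : R) : 0 < lo ->
  (forall z, E z -> lo <= b z <= hi) -> papprox (fun z => ((b z)%:C)%C) ->
  papprox (fun z => (((b z)^-1)%:C)%C).
Proof.
move=> lo0 hb pb.
have [[w Ew]|nE] := pselect (exists w, E w); last first.
  by move=> e e0; exists 0 => z Ez; exfalso; apply: nE; exists z.
have hi0 : 0 < hi by have /andP[h1 h2] := hb _ Ew; apply: lt_le_trans lo0 (le_trans h1 h2).
have lohi : lo <= hi by have /andP[h1 h2] := hb _ Ew; exact: le_trans h2.
pose t z := 1 - b z / hi.
have ht z : E z -> 0 <= t z <= 1 - lo / hi.
  move=> /hb /andP[h1 h2]; rewrite /t subr_ge0 ler_pdivrMr // mul1r h2 /=.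
  by rewrite lerD2l lerN2 ler_wpM2r // invr_ge0 ltW.
pose V n z : C := (((hi^-1) * \sum_(k < n) t z ^+ k)%:C)%C.
have hV n z : E z -> V n z - (((b z)^-1)%:C)%C = ((- (t z ^+ n / b z))%:C)%C.
  move=> Ez; rewrite /V -rmorphB; congr ((_)%:C)%C.
  have b0 : b z != 0 by rewrite gt_eqF // (lt_le_trans lo0) //; have /andP[] := hb _ Ez.
  have := subrX1 (t z) n; set S := \sum_(_ < _) _.
  have -> : t z - 1 = - (b z / hi) by rewrite /t addrAC subrr add0r.
  move=> h; have -> : t z ^+ n = 1 - b z / hi * S by rewrite -[LHS](subrK 1) h; ring.
  by field; rewrite b0 gt_eqF.
apply: papprox_lim => e e0.
have r1 : 1 - lo / hi < 1 by rewrite ltrBlDr ltrDl divr_gt0.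
have r0 : 0 <= 1 - lo / hi by rewrite subr_ge0 ler_pdivrMr // mul1r.
have [n hn] := exists_expr_lt r0 r1 (mulr_gt0 e0 lo0).
exists (V n).
  have pt : papprox (fun z => ((t z)%:C)%C).
    apply: papprox_ext (papproxD (papprox_cst 1) (papproxM (papprox_cst ((- hi^-1)%:C)%C) pb)).
    by move=> z _; rewrite /t -rmorphM -[1]/((1%:C)%C) -rmorphD mulNr mulrC.
  have pS : papprox (fun z => \sum_(k < n) ((t z)%:C)%C ^+ k).
    by apply: (@papprox_sum _ _ (fun (k : 'I_n) z => ((t z)%:C)%C ^+ k)) => k _; exact: papproxX.
  apply: papprox_ext (papproxM (papprox_cst ((hi^-1)%:C)%C) pS) => z _.
  rewrite /V rmorphM rmorph_sum /=; congr (_ * _); apply: eq_bigr => k _.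
  by rewrite rmorphXn.
move=> z Ez; rewrite hV // cabs_real normrN.
have /andP[h1 h2] := hb _ Ez; have bz0 : 0 < b z by exact: lt_le_trans h1.
have /andP[h3 h4] := ht _ Ez.
rewrite ger0_norm ?divr_ge0 ?exprn_ge0 ?(ltW bz0) // ltr_pdivrMr //.
apply: (@lt_le_trans _ _ (e * lo)); last by rewrite ler_wpM2l // ltW.
by apply: le_lt_trans hn; rewrite lerXn2r ?nnegrE.
Qed.

(** Angles are cut into cells of length [1/M] with [2/M < d], and one point of [E] is kept from each
    cell that meets it; the induction runs over the cells. *)
Lemma circle_net (d : R) : 0 < d ->
  exists s : seq C, (forall w, w \in s -> E w) /\
    forall z, E z -> exists2 w, w \in s & cabs (z - w) < d.
Proof.
move=> d0; pose M := (Num.truncn (2 / d)).+1.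
have M0 : 0 < M%:R :> R by rewrite ltr0n.
have hM : 2 / M%:R < d.
  rewrite ltr_pdivrMr // mulrC -ltr_pdivrMr //.
  by have /andP[] := truncn_itv (divr_ge0 (ler0n R 2) (ltW d0)).
pose idx (t : R) := Num.truncn ((t + pi) * M%:R).
have hidx t t' : - pi <= t -> - pi <= t' -> idx t = idx t' -> cabs (cis t - cis t') < d.
  move=> ht ht' e; apply: le_lt_trans (cis_lipschitz _ _) _.
  apply: le_lt_trans hM; rewrite ler_wpM2l // -[leRHS]mul1r ler_pdivlMr //.
  have p1 : 0 <= (t + pi) * M%:R by rewrite mulr_ge0 // -lerBlDr sub0r.
  have p2 : 0 <= (t' + pi) * M%:R by rewrite mulr_ge0 // -lerBlDr sub0r.
  have /andP[h1 h2] := truncn_itv p1; have /andP[h3 h4] := truncn_itv p2.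
  rewrite -/(idx t) -/(idx t') e -natr1 in h1 h2 h3 h4.
  rewrite -[X in _ * X]ger0_norm ?(ltW M0) // -normrM ler_norml.
  have -> : (t - t') * M%:R = (t + pi) * M%:R - (t' + pi) * M%:R by ring.
  by apply/andP; split; lra.
have claim k : exists s : seq C, (forall w, w \in s -> E w) /\
    forall t, - pi <= t -> E (cis t) -> (idx t < k)%N ->
    exists2 w, w \in s & cabs (cis t - w) < d.
  elim: k => [|k [s [sE hs]]]; first by exists [::].
  have [[t0 [Et0 pt0 it0]]|no] :=
    pselect (exists t0, [/\ E (cis t0), - pi <= t0 & idx t0 = k]).
    exists (cis t0 :: s); split=> [w|t pt Et].
      by rewrite inE => /orP[/eqP ->//|/sE].
    rewrite ltnS leq_eqVlt => /orP[/eqP it|/(hs _ pt Et)[w ws hw]].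
      by exists (cis t0); [rewrite inE eqxx | apply: hidx => //; rewrite it it0].
    by exists w; rewrite // inE ws orbT.
  exists s; split=> // t pt Et; rewrite ltnS leq_eqVlt => /orP[/eqP it|].
    by exfalso; apply: no; exists t.
  exact: hs.
have [s [sE hs]] := claim (idx pi).+1.
exists s; split=> // z Ez.
have [t /andP[t1 t2] ez] := circle_angle (onE Ez); rewrite ez in Ez *.
apply: hs => //; rewrite ltnS /idx truncn_ge_nat.
  apply: (@le_trans _ _ ((t + pi) * M%:R)).
    by rewrite truncn_le mulr_ge0 // -lerBlDr sub0r.
  by rewrite ler_wpM2r // lerD2r.
by rewrite mulr_ge0 // addr_ge0 // pi_ge0.
Qed.

Lemma disc_cluster (z : nat -> C) : (forall n, cabs (z n) <= 1) ->
  exists c, forall e N, 0 < e -> exists2 n, (N <= n)%N & cabs (c - z n) < e.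
Proof.
move=> hz; pose X (n l i : nat) : R := if i == 0%N then complex.Re (z n) else complex.Im (z n).
have hX n l i : - 1 <= X n l i <= 1.
  rewrite -ler_norml /X; case: ifP => _; apply: le_trans (hz n).
    exact: ler_Re_cabs.
  exact: ler_Im_cabs.
have [T [_ hT]] := pointwise_cluster hX.
exists (T 0%N 0%N +i* T 0%N 1%N)%C => e N e0.
have [n Nn hn] := hT 2%N N (e / 2) (divr_gt0 e0 (ltr0n R 2)).
exists n => //; apply: (le_lt_trans (cabs_le_ReIm _)).
have := hn 0%N 0%N isT isT; have := hn 0%N 1%N isT isT; rewrite /X /=.
case: (z n) => a b /=; lra.
Qed.

Lemma uniform_continuity (phi : C -> C) (e : R) : ccontinuous_on E phi -> 0 < e ->
  exists2 d : R, 0 < d &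
    forall z w, E z -> E w -> cabs (z - w) < d -> cabs (phi z - phi w) < e.
Proof.
move=> cphi e0; apply: contrapT => no.
have /choice [zw hzw] : forall n : nat, exists zw : C * C,
    [/\ E zw.1, E zw.2, cabs (zw.1 - zw.2) < n.+1%:R^-1 & e <= cabs (phi zw.1 - phi zw.2)].
  move=> n; apply: contrapT => h; apply: no; exists n.+1%:R^-1; first by rewrite invr_gt0.
  move=> z w Ez Ew lt; rewrite ltNge; apply/negP => ge; apply: h.
  by exists (z, w).
have [|c hc] := @disc_cluster (fun n => (zw n).1).
  by move=> n; have [/onE -> _ _ _] := hzw n.
have Ec : E c.
  apply: clE => e' e'0; have [n _ hn] := hc e' 0%N e'0.
  by exists (zw n).1 => //; have [] := hzw n.
have e20 : 0 < e / 2 by rewrite divr_gt0.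
have [d d0 hd] := cphi c Ec _ e20.
have d20 : 0 < d / 2 by rewrite divr_gt0.
have [n Nn hn] := hc (d / 2) (Num.truncn (2 / d)) d20.
have [E1 E2 lt ge] := hzw n.
have hn1 : n.+1%:R^-1 <= d / 2.
  rewrite -[leRHS]invrK lef_pV2 ?posrE ?invr_gt0 // invf_div.
  have /andP[_ /ltW h] := truncn_itv (divr_ge0 (ler0n R 2) (ltW d0)).
  by apply: (le_trans h); rewrite ler_nat ltnS.
have h1 : cabs (phi c - phi (zw n).1) < e / 2 by apply: hd => //; lra.
have h2 : cabs (phi c - phi (zw n).2) < e / 2.
  have lt2 := lt_le_trans lt hn1.
  by apply: hd => //; apply: (le_lt_trans (cabsDD _ (zw n).1 _)); move: hn lt2; clear; lra.
have := cabsDD (phi (zw n).1) (phi c) (phi (zw n).2); rewrite (cabsBC (phi (zw n).1) (phi c)).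
by move: h1 h2 ge; clear; lra.
Qed.

(* Shepard interpolation on a net with the weights
   [(1 - |z - w|^2 / 8) ^ n], which are polynomials in [z] and its conjugate
   and concentrate near [w] as [n] grows. *)
Lemma papprox_continuous (phi : C -> C) : ccontinuous_on E phi -> papprox phi.
Proof.
move=> cphi; apply: papprox_lim => e e0.
have e20 : 0 < e / 2 by rewrite divr_gt0.
have [d' d'0 hd'] := uniform_continuity cphi e20.
pose d := Num.min d' 1.
have d0 : 0 < d by rewrite lt_min d'0 ltr01.
have d1 : d <= 1 by rewrite ge_min lexx orbT.
have hd z w : E z -> E w -> cabs (z - w) < d -> cabs (phi z - phi w) < e / 2.
  by move=> Ez Ew; rewrite lt_min => /andP[h _]; exact: hd'.
have d40 : 0 < d / 4 by rewrite divr_gt0.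
have [s [sE hs]] := circle_net d40.
pose b (w z : C) : R := 1 - cabs (z - w) ^+ 2 / 8.
have pb w : E w -> papprox (fun z => ((b w z)%:C)%C).
  move=> Ew.
  have p1 : papprox (fun z => z * w^*%C) by exact: papproxM papprox_id (papprox_cst _).
  have p2 : papprox (fun z => z^*%C * w) by exact: papproxM papprox_conj (papprox_cst _).
  apply: papprox_ext (papproxD (papprox_cst ((3 / 4)%:C)%C)
    (papproxM (papprox_cst ((1 / 8)%:C)%C) (papproxD p1 p2))) => z Ez.
  rewrite /b cabsB_sqr (onE Ez) (onE Ew) expr1n.
  case: z w {p1 p2 Ew Ez} => a1 a2 [b1 b2]; apply/eqP; rewrite eq_complex /=.
  by apply/andP; split; apply/eqP; field.
have b12 z w : E z -> E w -> 1 / 2 <= b w z <= 1.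
  move=> Ez Ew; have := cabsB z w; rewrite (onE Ez) (onE Ew) => h.
  have h2 : cabs (z - w) ^+ 2 <= 2 ^+ 2.
    by rewrite lerXn2r ?nnegrE ?cabs_ge0 //; lra.
  by have := sqr_ge0 (cabs (z - w)); rewrite /b => h3; apply/andP; split; lra.
have [M M0 hM] : exists2 M : R, 0 < M & forall w, w \in s -> cabs (phi w) <= M.
  elim: (s) => [|w s' [M M0 hM]]; first by exists 1.
  exists (M + cabs (phi w)); first by rewrite ltr_wpDr ?cabs_ge0.
  move=> v; rewrite inE => /orP[/eqP ->|/hM h]; first by rewrite lerDr ltW.
  by rewrite (le_trans h) // lerDl cabs_ge0.
(* [beta1] bounds the weights of net points at distance at least [d]; some net point within [d/4]
   has weight at least [beta0]. Far terms are thus negligible once [(beta1 / beta0)^n] is small. *)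
pose beta1 : R := 1 - d ^+ 2 / 8; pose beta0 : R := 1 - (d / 4) ^+ 2 / 8.
have d2 : 0 < d ^+ 2 <= 1 by rewrite exprn_gt0 //= exprn_ile1 // ltW.
have /andP[d2a d2b] := d2.
have b1 : 0 < beta1 by rewrite /beta1; lra.
have b10 : beta1 < beta0 by rewrite /beta1 /beta0 expr_div_n; lra.
have b0 : 0 < beta0 by lra.
pose M2 := 2 * M + e; have M20 : 0 < M2 by rewrite addr_gt0 // mulr_gt0.
have [n hn] : exists n, (beta1 / beta0) ^+ n < e / (2 * M2 * (size s).+1%:R).
  apply: exists_expr_lt; first by rewrite divr_ge0 // ltW.
    by rewrite ltr_pdivrMr // mul1r.
  by rewrite divr_gt0 // !mulr_gt0.
pose B z : R := \sum_(w <- s) b w z ^+ n.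
have bn0 w z : E z -> w \in s -> 0 <= b w z ^+ n.
  by move=> Ez /sE Ew; have /andP[h _] := b12 _ _ Ez Ew; rewrite exprn_ge0 //; lra.
have Bterm z w : E z -> w \in s -> b w z ^+ n <= B z.
  move=> Ez ws; rewrite /B (perm_big _ (perm_to_rem ws)) big_cons /= lerDl big_seq.
  by apply: sumr_ge0 => v /mem_rem vs; exact: bn0.
have Blo z : E z -> (1 / 2) ^+ n <= B z <= (size s).+1%:R.
  move=> Ez; have [w ws _] := hs _ Ez; apply/andP; split.
    apply: le_trans (Bterm _ _ Ez ws); have /andP[h _] := b12 _ _ Ez (sE _ ws).
    by rewrite lerXn2r ?nnegrE //; lra.
  apply: (@le_trans _ _ (size s)%:R); last by rewrite ler_nat.
  rewrite /B big_seq; apply: (@le_trans _ _ (\sum_(w <- s | w \in s) 1)).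
    apply: ler_sum => v vs; have /andP[h1 h2] := b12 _ _ Ez (sE _ vs).
    by rewrite exprn_ile1 //; lra.
  by rewrite -big_seq big_const_seq count_predT iter_addr_0.
have half0 : (0 : R) < (1 / 2) ^+ n by rewrite exprn_gt0.
have pbn w : w \in s -> papprox (fun z => ((b w z ^+ n)%:C)%C).
  move=> ws; apply: papprox_ext (papproxX n (pb _ (sE _ ws))) => z _.
  by rewrite rmorphXn.
have pB : papprox (fun z => ((B z)%:C)%C).
  by apply: papprox_ext (papprox_sum pbn) => z _; rewrite /B rmorph_sum.
exists (fun z => (\sum_(w <- s) phi w * ((b w z ^+ n)%:C)%C) * (((B z)^-1)%:C)%C).
  apply: papproxM; last exact: papprox_invr half0 Blo pB.
  by apply: papprox_sum => w ws; apply: papproxM (papprox_cst _) (pbn _ ws).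
move=> z Ez; have /andP[hB _] := Blo _ Ez; have B0 := lt_le_trans half0 hB.
have -> : (\sum_(w <- s) phi w * ((b w z ^+ n)%:C)%C) * (((B z)^-1)%:C)%C - phi z =
    (\sum_(w <- s) (phi w - phi z) * ((b w z ^+ n)%:C)%C) * (((B z)^-1)%:C)%C.
  under [in RHS]eq_bigr do rewrite mulrBl.
  rewrite sumrB mulrBl -mulr_sumr -mulrA; congr (_ - _).
  have -> : \sum_(w <- s) ((b w z ^+ n)%:C)%C = ((B z)%:C)%C :> C by rewrite /B rmorph_sum.
  by rewrite -rmorphM mulfV ?gt_eqF // mulr1.
rewrite cabsM cabs_real ger0_norm ?invr_ge0 ?(ltW B0) // ltr_pdivrMr //.
have far w : w \in s -> cabs ((phi w - phi z) * ((b w z ^+ n)%:C)%C) <=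
    e / 2 * b w z ^+ n + M2 * beta1 ^+ n.
  move=> ws; have bw0 := bn0 _ _ Ez ws; rewrite cabsM cabs_real ger0_norm //.
  have beta1n : 0 <= M2 * beta1 ^+ n by rewrite mulr_ge0 ?exprn_ge0 // ltW.
  have [lt|ge] := ltP (cabs (w - z)) d.
    have h := hd _ _ (sE _ ws) Ez lt.
    by apply: ler_wpDr => //; rewrite ler_wpM2r // ltW.
  have h0 : 0 <= e / 2 * b w z ^+ n by rewrite mulr_ge0 // ltW.
  apply: ler_wpDl => //; apply: ler_pM; rewrite ?cabs_ge0 //.
    have [v vs hv] := hs _ Ez.
    have h1 : cabs (phi z - phi v) < e / 2 by apply: hd => //; [exact: sE | lra].
    have h2 := cabsDD (phi w) (phi v) (phi z).
    have h3 := cabsB (phi w) (phi v); rewrite (cabsBC (phi v)) in h2.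
    have := hM _ ws; have := hM _ vs; rewrite /M2; lra.
  have /andP[hh _] := b12 _ _ Ez (sE _ ws).
  rewrite lerXn2r ?nnegrE ?(ltW b1) //; first lra.
  rewrite /b /beta1 lerD2l lerN2 ler_wpM2r ?invr_ge0 // cabsBC.
  by rewrite lerXn2r ?nnegrE ?cabs_ge0 // ltW.
apply: (le_lt_trans (cabs_sum _ _ _)); rewrite big_seq.
apply: (le_lt_trans (ler_sum _ far)); rewrite -big_seq big_split /= -mulr_sumr -/(B z).
rewrite big_const_seq count_predT iter_addr_0.
have [v vs hv] := hs _ Ez.
have hBb : beta0 ^+ n <= B z.
  apply: le_trans (Bterm _ _ Ez vs); rewrite lerXn2r ?nnegrE ?(ltW b0) //.
    by have /andP[h _] := b12 _ _ Ez (sE _ vs); lra.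
  rewrite /b /beta0 lerD2l lerN2 ler_wpM2r ?invr_ge0 //.
  by rewrite lerXn2r ?nnegrE ?cabs_ge0 ?(ltW d40) // ltW.
have -> : e * B z = e / 2 * B z + e / 2 * B z by field.
rewrite ltrD2l -[M2 * _ *+ _]mulr_natl.
have s0 : 0 < (size s).+1%:R :> R by rewrite ltr0n.
apply: (@lt_le_trans _ _ (e / 2 * beta0 ^+ n)); last by rewrite ler_wpM2l // ltW.
move: hn; rewrite expr_div_n ltr_pdivrMr ?exprn_gt0 // => hn.
apply: (@le_lt_trans _ _ ((size s).+1%:R * (M2 * beta1 ^+ n))).
  by rewrite ler_wpM2r ?ler_nat // mulr_ge0 ?exprn_ge0 // ltW.
rewrite mulrA -ltr_pdivlMl ?mulr_gt0 //.
have -> : ((size s).+1%:R * M2)^-1 * (e / 2 * beta0 ^+ n) =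
   e / (2 * M2 * (size s).+1%:R) * beta0 ^+ n.
  by field; rewrite ?gt_eqF.
by [].
Qed.

End PolynomialDensity.

(** * Zero-free approximation on [E] *)

Section ComplexExponential.
Variable R : realType.
Local Notation C := R[i].
Implicit Types (z w u : C) (x y : R).

Definition cexp z : C := ((expR (complex.Re z))%:C)%C * cis (complex.Im z).

Lemma cexpD z w : cexp (z + w) = cexp z * cexp w.
Proof.
case: z w => a b [c d]; rewrite /cexp /= expRD cisD rmorphM /=; ring.
Qed.

Lemma cexp0 : cexp 0 = 1.
Proof. by rewrite /cexp /= expR0 mul1r /cis cos0 sin0. Qed.

Lemma cexpX z n : cexp z ^+ n = cexp (n%:R * z).
Proof.
elim: n => [|n ih]; first by rewrite mul0r cexp0.
by rewrite exprS ih -cexpD -[in RHS]natr1 mulrDl mul1r addrC.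
Qed.

Lemma cabs_cexp z : cabs (cexp z) = expR (complex.Re z).
Proof. by rewrite cabsM cabs_real cabs_cis mulr1 ger0_norm // expR_ge0. Qed.

Lemma cabs_cexp_le z : cabs (cexp z) <= expR (cabs z).
Proof.
by rewrite cabs_cexp ler_expR (le_trans (ler_norm _)) // ler_Re_cabs.
Qed.

Lemma normr_sin_le y : `|sin y| <= `|y|.
Proof.
have := @mvt_lipschitz R sin cos _ _ y 0; rewrite sin0 !subr0; apply; exact: cos_max.
Qed.

Lemma cosB1_le y : `|cos y - 1| <= y ^+ 2.
Proof.
have e : cos y = 1 - 2 * sin (y / 2) ^+ 2.
  have -> : cos y = cos (y / 2 + y / 2) by congr cos; lra.
  by rewrite cosD; have := cos2Dsin2 (y / 2); lra.
have h := normr_sin_le (y / 2).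
have h2 : sin (y / 2) ^+ 2 <= (y / 2) ^+ 2.
  by rewrite -[sin _ ^+ 2]real_normK ?num_real // -[leRHS]real_normK ?num_real // lerXn2r ?nnegrE.
rewrite e ler_norml; rewrite expr_div_n in h2.
have := sqr_ge0 (sin (y / 2)); have := sqr_ge0 y => ? ?; apply/andP; split; lra.
Qed.

Lemma sinB_le y : `|sin y - y| <= y ^+ 2.
Proof.
wlog y0 : y / 0 < y.
  move=> hw; have [y0|y0|<-] := ltgtP 0 y; [exact: hw| |].
    have := hw (- y); rewrite oppr_gt0 => /(_ y0).
    by rewrite sinN sqrrN -opprD normrN.
  by rewrite sin0 subr0 normr0 expr0n.
have cf : {within `[0, y], continuous (@sin R)}.
  by apply: derivable_within_continuous => u _; exact: ex_derive.
have [c hc e] := MVT y0 (fun (t : R) _ => is_derive_sin t) cf.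
rewrite sin0 !subr0 in e; rewrite e.
have -> : cos c * y - y = (cos c - 1) * y by ring.
rewrite normrM (gtr0_norm y0) expr2 ler_wpM2r ?(ltW y0) //.
have := @mvt_lipschitz R cos (fun u : R => - sin u) _ _ c 0; rewrite cos0 subr0 => h.
move: hc; rewrite in_itv /= => /andP[c0 cy].
apply: (@le_trans _ _ `|c|); last by rewrite gtr0_norm // ltW.
by apply: h => u; rewrite normrN sin_max.
Qed.

Lemma expRB1_bounds x : `|x| <= 1 / 2 ->
  [/\ `|expR x - 1 - x| <= 2 * x ^+ 2, `|expR x - 1| <= 2 * `|x| & expR x <= 2].
Proof.
rewrite ler_norml => /andP[x1 x2].
have h1 := expR_ge1Dx x.
have h2 : expR x <= (1 - x)^-1.
  have := expR_ge1Dx (- x); rewrite expRN => h.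
  have p : 0 < 1 - x by lra.
  by rewrite -[leLHS]invrK lef_pV2 ?posrE ?invr_gt0 ?expR_gt0.
have p : 0 < 1 - x by lra.
have h3 : (1 - x)^-1 * (1 - x) = 1 by rewrite mulVf // gt_eqF.
set i := (1 - x)^-1 in h2 h3.
have i2 : i <= 2 by rewrite /i -[leRHS]invrK lef_pV2 ?posrE //; lra.
have i0 : 0 < i by rewrite invr_gt0.
have sq := sqr_ge0 x.
have e1 : expR x - 1 - x <= 2 * x ^+ 2.
  have -> : 2 * x ^+ 2 = (2 - i) * x ^+ 2 + i * x ^+ 2 by ring.
  have -> : i * x ^+ 2 = i - 1 - x.
    have -> : x ^+ 2 = 1 - (1 + x) * (1 - x) by ring.
    by rewrite mulrBr mulr1 mulrCA h3; ring.
  by have := mulr_ge0 (_ : 0 <= 2 - i) sq; lra.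
split; [|
  | exact: le_trans i2].
  by rewrite ger0_norm //; lra.
have [x0|x0] := leP 0 x.
  rewrite (ger0_norm x0) ger0_norm; last lra.
  by rewrite expr2 in e1; nra.
rewrite (ltr0_norm x0) ler_norml; apply/andP; split; first lra.
have : expR x < 1 by rewrite expR_lt1.
lra.
Qed.

Lemma cexp_near0 u : cabs u <= 1 / 2 -> cabs (cexp u - (1 + u)) <= 4 * cabs u ^+ 2.
Proof.
move=> hu; apply: (le_trans (cabs_le_ReIm _)); rewrite cabs_sqr.
have hx := le_trans (ler_Re_cabs u) hu; have hy := le_trans (ler_Im_cabs u) hu.
case: u {hu} hx hy => x y /= hx hy.
have [e1 e2 e3] := expRB1_bounds hx.
have c1 := cosB1_le y; have s1 := sinB_le y; have s2 := normr_sin_le y.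
rewrite !mul0r subr0 addr0 add0r.
have -> : expR x * cos y - (1 + x) = (expR x - 1 - x) + expR x * (cos y - 1) by ring.
have -> : expR x * sin y - y = (expR x - 1) * sin y + (sin y - y) by ring.
have h1 := ler_normD (expR x - 1 - x) (expR x * (cos y - 1)).
have h2 := ler_normD ((expR x - 1) * sin y) (sin y - y).
rewrite !normrM (ger0_norm (expR_ge0 x)) in h1 h2.
have h3 : expR x * `|cos y - 1| <= 2 * y ^+ 2.
  by apply: ler_pM => //; exact: expR_ge0.
have h4 : `|expR x - 1| * `|sin y| <= 2 * `|x| * `|y| by apply: ler_pM.
have h5 : 2 * `|x| * `|y| <= x ^+ 2 + y ^+ 2.
  rewrite -(real_normK (num_real x)) -(real_normK (num_real y)).
  by have := sqr_ge0 (`|x| - `|y|); rewrite sqrrB; lra.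
have := sqr_ge0 x; lra.
Qed.

Lemma cexp_lipschitz z w (M : R) : cabs w <= M -> cabs (z - w) <= 1 / 2 ->
  cabs (cexp z - cexp w) <= 3 * expR M * cabs (z - w).
Proof.
move=> hw hd; have -> : cexp z - cexp w = cexp w * (cexp (z - w) - 1).
  by rewrite mulrBr mulr1 -cexpD addrCA subrr addr0.
have h1 := cexp_near0 hd.
have h2 : cabs (cexp (z - w) - 1) <= 3 * cabs (z - w).
  have -> : cexp (z - w) - 1 = (cexp (z - w) - (1 + (z - w))) + (z - w) by ring.
  apply: (le_trans (cabsD _ _)).
  have : 4 * cabs (z - w) ^+ 2 <= 2 * cabs (z - w).
    by rewrite expr2; have := cabs_ge0 (z - w); nra.
  lra.
rewrite cabsM mulrAC mulrC -mulrA.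
have h3 : cabs (cexp w) <= expR M by apply: (le_trans (cabs_cexp_le w)); rewrite ler_expR.
have := ler_pM (cabs_ge0 _) (cabs_ge0 _) h3 h2; rewrite mulrCA; lra.
Qed.

(** [cexp z] is the [m]-th power of [cexp (z/m)]. The bases differ by at most [4 (M/m)^2], their
    powers up to [m] are at most [expR M], and the difference of powers costs a factor [m]. *)
Lemma cexp_approx z (M : R) m : (0 < m)%N -> cabs z <= M -> 2 * M <= m%:R ->
  cabs ((1 + z / m%:R) ^+ m - cexp z) <= 4 * M ^+ 2 * expR M ^+ 2 / m%:R.
Proof.
move=> m0 hz mM; have mp : 0 < m%:R :> R by rewrite ltr0n.
have mC : (m%:R : C) != 0 by rewrite pnatr_eq0 -lt0n.
have M0 : 0 <= M by apply: le_trans hz; exact: cabs_ge0.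
set u := z / m%:R.
have hu : cabs u <= M / m%:R by rewrite cabsM cabsV cabs_nat ler_wpM2r ?invr_ge0.
have hu2 : cabs u <= 1 / 2.
  apply: (le_trans hu); rewrite ler_pdivrMr //; lra.
have powle k (a : R) : (k <= m)%N -> 0 <= a -> a <= expR (M / m%:R) -> a ^+ k <= expR M.
  move=> km a0 ha; apply: (@le_trans _ _ (expR (M / m%:R) ^+ k)).
    by rewrite lerXn2r ?nnegrE ?expR_ge0.
  rewrite -expRM_natl ler_expR mulrCA -[leRHS]mulr1 ler_wpM2l //.
  by rewrite ler_pdivrMr // mul1r ler_nat.
have eM : cexp z = cexp u ^+ m.
  by rewrite cexpX /u mulrC divfK.
have hA k : (k <= m)%N -> cabs (1 + u) ^+ k <= expR M.
  move=> km; apply: powle => //; first exact: cabs_ge0.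
  apply: (le_trans (cabsD _ _)); rewrite cabs1.
  apply: le_trans (expR_ge1Dx _); lra.
have hB k : (k <= m)%N -> cabs (cexp u) ^+ k <= expR M.
  move=> km; apply: powle => //; first exact: cabs_ge0.
  by apply: (le_trans (cabs_cexp_le _)); rewrite ler_expR.
rewrite eM; apply: (le_trans (cabs_expB_le hA hB)); rewrite -expr2 cabsBC.
have h1 := cexp_near0 hu2.
have h2 : cabs u ^+ 2 <= (M / m%:R) ^+ 2.
  by rewrite lerXn2r ?nnegrE ?cabs_ge0 ?divr_ge0.
apply: (@le_trans _ _ (m%:R * expR M ^+ 2 * (4 * (M / m%:R) ^+ 2))).
  rewrite ler_wpM2l ?mulr_ge0 ?sqr_ge0 //; lra.
have -> : m%:R * expR M ^+ 2 * (4 * (M / m%:R) ^+ 2) =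
    4 * M ^+ 2 * expR M ^+ 2 / m%:R by field; rewrite gt_eqF.
by [].
Qed.

Lemma cexp_surj w : w != 0 -> exists z, cexp z = w.
Proof.
move=> w0; have p : 0 < cabs w by rewrite cabs_gt0.
have [|t _ ht] := @circle_angle R (w / ((cabs w)%:C)%C).
  by rewrite cabsM cabsV cabs_real gtr0_norm // divff // gt_eqF.
exists (ln (cabs w) +i* t)%C; rewrite /cexp /= lnK ?posrE // -ht mulrC divfK //.
by rewrite -cabs_eq0 cabs_real normr_eq0 gt_eqF.
Qed.

(* Principal logarithm off the half-line of nonpositive reals, with the
   argument written as twice an arctangent. *)
Definition slit z := 0 < cabs z + complex.Re z.

Definition clog z : C :=
  (ln (cabs z) +i* (2 * atan (complex.Im z / (cabs z + complex.Re z))))%C.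

Lemma slitP z : (forall s : R, 0 <= s -> z != ((- s)%:C)%C) -> slit z.
Proof.
move=> h; rewrite /slit ltNge; apply/negP => le0.
have h1 := ler_Re_cabs z; rewrite ler_norml in h1; have /andP[h2 h3] := h1.
have e : cabs z = - complex.Re z by lra.
have := h (cabs z) (cabs_ge0 z); rewrite e opprK => /eqP; apply.
have := cabs_sqr z; rewrite e sqrrN => /eqP; rewrite -subr_eq0.
case: z {h h1 h2 h3 e le0} => x y /=; rewrite opprD addrA subrr add0r oppr_eq0.
by rewrite sqrf_eq0 => /eqP ->.
Qed.

Lemma slit_cabs_gt0 z : slit z -> 0 < cabs z.
Proof.
rewrite /slit; have := ler_Re_cabs z; rewrite ler_norml => /andP[_ h] h2; lra.
Qed.

Lemma clogK z : slit z -> cexp (clog z) = z.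
Proof.
move=> sz; have r0 := slit_cabs_gt0 sz; rewrite /cexp /= lnK ?posrE //.
have := cabs_sqr z; move: sz r0; rewrite /slit; set r := cabs z.
case: z @r => x y r /= s0 r0 hr.
(* [th] is half the argument of [z]; double-angle formulas recover [x/r] and [y/r] from
   [cos th ^+ 2 = (r + x) / (2 r)]. *)
set t := y / (r + x); set th := atan t.
have c0 : 0 < cos th by rewrite cos_atan invr_gt0 sqrtr_gt0 ltr_pwDl ?sqr_ge0.
have st : sin th = t * cos th.
  by rewrite -[t]atanK -/th /tan divfK ?gt_eqF.
have c2 : cos th ^+ 2 * (1 + t ^+ 2) = 1.
  by rewrite mulrDr mulr1 -exprMn [cos th * t]mulrC -st cos2Dsin2.
have t2 : 1 + t ^+ 2 = 2 * r / (r + x).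
  rewrite /t expr_div_n; have -> : y ^+ 2 = r ^+ 2 - x ^+ 2 by lra.
  by field; rewrite gt_eqF.
have rx0 := gt_eqF s0; have rn0 := gt_eqF r0.
have cc : cos th ^+ 2 = (r + x) / (2 * r).
  rewrite t2 in c2.
  have -> : cos th ^+ 2 = cos th ^+ 2 * (2 * r / (r + x)) * ((r + x) / (2 * r)).
    by field; rewrite rx0 rn0.
  by rewrite c2 mul1r.
have s2 : sin th ^+ 2 = 1 - cos th ^+ 2 by have := cos2Dsin2 th; lra.
have e2 : 2 * th = th + th by ring.
have ec : cos (2 * th) = x / r.
  by rewrite e2 cosD -!expr2 s2 cc; field; rewrite rn0.
have es : sin (2 * th) = y / r.
  rewrite e2 sinD st.
  have -> : t * cos th * cos th + cos th * (t * cos th) = 2 * t * cos th ^+ 2 by ring.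
  by rewrite cc /t; field; rewrite rx0 rn0.
apply/eqP; rewrite eq_complex /= ec es !mul0r subr0 addr0.
by apply/andP; split; apply/eqP; field; rewrite rn0.
Qed.

End ComplexExponential.

(** * Targets on [E] reached by zero-free polynomials close to [1] *)

Section ZeroFree.
Variable R : realType.
Local Notation C := R[i].
Variable E : set C.
Hypotheses (clE : cclosed E) (onE : on_circle E) (cap0 : log_capacity E = 0).
Implicit Types (z w : C) (u v phi psi : C -> C) (p q P Q : {poly C}).

Definition zero_free Q := forall z, cabs z <= 1 -> Q.[z] != 0.

(** Closeness to [1] in the Dirichlet norm lets [Q] multiply another polynomial at almost no cost in
    that norm, and makes the notion stable under products as well as uniform limits on [E]. *)
Definition reachable phi := forall e : R, 0 < e -> exists Q,
  [/\ zero_free Q, dle (pcoef (Q - 1)) e & forall z, E z -> cabs (Q.[z] - phi z) < e].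

Lemma reachable_ext phi psi : (forall z, E z -> phi z = psi z) ->
  reachable phi -> reachable psi.
Proof.
move=> h hphi e /hphi [Q [h1 h2 h3]]; exists Q; split=> // z Ez.
by rewrite -h // h3.
Qed.

Lemma reachable_lim phi :
  (forall e : R, 0 < e -> exists2 psi, reachable psi &
     forall z, E z -> cabs (psi z - phi z) < e) -> reachable phi.
Proof.
move=> h e e0; have e20 : 0 < e / 2 by rewrite divr_gt0.
have [psi hpsi hclose] := h _ e20; have [Q [h1 h2 h3]] := hpsi _ e20.
exists Q; split=> //; first by apply: dle_le h2; lra.
move=> z Ez; apply: (le_lt_trans (cabsDD _ (psi z) _)).
have := h3 _ Ez; have := hclose _ Ez; lra.
Qed.

Lemma dle0 (e : R) : 0 <= e -> dle (pcoef (0 : {poly C})) e.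
Proof.
move=> e0 n; rewrite big1 // => k _.
by rewrite /dirichlet_weighted /pcoef coef0 cabs0 expr0n mulr0.
Qed.

Lemma reachable1 : reachable (fun=> 1).
Proof.
move=> e e0; exists 1; split.
- by move=> z _; rewrite -polyC1 hornerC oner_eq0.
- by rewrite subrr; apply: dle0; exact: ltW.
- by move=> z _; rewrite -polyC1 hornerC subrr cabs0.
Qed.

(** From [Q1 Q2 - 1 = Q1 (Q2 - 1) + (Q1 - 1)]. The multiplier constant of [Q1] is not controlled by
    the norm of [Q1 - 1], so [Q2] is chosen after [Q1]; [Q0] serves to bound [psi] on [E]. *)
Lemma reachableM phi psi : reachable phi -> reachable psi ->
  reachable (fun z => phi z * psi z).
Proof.
move=> hphi hpsi e e0.
have [Q0 [_ _ hQ0]] := hpsi 1 ltr01; have [B0 B00 hB0] := poly_bounded_on onE Q0.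
pose B := B0 + 1; have Bp : 0 < B by rewrite addr_gt0.
have hB z : E z -> cabs (psi z) <= B.
  move=> Ez; have -> : psi z = Q0.[z] - (Q0.[z] - psi z) by ring.
  by apply: (le_trans (cabsB _ _)); rewrite lerD ?hB0 // ltW ?hQ0.
pose e1 := Num.min (e / 4) (e / (2 * B)).
have e10 : 0 < e1 by rewrite lt_min !divr_gt0 // mulr_gt0.
have [Q1 [z1 d1 c1]] := hphi _ e10.
have [K K0 hK] := @dle_mull R Q1.
have [D D0 hD] := poly_bounded_on onE Q1.
pose e2 := Num.min (e / (4 * K)) (e / (2 * D)).
have e20 : 0 < e2 by rewrite lt_min !divr_gt0 // mulr_gt0.
have [Q2 [z2 d2 c2]] := hpsi _ e20.
exists (Q1 * Q2); split.
- by move=> z hz; rewrite hornerM mulf_neq0 ?z1 ?z2.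
- have := dle_add (hK _ _ d2) d1.
  have h1 : 2 * (K * e2) + 2 * e1 <= e.
    have : e2 <= e / (4 * K) by rewrite ge_min lexx.
    have : e1 <= e / 4 by rewrite ge_min lexx.
    rewrite [e2 <= _]ler_pdivlMr ?mulr_gt0 // => ? ?; lra.
  move/(dle_le h1); apply: dle_eq => k.
  have -> : Q1 * Q2 - 1 = Q1 * (Q2 - 1) + (Q1 - 1) by ring.
  by rewrite /pcoef [RHS]coefD.
- move=> z Ez; rewrite hornerM.
  have -> : Q1.[z] * Q2.[z] - phi z * psi z =
    Q1.[z] * (Q2.[z] - psi z) + psi z * (Q1.[z] - phi z) by ring.
  apply: (le_lt_trans (cabsD _ _)); rewrite !cabsM.
  have a1 : cabs Q1.[z] * cabs (Q2.[z] - psi z) <= D * cabs (Q2.[z] - psi z).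
    by rewrite ler_wpM2r ?cabs_ge0 ?hD.
  have a2 : cabs (psi z) * cabs (Q1.[z] - phi z) <= B * cabs (Q1.[z] - phi z).
    by rewrite ler_wpM2r ?cabs_ge0 ?hB.
  have a3 : D * cabs (Q2.[z] - psi z) < e / 2.
    have := c2 _ Ez; rewrite lt_min => /andP[_].
    rewrite ltr_pdivlMr ?mulr_gt0 // => a3; lra.
  have a4 : B * cabs (Q1.[z] - phi z) < e / 2.
    have := c1 _ Ez; rewrite lt_min => /andP[_].
    rewrite ltr_pdivlMr ?mulr_gt0 // => a4; lra.
  lra.
Qed.

Lemma reachableX phi n : reachable phi -> reachable (fun z => phi z ^+ n).
Proof.
move=> h; elim: n => [|n ih].
  by apply: reachable_ext reachable1 => z _; rewrite expr0.
by apply: reachable_ext (reachableM h ih) => z _; rewrite exprS.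
Qed.

Lemma reachable_small p : (forall z, cabs z <= 1 -> cabs p.[z] <= 1 / 4) ->
  reachable (fun z => 1 + p.[z]).
Proof.
move=> hp e e0; have [K K0 hK] := @dle_mull R p.
pose d := Num.min (e / K) e; have d0 : 0 < d by rewrite lt_min divr_gt0 ?e0.
have [h [h3 hE hd]] := cutoff_poly clE onE cap0 d0.
have hh := maximum_principle h3.
exists (1 + p * h); split.
- move=> z hz; rewrite hornerD hornerM -polyC1 hornerC; apply/eqP => e1.
  have : cabs (p.[z] * h.[z]) <= 1 / 4 * 3.
    by rewrite cabsM ler_pM ?cabs_ge0 ?hp ?hh.
  have -> : p.[z] * h.[z] = -1 by apply/eqP; rewrite -addr_eq0 addrC e1.
  rewrite cabsN cabs1; lra.
- have -> : 1 + p * h - 1 = p * h by ring.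
  apply: dle_le (hK _ _ hd).
  have : d <= e / K by rewrite ge_min lexx.
  by rewrite ler_pdivlMr // mulrC.
- move=> z Ez; rewrite hornerD hornerM -polyC1 hornerC.
  have -> : 1 + p.[z] * h.[z] - (1 + p.[z]) = p.[z] * (h.[z] - 1) by ring.
  rewrite cabsM; have a1 : cabs p.[z] <= 1 / 4 by rewrite hp // onE.
  have a2 := hE _ Ez; have a3 : d <= e by rewrite ge_min lexx orbT.
  have := ler_pM (cabs_ge0 _) (cabs_ge0 _) a1 a2; lra.
Qed.

Lemma reachable_cexp_poly p : reachable (fun z => cexp p.[z]).
Proof.
have [M M0 hM] := poly_bounded p.
apply: reachable_lim => e e0.
pose A := 4 * M ^+ 2 * expR M ^+ 2.
have A0 : 0 <= A by rewrite mulr_ge0 ?sqr_ge0 // mulr_ge0 ?sqr_ge0.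
(* [4 M] makes [|p/m| <= 1/4] on the disc, and [A / e] brings the exponential error below [e]. *)
pose m := (Num.truncn (4 * M + A / e)).+1.
have p1 : 0 <= 4 * M by rewrite mulr_ge0 // ltW.
have p2 : 0 <= A / e by rewrite divr_ge0 // ltW.
have /andP[_ hm] := truncn_itv (addr_ge0 p1 p2).
rewrite -/m in hm; have m0 : 0 < m%:R :> R by rewrite ltr0n.
exists (fun z => (1 + p.[z] / m%:R) ^+ m).
  apply: reachableX.
  apply: (@reachable_ext (fun z => 1 + ((m%:R^-1)%:P * p).[z])).
    by move=> z _; rewrite hornerM hornerC mulrC.
  apply: reachable_small => z hz; rewrite hornerM hornerC cabsM cabsV cabs_nat.
  rewrite mulrC ler_pdivrMr //; have := hM _ hz; lra.
move=> z Ez; have hz : cabs p.[z] <= M by apply: hM; rewrite onE.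
apply: (le_lt_trans (cexp_approx _ hz _)) => //; first lra.
rewrite -/A ltr_pdivrMr // mulrC -ltr_pdivrMr //; lra.
Qed.

Lemma reachable_cexp v : papprox E v -> reachable (fun z => cexp (v z)).
Proof.
move=> hv; have [M M0 hM] := papprox_bounded onE hv.
apply: reachable_lim => e e0.
have K0 : 0 < 3 * expR M by rewrite mulr_gt0 ?expR_gt0.
pose d := Num.min (1 / 2) (e / (3 * expR M)).
have d0 : 0 < d by rewrite lt_min !divr_gt0.
have [p hp] := hv _ d0.
exists (fun z => cexp p.[z]); first exact: reachable_cexp_poly.
move=> z Ez; have := hp _ Ez; rewrite lt_min => /andP[h1 h2].
apply: (le_lt_trans (cexp_lipschitz (hM _ Ez) (ltW h1))).
by rewrite mulrC -ltr_pdivlMr.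
Qed.

Lemma reachable_cst (c : C) : c != 0 -> reachable (fun=> c).
Proof.
move=> /cexp_surj [w hw].
by apply: reachable_ext (reachable_cexp (papprox_cst E w)) => z _.
Qed.

End ZeroFree.

(** * Logarithms of linear factors and general continuous targets *)

Section ContinuousTargets.
Variable R : realType.
Local Notation C := R[i].
Variable E : set C.
Hypotheses (clE : cclosed E) (onE : on_circle E) (cap0 : log_capacity E = 0).
Implicit Types (z w : C) (u v phi psi : C -> C) (p q P Q : {poly C}).

Lemma papprox_ccontinuous u : papprox E u -> ccontinuous_on E u.
Proof.
move=> hu z Ez e e0; have e30 : 0 < e / 3 by rewrite divr_gt0.
have [p hp] := hu _ e30; have [L L0 hL] := poly_lipschitz p.
have L1 : 0 < L + 1 by rewrite ltr_wpDl.
exists (e / 3 / (L + 1)); first by rewrite divr_gt0.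
move=> w Ew; rewrite ltr_pdivlMr // => hd.
have h1 := hp _ Ez; have h2 := hp _ Ew.
have h3 := hL z w; rewrite (onE Ez) (onE Ew) lexx in h3; have {}h3 := h3 isT isT.
have h4 := cabs_ge0 (z - w).
have h5 : L * cabs (z - w) <= cabs (z - w) * (L + 1) by rewrite mulrDr mulr1 mulrC lerDl.
apply: (le_lt_trans (cabsDD _ p.[z] _)); rewrite (cabsBC (u z)).
have := cabsDD p.[z] p.[w] (u w); lra.
Qed.

(** Expresses [ccontinuous_on] as convergence along a filter, so that limit theorems for quotients,
    [ln] and [atan] apply to [clog]. *)
Definition near_on z : set_system C :=
  filter_from [set d : R | 0 < d] (fun d => [set w | E w /\ cabs (z - w) < d]).

Lemma near_on_filter z : Filter (near_on z).
Proof.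
apply: filter_from_filter; first by exists 1 => /=.
move=> i j i0 j0; exists (Num.min i j); first by rewrite /= lt_min i0.
by move=> w [Ew]; rewrite lt_min => /andP[h1 h2].
Qed.

Lemma near_on_cvg z (r : C -> R) :
  (forall e : R, 0 < e -> exists2 d : R, 0 < d &
    forall w, E w -> cabs (z - w) < d -> `|r z - r w| < e) <->
  r @ near_on z --> r z.
Proof.
have FF := near_on_filter z; split=> [h|/cvgrPdist_lt h e e0].
  apply/cvgrPdist_lt => e /h [d d0 hd].
  by exists d => // w [Ew hw]; exact: hd.
by have [d d0 hd] := h e e0; exists d => // w Ew hw; apply: hd.
Qed.

Lemma near_on_ReIm u : ccontinuous_on E u -> forall z, E z ->
  [/\ (fun w => complex.Re (u w)) @ near_on z --> complex.Re (u z),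
      (fun w => complex.Im (u w)) @ near_on z --> complex.Im (u z) &
      (fun w => cabs (u w)) @ near_on z --> cabs (u z)].
Proof.
move=> cu z Ez; split; apply/near_on_cvg => e /(cu z Ez) [d d0 hd];
  exists d => // w Ew /(hd _ Ew); apply: le_lt_trans.
- by rewrite -raddfB; exact: ler_Re_cabs.
- by rewrite -raddfB; exact: ler_Im_cabs.
- have h1 := cabsD (u z - u w) (u w); have h2 := cabsD (u w - u z) (u z).
  rewrite !subrK (cabsBC (u w)) in h1 h2.
  by rewrite ler_norml; apply/andP; split; lra.
Qed.

Lemma clog_ccontinuous u : ccontinuous_on E u -> (forall z, E z -> slit (u z)) ->
  ccontinuous_on E (fun z => clog (u z)).
Proof.
move=> cu su z Ez e e0; have FF := near_on_filter z.
have [cre cim cab] := near_on_ReIm cu Ez.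
have sz := su _ Ez; have r0 := slit_cabs_gt0 sz.
have c1 : (fun w => ln (cabs (u w))) @ near_on z --> ln (cabs (u z)).
  exact: cvg_comp cab (continuous_ln r0).
have c2 : (fun w => 2 * atan (complex.Im (u w) / (cabs (u w) + complex.Re (u w))))
    @ near_on z --> 2 * atan (complex.Im (u z) / (cabs (u z) + complex.Re (u z))).
  apply: cvgM; first exact: cvg_cst.
  have c3 : (fun w => complex.Im (u w) / (cabs (u w) + complex.Re (u w)))
      @ near_on z --> complex.Im (u z) / (cabs (u z) + complex.Re (u z)).
    apply: cvgM => //; apply: cvgV; first by rewrite gt_eqF.
    exact: cvgD.
  exact: (cvg_comp _ _ c3 (@continuous_atan R _)).
have e20 : 0 < e / 2 by rewrite divr_gt0.
have [d1 d10 h1] := (near_on_cvg z _).2 c1 _ e20.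
have [d2 d20 h2] := (near_on_cvg z _).2 c2 _ e20.
exists (Num.min d1 d2); first by rewrite lt_min d10.
move=> w Ew; rewrite lt_min => /andP[l1 l2].
apply: (le_lt_trans (cabs_le_ReIm _)).
have := h1 _ Ew l1; have := h2 _ Ew l2; rewrite /=; lra.
Qed.

Lemma reachable_slit u : papprox E u -> (forall z, E z -> slit (u z)) -> reachable E u.
Proof.
move=> /papprox_ccontinuous cu su.
have h := papprox_continuous clE onE cap0 (clog_ccontinuous cu su).
apply: reachable_ext (reachable_cexp clE onE cap0 h) => z Ez.
by rewrite clogK // su.
Qed.

(* Otherwise a polynomial [p] is close to the conjugate on the whole circle, and
   [z p(z) - 1], small on the circle, contradicts the maximum principle at [0]. *)
Lemma circle_not_subset : exists2 t : C, cabs t = 1 & ~ E t.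
Proof.
apply: contrapT => no.
have all z : cabs z = 1 -> E z.
  by move=> hz; apply: contrapT => nE; apply: no; exists z.
have h20 : 0 < 1 / 2 :> R by rewrite divr_gt0.
have [p hp] := papprox_conj clE onE cap0 h20.
have h z : cabs z = 1 -> cabs ('X * p - 1%:P).[z] <= 1 / 2.
  move=> hz; have := hp _ (all _ hz); rewrite hornerD hornerN hornerM hornerX hornerC.
  have -> : z * p.[z] - 1 = z * (p.[z] - z^*%C).
    by rewrite mulrBr mulJ_cabs hz expr1n.
  by rewrite cabsM hz [1 * cabs _]mul1r; exact: ltW.
have := maximum_principle h (z := 0); rewrite cabs0 ler01 => /(_ isT).
rewrite hornerD hornerN hornerM hornerX hornerC mul0r sub0r cabsN cabs1; lra.
Qed.

(** If [1 - z/a = -s] with [s >= 0], then [z/a = 1 + s] has modulus at most [1], so [s = 0] and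
    [z = a], which is not in [E]. Hence [1 - z/a] has a principal logarithm on [E]. *)
Lemma reachable_outer_factor (a : C) : 1 <= cabs a -> ~ E a -> reachable E (fun z => z - a).
Proof.
move=> a1 nEa; have a0 : a != 0 by rewrite -cabs_gt0; lra.
have h : reachable E (fun z => 1 - z / a).
  apply: reachable_slit => [|z Ez].
    apply: papprox_ext (papprox_poly E (1%:P - a^-1 *: 'X)) => z _.
    by rewrite hornerD hornerN hornerZ hornerX hornerC mulrC.
  apply: slitP => s s0; apply/eqP => e.
  have e1 : z / a = ((1 + s)%:C)%C.
    have -> : z / a = 1 - (1 - z / a) by ring.
    by rewrite e -[1]/((1%:C)%C) -rmorphB opprK.
  have := congr1 (@cabs R) e1; rewrite cabsM cabsV (onE Ez) mul1r cabs_real ger0_norm; last lra.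
  have : (cabs a)^-1 <= 1 by rewrite invf_le1 //; lra.
  move=> h1 h2; have s00 : s = 0 by lra.
  move: e1; rewrite s00 addr0 => e1; apply: nEa.
  suff <- : z = a by [].
  by rewrite -[z](divfK a0) e1 mul1r.
have na : - a != 0 by rewrite oppr_eq0.
apply: reachable_ext (reachableM onE (reachable_cst clE onE cap0 na) h) => z _.
by field.
Qed.

(** For [|a| < 1], with [t] on the circle outside [E], [z - a] is [z - t] times
    [(z - a) * (z - t)^*] over [|z - t|^2]. The middle product avoids the nonpositive reals:
    otherwise [z] would be a convex combination of [a] and [t] with positive weight on [a], hence of
    modulus below [1]. *)
Lemma reachable_factor (a : C) : ~ E a -> reachable E (fun z => z - a).
Proof.
move=> nEa; have [a1|a1] := leP 1 (cabs a); first exact: reachable_outer_factor.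
have [t t1 nEt] := circle_not_subset.
have ht : reachable E (fun z => z - t) by apply: reachable_outer_factor; rewrite ?t1.
have [d d0 hd] : exists2 d : R, 0 < d & forall z, E z -> d <= cabs (z - t).
  apply: contrapT => no; apply: nEt; apply: clE => d d0.
  apply: contrapT => nw; apply: no; exists d => // z Ez.
  by rewrite leNgt cabsBC; apply/negP => lt; apply: nw; exists z.
pose b z := cabs (z - t) ^+ 2.
have hb z : E z -> d ^+ 2 <= b z <= 4.
  move=> Ez; apply/andP; split; first by rewrite lerXn2r ?nnegrE ?cabs_ge0 ?(ltW d0) ?hd.
  have -> : 4 = 2 ^+ 2 :> R by ring.
  rewrite lerXn2r ?nnegrE ?cabs_ge0 //; apply: (le_trans (cabsB _ _)).
  by rewrite (onE Ez) t1.
have d20 : 0 < d ^+ 2 by rewrite exprn_gt0.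
have pJ : papprox E (fun z => (z - t)^*%C).
  apply: papprox_ext (papproxD (papprox_conj clE onE cap0) (papprox_cst E (- t^*%C))) => z _.
  by rewrite rmorphB.
have pX (c : C) : papprox E (fun z => z - c).
  by apply: papprox_ext (papprox_poly E ('X - c%:P)) => z _; rewrite hornerXsubC.
have pb : papprox E (fun z => ((b z)%:C)%C).
  by apply: papprox_ext (papproxM onE (pX t) pJ) => z _; rewrite mulJ_cabs.
have rb : reachable E (fun z => (((b z)^-1)%:C)%C).
  apply: reachable_slit; first exact: (papprox_invr onE d20 hb pb).
  move=> z /hb /andP[h _]; rewrite /slit cabs_real /= ger0_norm ?invr_ge0; last lra.
  by rewrite addr_gt0 // invr_gt0; lra.
have rg : reachable E (fun z => (z - a) * (z - t)^*%C).
  apply: reachable_slit; first exact: papproxM.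
  move=> z Ez; apply: slitP => s s0; apply/eqP => e.
  have b0 : 0 < b z by have /andP[h _] := hb _ Ez; lra.
  have e1 : z * ((b z + s)%:C)%C = a * ((b z)%:C)%C + (s%:C)%C * t.
    have e2 : (z - a) * ((b z)%:C)%C = - (s%:C)%C * (z - t).
      by rewrite /b -mulJ_cabs [(z - t) * _]mulrC mulrA e rmorphN.
    have -> : a * ((b z)%:C)%C = z * ((b z)%:C)%C - (z - a) * ((b z)%:C)%C by ring.
    by rewrite e2 rmorphD /=; ring.
  have := congr1 (@cabs R) e1; rewrite cabsM (onE Ez) mul1r cabs_real ger0_norm; last lra.
  have := cabsD (a * ((b z)%:C)%C) ((s%:C)%C * t).
  rewrite !cabsM !cabs_real t1 (ger0_norm s0) (ger0_norm (ltW b0)) => h1 h2.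
  have : cabs a * b z < 1 * b z by rewrite ltr_pM2r.
  lra.
apply: reachable_ext (reachableM onE (reachableM onE ht rb) rg) => z Ez.
have b0 : b z != 0 by rewrite gt_eqF //; have /andP[h _] := hb _ Ez; lra.
have -> : (z - t) * (((b z)^-1)%:C)%C * ((z - a) * (z - t)^*%C) =
  (z - a) * ((z - t) * (z - t)^*%C) * (((b z)^-1)%:C)%C by ring.
by rewrite mulJ_cabs -/(b z) -mulrA -rmorphM mulfV // mulr1.
Qed.

Lemma reachable_poly p : (forall z, E z -> p.[z] != 0) -> reachable E (horner p).
Proof.
move=> hp; have [[z0 Ez0]|nE] := pselect (exists z, E z); last first.
  by apply: reachable_ext (reachable1 E) => z Ez; case: nE; exists z.
have p0 : p != 0 by apply: contra_neq (hp _ Ez0) => ->; rewrite horner0.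
have [r hr] := closed_field_poly_normal p.
have lp0 : lead_coef p != 0 by rewrite lead_coef_eq0.
have hE (a : C) : a \in r -> ~ E a.
  move=> ar Ea; have := hp _ Ea; rewrite hr hornerZ mulf_eq0 negb_or => /andP[_].
  by rewrite -rootE root_prod_XsubC ar.
have hprod : reachable E (horner (\prod_(a <- r) ('X - a%:P))).
  elim: (r) hE => [|a s ih] hE.
    by apply: reachable_ext (reachable1 E) => z _; rewrite big_nil -polyC1 hornerC.
  have ha : ~ E a by apply: hE; rewrite inE eqxx.
  have hs : reachable E (horner (\prod_(a <- s) ('X - a%:P))).
    by apply: ih => b bs; apply: hE; rewrite inE bs orbT.
  apply: reachable_ext (reachableM onE (reachable_factor ha) hs) => z _.
  by rewrite big_cons hornerM hornerXsubC.
apply: reachable_ext (reachableM onE (reachable_cst clE onE cap0 lp0) hprod) => z _.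
by rewrite [in RHS]hr hornerZ.
Qed.

Lemma ccontinuous_lower_bound phi : ccontinuous_on E phi ->
  (forall z, E z -> phi z != 0) ->
  exists2 m : R, 0 < m & forall z, E z -> m <= cabs (phi z).
Proof.
move=> cphi phi0; apply: contrapT => no.
have /choice [x hx] : forall n : nat, exists z : C, E z /\ cabs (phi z) < n.+1%:R^-1.
  move=> n; apply: contrapT => h; apply: no; exists n.+1%:R^-1; first by rewrite invr_gt0.
  by move=> z Ez; rewrite leNgt; apply/negP => lt; apply: h; exists z.
have [|c hc] := @disc_cluster R x; first by move=> n; have [/onE ->] := hx n.
have Ec : E c.
  apply: clE => e e0; have [n _ hn] := hc e 0%N e0.
  by exists (x n) => //; have [] := hx n.
have e0 : 0 < cabs (phi c) / 2 by rewrite divr_gt0 // cabs_gt0 phi0.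
have [d d0 hd] := cphi c Ec _ e0.
have [n Nn hn] := hc d (Num.truncn (cabs (phi c) / 2)^-1) d0.
have [En lt] := hx n; have := hd _ En hn.
have hn1 : n.+1%:R^-1 <= cabs (phi c) / 2.
  rewrite -[leRHS]invrK lef_pV2 ?posrE ?invr_gt0 //.
  have e0' : 0 <= (cabs (phi c) / 2)^-1 by rewrite invr_ge0 ltW.
  have /andP[_ /ltW h] := truncn_itv e0'.
  by apply: (le_trans h); rewrite ler_nat ltnS.
have := cabsD (phi c - phi (x n)) (phi (x n)); rewrite subrK.
by move: (lt_le_trans lt hn1); clear; lra.
Qed.

Lemma reachable_ccontinuous phi : ccontinuous_on E phi ->
  (forall z, E z -> phi z != 0) -> reachable E phi.
Proof.
move=> cphi phi0; have [m m0 hm] := ccontinuous_lower_bound cphi phi0.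
apply: reachable_lim => e e0.
(* The tolerance [m], a lower bound of [|phi|] on [E], keeps the approximating polynomial from
   vanishing there. *)
have d0 : 0 < Num.min e m by rewrite lt_min e0.
have [p hp] := papprox_continuous clE onE cap0 cphi d0.
exists (horner p) => [|z Ez]; last by apply: lt_le_trans (hp _ Ez) _; rewrite ge_min lexx.
apply: reachable_poly => z Ez; apply/eqP => e1.
have := hp _ Ez; rewrite e1 sub0r cabsN lt_min => /andP[_].
by rewrite ltNge hm.
Qed.

Lemma ccontinuousV phi : ccontinuous_on E phi -> (forall z, E z -> phi z != 0) ->
  ccontinuous_on E (fun z => (phi z)^-1).
Proof.
move=> cphi phi0; have [m m0 hm] := ccontinuous_lower_bound cphi phi0.
move=> z Ez e e0; have e1 : 0 < e * m ^+ 2 by rewrite mulr_gt0 // exprn_gt0.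
have [d d0 hd] := cphi z Ez _ e1; exists d => // w Ew hw.
have -> : (phi z)^-1 - (phi w)^-1 = (phi w - phi z) / (phi z * phi w).
  by field; rewrite !phi0.
have zw0 : 0 < cabs (phi z * phi w) by rewrite cabs_gt0 mulf_neq0 ?phi0.
rewrite cabsM cabsV cabsBC ltr_pdivrMr //; apply: (lt_le_trans (hd _ Ew hw)).
by rewrite ler_wpM2l ?(ltW e0) // cabsM expr2 ler_pM ?hm // ltW.
Qed.

Lemma reachable_quotient phi p : ccontinuous_on E phi ->
  (forall z, E z -> phi z != 0) -> (forall z, E z -> p.[z] != 0) ->
  reachable E (fun z => phi z / p.[z]).
Proof.
move=> cphi phi0 p0.
have pc := papprox_ccontinuous (papprox_poly E p).
apply: reachable_ccontinuous => [|z Ez]; last by rewrite mulf_neq0 ?invr_eq0 ?phi0 ?p0.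
apply: papprox_ccontinuous; apply: papproxM => //.
  exact: papprox_continuous.
exact: papprox_continuous (ccontinuousV pc p0).
Qed.

End ContinuousTargets.

(** * Dilation and conclusion *)

Section Dilation.
Variable R : realType.
Local Notation C := R[i].
Variable a : nat -> C.
Hypothesis da : in_dirichlet a.
Implicit Types (z w c : C) (r e : R).

Lemma dirichlet_series_le n :
  \sum_(k < n) dirichlet_weighted a k <= limn (series (dirichlet_weighted a)).
Proof.
have h : {homo series (dirichlet_weighted a) : m k / (m <= k)%N >-> m <= k}.
  by apply: nondecreasing_series => k _ _; exact: dirichlet_weighted_ge0.
have := nondecreasing_cvgn_le h da n.
by rewrite /series /= big_mkord.
Qed.

Lemma coef_bounded : exists2 A : R, 0 < A & forall k, cabs (a k) <= A.
Proof.
pose L := limn (series (dirichlet_weighted a)).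
have L0 : 0 <= L by have := dirichlet_series_le 0; rewrite big_ord0.
exists (L + 1); first by rewrite ltr_wpDl.
move=> k; have h1 : cabs (a k) ^+ 2 <= L.
  apply: le_trans (dirichlet_series_le k.+1); rewrite big_ord_recr /=.
  apply: ler_wpDl; first by apply: sumr_ge0 => i _; exact: dirichlet_weighted_ge0.
  by rewrite /dirichlet_weighted ler_peMl ?sqr_ge0 // ler1n.
by have := sqr_ge0 (cabs (a k) - 1); rewrite sqrrB expr1n; lra.
Qed.

Definition dilate r n : {poly C} := \poly_(k < n) (a k * ((r%:C)%C) ^+ k).

Lemma horner_dilate r n z : (dilate r n).[z] = psum a ((r%:C)%C * z) n.
Proof. by rewrite horner_poly; apply: eq_bigr => k _; rewrite exprMn mulrA. Qed.

Lemma dilate_tail (A r : R) n j z : (forall k, cabs (a k) <= A) -> 0 <= r -> r < 1 ->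
  cabs z <= 1 ->
  cabs ((dilate r n).[z] - (dilate r (n + j)).[z]) <= A * (r ^+ n - r ^+ (n + j)) / (1 - r).
Proof.
move=> hA r0 r1 hz; have r10 : 1 - r != 0 by rewrite gt_eqF // subr_gt0.
elim: j => [|j ih]; first by rewrite addn0 !subrr cabs0 mulr0 mul0r.
have -> : (dilate r (n + j.+1)).[z] =
    (dilate r (n + j)).[z] + a (n + j)%N * (r%:C)%C ^+ (n + j) * z ^+ (n + j).
  by rewrite addnS /dilate !horner_poly big_ord_recr.
rewrite addnS opprD addrA; apply: (le_trans (cabsB _ _)).
have -> : A * (r ^+ n - r ^+ (n + j).+1) / (1 - r) =
    A * (r ^+ n - r ^+ (n + j)) / (1 - r) + A * r ^+ (n + j) * 1.
  by rewrite exprS; field.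
apply: lerD => //; rewrite !cabsM !cabsX cabs_real (ger0_norm r0).
have A0 : 0 <= A by apply: le_trans (hA 0%N); exact: cabs_ge0.
have c0 : 0 <= cabs z by exact: cabs_ge0.
apply: ler_pM; rewrite ?mulr_ge0 ?cabs_ge0 ?exprn_ge0 //; last by rewrite exprn_ile1.
by rewrite ler_wpM2r ?exprn_ge0.
Qed.

(* Otherwise zeros [x n] of [dilate r n] in the disc accumulate at some [c],
   and the power series vanishes at [r * c]. *)
Lemma dilate_zero_free r N : 0 <= r -> r < 1 ->
  (forall z w, cabs z < 1 -> pseries_to a z w -> w != 0) ->
  exists2 n, (N <= n)%N & zero_free (dilate r n).
Proof.
move=> r0 r1 nz; apply: contrapT => no.
have /choice [x hx] : forall j, exists z : C, cabs z <= 1 /\ (dilate r (N + j)).[z] = 0.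
  move=> j; apply: contrapT => h; apply: no; exists (N + j)%N; first exact: leq_addr.
  by move=> z hz; apply/eqP => e; apply: h; exists z.
have [|c hc] := @disc_cluster R x; first by move=> n; have [] := hx n.
have c1 : cabs c <= 1.
  apply/ler_addgt0Pr => e e0; have [n _ hn] := hc e 0%N e0; have [xn _] := hx n.
  by have := cabsD (c - x n) (x n); rewrite subrK; lra.
have [A A0 hA] := coef_bounded.
have r10 : 0 < 1 - r by rewrite subr_gt0.
(* Passing from [c] to a nearby zero [x j] of a longer partial sum costs a Lipschitz term, and
   passing to that longer sum a geometric tail. *)
have bnd n : cabs (psum a ((r%:C)%C * c) n - 0) <= A / (1 - r) * r ^+ n.
  rewrite subr0 -horner_dilate; apply/ler_addgt0Pr => e e0.
  have [L L0 hL] := poly_lipschitz (dilate r n).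
  have L1 : 0 < L + 1 by rewrite ltr_wpDl.
  have [j nj hj] := hc (e / (L + 1)) n (divr_gt0 e0 L1).
  have [xj zj] := hx j.
  have h1 := hL _ _ c1 xj; have h2 := cabs_ge0 (c - x j).
  rewrite ltr_pdivlMr // in hj.
  have nNj : (n <= N + j)%N by rewrite (leq_trans nj) ?leq_addl.
  have := dilate_tail n (N + j - n) hA r0 r1 xj; rewrite subnKC // zj subr0 => h3.
  have h4 : A * (r ^+ n - r ^+ (N + j)) / (1 - r) <= A / (1 - r) * r ^+ n.
    rewrite mulrAC ler_wpM2l ?divr_ge0 ?(ltW A0) ?(ltW r10) //.
    by rewrite gerBl exprn_ge0.
  have := cabsD ((dilate r n).[c] - (dilate r n).[x j]) ((dilate r n).[x j]).
  rewrite subrK mulrDr mulr1 in hj *; lra.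
have lim : pseries_to a ((r%:C)%C * c) 0.
  apply: (@squeeze_cvgr _ _ _ _ (fun=> 0) (fun n => A / (1 - r) * r ^+ n)).
  - by apply: nearW => n; rewrite cabs_ge0 bnd.
  - exact: cvg_cst.
  - rewrite -[X in _ --> X](mulr0 (A / (1 - r))); apply: cvgM; first exact: cvg_cst.
    by apply: cvg_expr; rewrite ger0_norm.
have := nz ((r%:C)%C * c) 0 _ lim; rewrite eqxx => h.
suff : false by []; apply: h; rewrite cabsM cabs_real ger0_norm //.
by apply: le_lt_trans r1; rewrite ler_piMr.
Qed.

Lemma expr_ge_1sub r n : 0 <= r -> r <= 1 -> 1 - n%:R * (1 - r) <= r ^+ n.
Proof.
move=> r0 r1; elim: n => [|n ih]; first by rewrite mul0r subr0.
rewrite exprS -natr1; have rn : r ^+ n <= 1 by rewrite exprn_ile1.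
have : (1 - r) * r ^+ n <= (1 - r) * 1 by rewrite ler_wpM2l // subr_ge0.
by move: ih; move: (r ^+ n) (n%:R : R) => s m; clear; lra.
Qed.

Lemma tail_sum N m : \sum_(k < m) (if (k < N)%N then 0 else dirichlet_weighted a k) =
  \sum_(k < maxn m N) dirichlet_weighted a k - \sum_(k < N) dirichlet_weighted a k.
Proof.
elim: m => [|m ih]; first by rewrite big_ord0 max0n subrr.
rewrite big_ord_recr /= ih; case: ltnP => mN.
  by rewrite addr0 (maxn_idPr mN).
rewrite (maxn_idPl (leq_trans mN (leqnSn m))) big_ord_recr /=; ring.
Qed.

Lemma dilate_coefB (u : C) r k : u * (r%:C)%C ^+ k - u = - ((1 - r ^+ k)%:C)%C * u.
Proof. by rewrite rmorphB rmorphXn rmorph1; ring. Qed.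

(** [N] makes the tail of the norm at most [e/2]; then [r] is taken close enough to [1] to move the
    first [N] coefficients little; finally [n >= N] is a zero-free truncation. From [N] on, each
    error is at most the weighted coefficient of [a], whether dilated or cut off. *)
Lemma zero_free_approximation e : 0 < e ->
  (forall z w, cabs z < 1 -> pseries_to a z w -> w != 0) ->
  exists2 G, zero_free G & dle (fun k => pcoef G k - a k) e.
Proof.
move=> e0 nz; pose L : R := limn (series (dirichlet_weighted a)).
have L0 : 0 <= L by have := dirichlet_series_le 0; rewrite big_ord0.
have e20 : 0 < e / 2 by rewrite divr_gt0.
have [N hN] : exists N, L - \sum_(k < N) dirichlet_weighted a k <= e / 2.
  have /cvgrPdist_le /(_ _ e20) [N _ hN] := da.
  exists N; have := hN N (leqnn N); rewrite /= /series /= big_mkord => h.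
  exact: le_trans (ler_norm _) h.
(* By Bernoulli [1 - r^N <= N (1 - r)], so [1 - r <= e/K] gives [(1 - r^N) L <= e/2]. *)
pose K := 2 * N.+1%:R * (L + 1).
have K0 : 0 < K by rewrite !mulr_gt0 // ltr_wpDl.
pose r : R := 1 - Num.min 1 (e / K).
have m0 : 0 < Num.min 1 (e / K) by rewrite lt_min ltr01 divr_gt0.
have m1 : Num.min 1 (e / K) <= 1 by rewrite ge_min lexx.
have m2 : Num.min 1 (e / K) <= e / K by rewrite ge_min lexx orbT.
have r0 : 0 <= r by rewrite subr_ge0.
have r1 : r < 1 by rewrite /r ltrBlDr ltrDl.
have rN : (1 - r ^+ N) * L <= e / 2.
  have h1 := expr_ge_1sub N r0 (ltW r1).
  have h2 : 1 - r ^+ N <= N.+1%:R * (e / K).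
    have : N%:R * (1 - r) <= N.+1%:R * (e / K).
      apply: ler_pM => //; rewrite ?ler_nat //; first by rewrite subr_ge0 ltW.
      by rewrite /r opprB addrCA subrr addr0.
    lra.
  have h3 : N.+1%:R * (e / K) * (L + 1) = e / 2.
    have aux (u v : R) : u != 0 -> v != 0 -> u * (e / (2 * u * v)) * v = e / 2.
      by move=> u0 v0; field; rewrite u0 v0.
    by apply: aux; rewrite gt_eqF // ltr_wpDl.
  have h4 : 0 <= N.+1%:R * (e / K) by rewrite mulr_ge0 // divr_ge0 // ltW.
  have := ler_wpM2r L0 h2; lra.
have [n Nn zf] := dilate_zero_free N r0 r1 nz.
exists (dilate r n) => // m.
have term k : dirichlet_weighted (fun k => pcoef (dilate r n) k - a k) k <=
    (1 - r ^+ N) * dirichlet_weighted a k + (if (k < N)%N then 0 else dirichlet_weighted a k).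
  have rk0 : 0 <= r ^+ k by exact: exprn_ge0.
  have rk1 : r ^+ k <= 1 by rewrite exprn_ile1 // ltW.
  have rN1 : r ^+ N <= 1 by rewrite exprn_ile1 // ltW.
  have w0 := dirichlet_weighted_ge0 a k.
  have w1 : 0 <= (1 - r ^+ N) * dirichlet_weighted a k by rewrite mulr_ge0 // subr_ge0.
  have [kn|kn] := ltnP k n; last first.
    rewrite ltnNge (leq_trans Nn kn) /= {1}/dirichlet_weighted /pcoef coef_poly ltnNge kn /=.
    by rewrite sub0r cabsN lerDr.
  have -> : dirichlet_weighted (fun k => pcoef (dilate r n) k - a k) k =
      (1 - r ^+ k) ^+ 2 * dirichlet_weighted a k.
    rewrite /dirichlet_weighted /pcoef coef_poly kn dilate_coefB.
    by rewrite cabsM cabsN cabs_real exprMn real_normK ?num_real // mulrCA.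
  have q0 : 0 <= 1 - r ^+ k by rewrite subr_ge0.
  case: ltnP => kN.
    rewrite addr0 ler_wpM2r //; apply: (@le_trans _ _ (1 - r ^+ k)).
      by rewrite expr2 ler_piMr // gerBl.
    by rewrite lerD2l lerN2 ler_wiXn2l //; [exact: ltW | exact: ltnW].
  apply: ler_wpDl => //; rewrite ler_piMl // exprn_ile1 // gerBl //.
apply: (le_trans (ler_sum _ (fun (k : 'I_m) _ => term k))).
rewrite big_split /= -mulr_sumr tail_sum.
have h1 := dirichlet_series_le m; have h2 := dirichlet_series_le (maxn m N).
have h3 : (1 - r ^+ N) * \sum_(k < m) dirichlet_weighted a k <= (1 - r ^+ N) * L.
  by rewrite ler_wpM2l // subr_ge0 exprn_ile1 // ltW.
rewrite -/L in h2; lra.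
Qed.

End Dilation.

Lemma dirichlet_norm_le (R : realType) (b : nat -> R[i]) (e : R) :
  0 <= e -> dle b (e ^+ 2) -> dirichlet_norm b <= e.
Proof.
move=> e0 hb; rewrite -[leRHS](ger0_norm e0) -sqrtr_sqr ler_wsqrtr //.
have hs n : series (dirichlet_weighted b) n <= e ^+ 2.
  by rewrite /series /= big_mkord; exact: hb.
apply: limr_le; last exact: nearW.
apply: nondecreasing_is_cvgn.
  by apply: nondecreasing_series => k _ _; exact: dirichlet_weighted_ge0.
by exists (e ^+ 2) => _ [n _ <-].
Qed.

Lemma simultaneous_approximation (R : realType) (E : set R[i]) (a : nat -> R[i])
    (f : R[i] -> R[i]) (e : R) :
  cclosed E -> on_circle E -> log_capacity E = 0 -> in_dirichlet a ->
  (forall z w, cabs z < 1 -> pseries_to a z w -> w != 0) ->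
  ccontinuous_on E f -> (forall z, E z -> f z != 0) -> 0 < e ->
  exists P : {poly R[i]}, [/\ zero_free P, dle (fun k => pcoef P k - a k) e &
    forall z, E z -> cabs (P.[z] - f z) < e].
Proof.
move=> clE onE cap0 da nz cf f0 e0.
have [G Gz Gd] := zero_free_approximation da (divr_gt0 e0 (ltr0n R 4)) nz.
have [K K0 hK] := dle_mull G; have [D D0 hD] := poly_bounded_on onE G.
have GE z : E z -> G.[z] != 0 by move=> Ez; rewrite Gz // onE.
(* [Q] is chosen after [G]: [K] controls [G (Q - 1)] in the Dirichlet norm, and [D] controls
   [G (Q - f/G)] on [E]. *)
pose d := Num.min (e / (4 * K)) (e / D).
have d0 : 0 < d by rewrite lt_min !divr_gt0 // mulr_gt0.
have [Q [Qz Qd QE]] := reachable_quotient clE onE cap0 cf f0 GE d0.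
exists (G * Q); split.
- by move=> z hz; rewrite hornerM mulf_neq0 ?Gz ?Qz.
- have := dle_add (hK _ _ Qd) Gd.
  have h1 : 2 * (K * d) + 2 * (e / 4) <= e.
    have : d <= e / (4 * K) by rewrite ge_min lexx.
    rewrite ler_pdivlMr ?mulr_gt0 // => ?; lra.
  move/(dle_le h1); apply: dle_eq => k.
  by rewrite addrA /pcoef mulrBr mulr1 coefB subrK.
- move=> z Ez; rewrite hornerM.
  have -> : G.[z] * Q.[z] - f z = G.[z] * (Q.[z] - f z / G.[z]).
    by field; rewrite GE.
  rewrite cabsM; apply: (@le_lt_trans _ _ (D * cabs (Q.[z] - f z / G.[z]))).
    by rewrite ler_wpM2r ?cabs_ge0 ?hD.
  have := QE _ Ez; rewrite lt_min => /andP[_].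
  by rewrite ltr_pdivlMr // mulrC.
Qed.

Theorem theorem4p2 (R : realType) (E : set R[i]) (a : nat -> R[i])
    (f : R[i] -> R[i]) :
  cclosed E -> on_circle E -> log_capacity E = 0 ->
  in_dirichlet a ->
  (forall z w, cabs z < 1 -> pseries_to a z w -> w != 0) ->
  ccontinuous_on E f -> (forall z, E z -> f z != 0) ->
  exists P : nat -> {poly R[i]},
    (forall n z, cabs z <= 1 -> (P n).[z] != 0) /\
    (fun n => dirichlet_norm (fun k => pcoef (P n) k - a k)) @ \oo --> (0 : R) /\
    (forall e : R, 0 < e -> \forall n \near \oo,
        forall z, E z -> cabs ((P n).[z] - f z) < e).
Proof.
move=> clE onE cap0 da nz cf f0.
have i0 n : 0 < (n.+1%:R : R)^-1 by rewrite invr_gt0.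
(* The tolerance is [(n + 1)^-2] because [dle] bounds the squared norm; the norm itself is then at
   most [1 / (n + 1)]. *)
have /choice [P hP] n := simultaneous_approximation clE onE cap0 da nz cf f0
  (exprn_gt0 2 (i0 n)).
exists P; split; [|split].
- by move=> n; have [] := hP n.
- apply: (@squeeze_cvgr _ _ _ _ (fun=> 0) (fun n : nat => n.+1%:R^-1)).
  + apply: nearW => n; apply/andP; split; first exact: sqrtr_ge0.
    by apply: dirichlet_norm_le; [exact: ltW (i0 n) | have [] := hP n].
  + exact: cvg_cst.
  + exact: cvg_harmonic.
- move=> e e0; have : (fun n : nat => (n.+1%:R : R)^-1) @ \oo --> (0 : R) by exact: cvg_harmonic.
  move=> /cvgrPdist_lt /(_ e e0); apply: filterS => n /=.
  rewrite sub0r normrN gtr0_norm // => lt z Ez; have [_ _ h] := hP n.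
  apply: lt_trans (lt_le_trans (h _ Ez) _) lt.
  by rewrite expr2 ler_piMl ?(ltW (i0 n)) // invf_le1 // ler1n.
Qed.
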